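(* Let $H=\{(x,x_{n+1})\in\mathbb{R}^n\times\mathbb{R}: x_{n+1}=0\}\subset\mathbb{R}^{n+1}$, where $\mathbb{R}^{n+1}$ carries the Euclidean metric, and let $K\subset H$ be a convex Euclidean billiard table (whose boundary $\partial K$ is of class $C^{2,1}$). Let $p_0\in\partial K$. Then there exist an open bounded neighborhood $U\subset\mathbb{R}^{n+1}$ of $p_0$ and a function $f\in C^{2,1}(K\cap\overline U)$ defining $K$ near $p_0$ (i.e. $f\ge 0$ on $K\cap U$, $\partial K\cap U=\{x\in K\cap U: f(x)=0\}$, and $\nabla f\neq 0$ on the zero set of $f$) such that, writing for $\lambda\in(0,1)$ $$M_\lambda=\{(x,x_{n+1})\in\mathbb{R}^{n+1}:\ x_{n+1}^2=\lambda^2 f(x),\ x\in K\cap U\}$$ with the Riemannian metric $g_\lambda$ induced by the Euclidean metric, the following holds. There is $T>0$ such that every billiard trajectory $\gamma:[-T,T]\to K$ with $\gamma(0)=p_0$ which touches $\partial K$ at $p_0$ transversally is the uniform limit on $[-T,T]$ of a sequence of arclength-parameterized geodesic segments $$\{\gamma_k:[-T,T]\to M_{\lambda_k}\}_{k\in\mathbb{N}}$$ with $\gamma_k(0)=p_0$ for all $k\in\mathbb{N}$, where $\lambda_k\in(0,1)$ and $\lambda_k\to 0^+$ as $k\to\infty$.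
   Context: Conventions. $\mathbb{R}^n$ is identified with $H$ via $x\mapsto(x,0)$, so $f(x)$ makes sense for points of $K\subset H$. A function is of class $C^{2,1}$ on the closure of a set $\Omega$ (connected, non-empty interior) if it is $C^2$ in the interior of $\Omega$ with Lipschitz second derivatives and it and all its first and second derivatives extend continuously to the boundary. The boundary $\partial K$ is of class $C^{2,1}$ if near each boundary point there is a defining function $f$ of class $C^{2,1}$ as in the claim (nonnegative on $K$ near the point, vanishing there exactly on $\partial K$, with nonvanishing gradient on its zero set). Billiard table. A (Euclidean) billiard table $K\subset H$ is the closure of an open connected subset of $H\cong\mathbb{R}^n$ whose boundary is of class $C^{2,1}$, with the induced Euclidean metric. It is convex if $K$ is a convex set. Billiard trajectory. A Lipschitz curve $c$ is regular if it has one-sided derivatives $c'_\pm(t)$ at every time; set $c^+(t)=c'_+(t)$ and $c^-(t)=-c'_-(t)$. For $x_0\in\partial K$ let $\nu(x_0)$ be the unit normal to $\partial K$ pointing into $K$ and $C_{x_0}(K)=\{\tilde w+r\,\nu(x_0): \tilde w\in T_{x_0}(\partial K),\ r\ge 0\}$. Unit vectors $u,v\in C_{x_0}(K)$ are polar if $\langle u+v,w\rangle\ge 0$ for all $w\in C_{x_0}(K)$ (equivalently, $u,v$ satisfy the usual reflection law). A billiard trajectory is a Lipschitz regular curve $c:[a,b]\to K$, parameterized by arclength, which is locally length-minimizing at all times except the finite set of bounce times $\mathcal{T}=\{\tau\in[a,b]:c(\tau)\in\partial K\}$, and such that $c^+(\tau)$ and $c^-(\tau)$ are polar for every $\tau\in\mathcal{T}$.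 Only trajectories with finitely many, transverse reflections are considered; touching $\partial K$ at $p_0=\gamma(0)$ transversally means that the one-sided tangent vectors at time $0$ are not tangent to $\partial K$. *)

(* Defs.v *)
From HB Require Import structures.
From mathcomp Require Import all_boot all_order all_algebra.
From mathcomp Require Import all_classical all_reals all_analysis.

Set Implicit Arguments.
Unset Strict Implicit.
Unset Printing Implicit Defensive.

Import Order.TTheory GRing.Theory Num.Theory.
Import numFieldNormedType.Exports.

Local Open Scope classical_set_scope.
Local Open Scope ring_scope.

(* The library norm on row vectors is the sup norm.  It is used below only for
   notions that do not depend on the choice of a norm (topology, boundedness,
   Lipschitz continuity, derivatives, uniform convergence); lengths and angles
   use the Euclidean structure [dot], [enorm]. *)

Section Euclidean.
Context {R : realType}.

Definition dot n (u v : 'rV[R]_n) : R := (u *m v^T) 0 0.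

Definition enorm n (u : 'rV[R]_n) : R := Num.sqrt (dot u u).

(* The point (x, z) of R^n x R. *)
Definition pt n (x : 'rV[R]_n) (z : R) : 'rV[R]_(n + 1) :=
  row_mx x (const_mx z).

Definition emb n (x : 'rV[R]_n) : 'rV[R]_(n + 1) := pt x 0.

Definition slice n (U : set 'rV[R]_(n + 1)) : set 'rV[R]_n :=
  [set x | U (emb x)].

Definition boundary n (A : set 'rV[R]_n) : set 'rV[R]_n :=
  closure A `\` A°.

End Euclidean.

Section Curves.
Context {R : realType}.

(* Same shape as [variation] and [total_variation], for vector-valued maps and
   the Euclidean norm. *)
Definition polygon_length n (c : R -> 'rV[R]_n) (a b : R) (s : seq R) : R :=
  let F := c \o nth b (a :: s) in
  \sum_(0 <= i < size s) enorm (F i.+1 - F i).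

Definition curve_length n (c : R -> 'rV[R]_n) (a b : R) : \bar R :=
  ereal_sup [set (polygon_length c a b s)%:E | s in itv_partition a b].

Definition length_minimizing n (K : set 'rV[R]_n) (c : R -> 'rV[R]_n)
    (a b : R) : Prop :=
  forall d : R -> 'rV[R]_n,
    {within `[a, b], continuous d} ->
    (forall t, a <= t <= b -> K (d t)) ->
    d a = c a -> d b = c b ->
    (curve_length c a b <= curve_length d a b)%E.

Definition locally_length_minimizing_at n (K : set 'rV[R]_n)
    (c : R -> 'rV[R]_n) (a b t : R) : Prop :=
  exists2 delta : R, 0 < delta &
    length_minimizing K c (Num.max a (t - delta)) (Num.min b (t + delta)).

Definition diff_quotient n (c : R -> 'rV[R]_n) (t h : R) : 'rV[R]_n :=
  h^-1 *: (c (t + h) - c t).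

Definition right_derive n (c : R -> 'rV[R]_n) (t : R) : 'rV[R]_n :=
  lim (diff_quotient c t h @[h --> 0^'+]).

Definition left_derive n (c : R -> 'rV[R]_n) (t : R) : 'rV[R]_n :=
  lim (diff_quotient c t h @[h --> 0^'-]).

Definition regular_curve n (c : R -> 'rV[R]_n) (a b : R) : Prop :=
  (forall t, a <= t < b -> cvg (diff_quotient c t h @[h --> 0^'+])) /\
  (forall t, a < t <= b -> cvg (diff_quotient c t h @[h --> 0^'-])).

(* c^+ and c^-: both point away from c t. *)
Definition cplus n (c : R -> 'rV[R]_n) (t : R) : 'rV[R]_n := right_derive c t.
Definition cminus n (c : R -> 'rV[R]_n) (t : R) : 'rV[R]_n := - left_derive c t.

Definition tangent_vector n (M : set 'rV[R]_n) (p v : 'rV[R]_n) : Prop :=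
  exists c : R -> 'rV[R]_n,
    [/\ \forall t \near 0, M (c t), c 0 = p & is_derive (0 : R) (1 : R) c v].

(* Arclength-parameterized geodesic of a submanifold M with the metric induced
   by the Euclidean one.  The Levi-Civita covariant derivative of c' along c is
   the component of c'' tangent to M, so that c is a geodesic exactly when c''
   is orthogonal to M.  Derivatives are taken in the open interval; at the end
   points the curve is continuous and still in M. *)
Definition unit_geodesic_segment n (M : set 'rV[R]_n) (a b : R)
    (c : R -> 'rV[R]_n) : Prop :=
  [/\ forall t, a <= t <= b -> M (c t),
      {within `[a, b], continuous c} &
      forall t, a < t < b ->
        [/\ derivable c t 1, derivable (derive1 c) t 1,
            enorm (derive1 c t) = 1 &
            forall v, tangent_vector M (c t) v ->
              dot (derive1 (derive1 c) t) v = 0]].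

End Curves.

Section Tables.
Context {R : realType}.

(* f is of class C^{2,1} on the closure of Omega; df and d2f are the continuous
   extensions to closure Omega of its gradient and of its Hessian. *)
Definition C21_closure n (Omega : set 'rV[R]_n) (f : 'rV[R]_n -> R)
    (df : 'rV[R]_n -> 'rV[R]_n) (d2f : 'rV[R]_n -> 'M[R]_n) : Prop :=
  (connected Omega /\ Omega° !=set0) /\
  [/\ {within closure Omega, continuous f},
      {within closure Omega, continuous df} &
      {within closure Omega, continuous d2f}] /\
  [/\ forall x, Omega° x -> forall i : 'I_n,
        is_derive x (delta_mx 0 i : 'rV[R]_n) f (df x 0 i),
      forall x, Omega° x -> forall i j : 'I_n,
        is_derive x (delta_mx 0 j : 'rV[R]_n) (fun y => df y 0 i) (d2f x i j) &
      [lipschitz d2f x | x in Omega°]].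

(* The pair f, df (a function and its gradient) defines K near p; U is an open
   set of R^{n+1}, and slice U is its trace on the hyperplane H, identified with
   R^n. *)
Definition defining_near n (K : set 'rV[R]_n) (p : 'rV[R]_n)
    (U : set 'rV[R]_(n + 1)) (f : 'rV[R]_n -> R)
    (df : 'rV[R]_n -> 'rV[R]_n) : Prop :=
  [/\ open U, bounded_set U & U (emb p)] /\
  (exists d2f, C21_closure (K `&` slice (closure U)) f df d2f) /\
  [/\ forall x, K x -> U (emb x) -> 0 <= f x,
      boundary K `&` slice U =
        [set x | [/\ K x, U (emb x) & f x = 0]] &
      forall x, K x -> closure U (emb x) -> f x = 0 -> df x != 0].

Definition billiard_table n (K : set 'rV[R]_n) : Prop :=
  (exists O : set 'rV[R]_n, [/\ open O, connected O & K = closure O]) /\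
  (forall p, boundary K p -> exists U f df, defining_near K p U f df).

(* The gradient of a defining function is normal to the boundary; it points
   into K because the function is nonnegative on K. *)
Definition inner_unit_normal n (K : set 'rV[R]_n) (x nu : 'rV[R]_n) : Prop :=
  exists U f df,
    defining_near K x U f df /\ nu = (enorm (df x))^-1 *: df x.

Definition boundary_tangent n (K : set 'rV[R]_n) (x : 'rV[R]_n) :
    set 'rV[R]_n :=
  [set w | forall nu, inner_unit_normal K x nu -> dot w nu = 0].

Definition tangent_cone n (K : set 'rV[R]_n) (x : 'rV[R]_n) :
    set 'rV[R]_n :=
  [set z | exists w r nu,
     [/\ boundary_tangent K x w, 0 <= r, inner_unit_normal K x nu &
         z = w + r *: nu]].

Definition polar n (K : set 'rV[R]_n) (x u v : 'rV[R]_n) : Prop :=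
  [/\ enorm u = 1, enorm v = 1, tangent_cone K x u, tangent_cone K x v &
      forall w, tangent_cone K x w -> 0 <= dot (u + v) w].

Definition transversal_at n (K : set 'rV[R]_n) (c : R -> 'rV[R]_n) (t : R) :
    Prop :=
  ~ boundary_tangent K (c t) (cplus c t) /\
  ~ boundary_tangent K (c t) (cminus c t).

Definition bounce_times n (K : set 'rV[R]_n) (a b : R) (c : R -> 'rV[R]_n) :
    set R :=
  [set t | a <= t <= b /\ boundary K (c t)].

(* At a bounce time equal to a or b only one of c^+, c^- exists, so that the
   reflection law is a condition on the bounce times in the open interval. *)
Definition billiard_trajectory n (K : set 'rV[R]_n) (a b : R)
    (c : R -> 'rV[R]_n) : Prop :=
  (forall t, a <= t <= b -> K (c t)) /\
  [/\ [lipschitz c t | t in `[a, b]],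
      regular_curve c a b &
      forall s t, a <= s -> s <= t -> t <= b ->
        curve_length c s t = (t - s)%:E] /\
  [/\ finite_set (bounce_times K a b c),
      forall t, a <= t <= b -> ~ bounce_times K a b c t ->
        locally_length_minimizing_at K c a b t,
      forall t, a < t < b -> bounce_times K a b c t ->
        polar K (c t) (cplus c t) (cminus c t) &
      forall t, a < t < b -> bounce_times K a b c t -> transversal_at K c t].

Definition Mlambda n (K : set 'rV[R]_n) (U : set 'rV[R]_(n + 1))
    (f : 'rV[R]_n -> R) (lambda : R) : set 'rV[R]_(n + 1) :=
  [set p | exists x z,
     [/\ p = pt x z, K x, U (emb x) & z ^+ 2 = lambda ^+ 2 * f x]].

End Tables.

(* Main.v *)
(* A geodesic of M_lambda, seen in the table, solves x'' = m grad f(x) with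
   m (lambda^2 |grad f|^2 + 4 f) = 2 z'^2 - lambda^2 Hess f (x', x'),
   |x'|^2 + z'^2 = 1 and 4 f z'^2 = lambda^2 <grad f, x'>^2.  Where f >= eps the
   force is O(lambda^2), so x moves almost on a straight line.  During a
   passage near a boundary point p the force is nearly parallel to grad f(p) and
   has bounded total impulse, so the tangential velocity is almost conserved.
   The function f^2 + (C/2) lambda^2 f is uniformly convex along a transversal
   passage, which forces x to leave the boundary layer f <= eps within a time
   O(eps); then z' is small again, so conservation of energy makes the outgoing
   velocity that of the reflection law.

   To have geodesics through p0 itself, f must be of class C^{2,1} on a full
   neighbourhood of p0 and not only in K.  For this, f(x) is taken to be the
   signed distance of x to the boundary of K measured along a fixed direction e
   pointing into K; convexity makes it Lipschitz, and it inherits C^{2,1}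
   regularity from a given defining function.

   The geodesics started at p0 with the tangential velocity of the given
   trajectory then follow it, bounce after bounce, as lambda tends to 0, and
   backwards in time as well since both notions are reversible; curves with
   unit speed that converge pointwise converge uniformly. *)
Require Import Defs.
From HB Require Import structures.
From mathcomp Require Import all_boot all_order all_algebra.
From mathcomp Require Import all_classical all_reals all_analysis.
From mathcomp Require Import ring lra.
Set Implicit Arguments.
Unset Strict Implicit.
Unset Printing Implicit Defensive.
Import Order.TTheory GRing.Theory Num.Theory.
Import numFieldNormedType.Exports.
Local Open Scope classical_set_scope.
Local Open Scope ring_scope.

(** * Euclidean norm and derivatives along curves *)

Section dot_product.
Context {R : realType} {n : nat}.
Implicit Types u v w : 'rV[R]_n.

(** The obstacle is the boundary layer: the force m there may be of order lambda^-2, and the motion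
    depends on the phase in which the geodesic enters. The passage is therefore never solved. Three
    facts are enough: m is bounded below uniformly in lambda, the total energy is 1, and the virial
    function is convex. The derivative of that function is f' times the weight 2 f + (C/2) lambda^2.
    Multiplied by this weight, the large part of f'' turns into the vertical energy, while 2 f'^2
    supplies the normal kinetic energy; their nearly constant sum bounds the second derivative
    below, whatever the phase. The energy sum does not see how normal energy is shared between x and
    z, so the incoming velocity matters only up to a multiple of grad f(p). Hence the start at p0,
    where all normal energy is vertical, is handled as the second half of a bounce. Bounces are not
    enumerated: convergence is propagated by real induction on time, and the errors are chosen in
    the order eta, eps, lambda. *)

Lemma dotE u v : dot u v = \sum_i u 0 i * v 0 i.
Proof. by rewrite /dot mxE; apply: eq_bigr => i _; rewrite mxE. Qed.

Lemma dotC u v : dot u v = dot v u.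
Proof. by rewrite !dotE; apply: eq_bigr => i _; rewrite mulrC. Qed.

Lemma dotDl u v w : dot (u + v) w = dot u w + dot v w.
Proof. by rewrite /dot mulmxDl mxE. Qed.

Lemma dotDr u v w : dot w (u + v) = dot w u + dot w v.
Proof. by rewrite dotC dotDl !(dotC w). Qed.

Lemma dotZl a u w : dot (a *: u) w = a * dot u w.
Proof. by rewrite /dot -scalemxAl mxE. Qed.

Lemma dotZr a u w : dot w (a *: u) = a * dot w u.
Proof. by rewrite dotC dotZl (dotC w). Qed.

Lemma dotNl u w : dot (- u) w = - dot u w.
Proof. by rewrite -scaleN1r dotZl mulN1r. Qed.

Lemma dotNr u w : dot w (- u) = - dot w u.
Proof. by rewrite -scaleN1r dotZr mulN1r. Qed.

Lemma dotBl u v w : dot (u - v) w = dot u w - dot v w.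
Proof. by rewrite dotDl dotNl. Qed.

Lemma dotBr u v w : dot w (u - v) = dot w u - dot w v.
Proof. by rewrite dotDr dotNr. Qed.

Lemma dot0l w : dot 0 w = 0.
Proof. by rewrite -(scale0r (0 : 'rV[R]_n)) dotZl mul0r. Qed.

Lemma dot0r w : dot w 0 = 0.
Proof. by rewrite dotC dot0l. Qed.

Definition dot_linear := (dotDl, dotDr, dotZl, dotZr, dotNl, dotNr, dot0l, dot0r).

Lemma dot_ge0 u : 0 <= dot u u.
Proof. by rewrite dotE sumr_ge0// => i _; rewrite -expr2 sqr_ge0. Qed.

Lemma coord_sqr_le_dot u i : u 0 i ^+ 2 <= dot u u.
Proof.
rewrite dotE (bigD1 i)//= -expr2 lerDl sumr_ge0// => j _.
by rewrite -expr2 sqr_ge0.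
Qed.

Lemma dot_eq0 u : dot u u = 0 -> u = 0.
Proof.
move=> u0; apply/rowP => i; rewrite mxE; apply/eqP.
by rewrite -sqrf_eq0 eq_le sqr_ge0 andbT -u0 coord_sqr_le_dot.
Qed.

Lemma dot_gt0 u : u != 0 -> 0 < dot u u.
Proof.
by move=> u0; rewrite lt_neqAle dot_ge0 andbT eq_sym; apply: contra_neq u0 => /dot_eq0.
Qed.

Lemma Cauchy_Schwarz u v : dot u v ^+ 2 <= dot u u * dot v v.
Proof.
have [->|v0] := eqVneq v 0; first by rewrite !dot0r expr0n mulr0.
have vv := dot_gt0 v0.
have := dot_ge0 (dot v v *: u - dot u v *: v).
rewrite !dot_linear (dotC v u) => H.
have : 0 <= dot v v * (dot u u * dot v v - dot u v ^+ 2) by nra.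
by rewrite pmulr_rge0// subr_ge0.
Qed.

Lemma coord_le_norm u i : `|u 0 i| <= `|u|.
Proof. by rewrite [leRHS]/Num.Def.normr/= mx_normrE; exact: (le_bigmax _ _ (0, i)). Qed.

Lemma norm_le_coord u e : 0 <= e -> (forall i, `|u 0 i| <= e) -> `|u| <= e.
Proof.
move=> e0 ue; rewrite [leLHS]/Num.Def.normr/= mx_normrE.
by apply/bigmax_le => // -[i j] _; rewrite (ord1 i).
Qed.

Lemma norm_dot_le u v : `|dot u v| <= n%:R * (`|u| * `|v|).
Proof.
rewrite dotE (le_trans (ler_norm_sum _ _ _))//.
apply: (@le_trans _ _ (\sum_(i < n) `|u| * `|v|)).
  by apply: ler_sum => i _; rewrite normrM ler_pM// coord_le_norm.
by rewrite sumr_const card_ord mulr_natl.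
Qed.

Lemma norm_sqr_le_dot u : `|u| ^+ 2 <= dot u u.
Proof.
rewrite -[dot u u]sqr_sqrtr ?dot_ge0// lerXn2r// ?nnegrE ?sqrtr_ge0//.
apply: norm_le_coord => [|i]; first exact: sqrtr_ge0.
by rewrite -sqrtr_sqr ler_wsqrtr// coord_sqr_le_dot.
Qed.

Lemma norm_le_dot u (r : R) : 0 <= r -> dot u u <= r ^+ 2 -> `|u| <= r.
Proof.
move=> r0 h; rewrite -(@ler_pXn2r _ 2)// ?nnegrE//.
exact: le_trans (norm_sqr_le_dot u) h.
Qed.

Lemma dot_le_norm_sqr u : dot u u <= n%:R * `|u| ^+ 2.
Proof. by rewrite (le_trans (ler_norm _))// (le_trans (norm_dot_le _ _))// expr2. Qed.

Lemma enorm_sqr u : enorm u ^+ 2 = dot u u.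
Proof. by rewrite sqr_sqrtr// dot_ge0. Qed.

Lemma enorm_ge0 u : 0 <= enorm u.
Proof. exact: sqrtr_ge0. Qed.

Lemma enorm_eq1 u : enorm u = 1 <-> dot u u = 1.
Proof.
split=> [h|h]; first by rewrite -enorm_sqr h expr1n.
by rewrite /enorm h sqrtr1.
Qed.

Lemma enorm_le u r : 0 <= r -> (enorm u <= r) = (dot u u <= r ^+ 2).
Proof. by move=> r0; rewrite -enorm_sqr ler_pXn2r// ?nnegrE// enorm_ge0. Qed.

Lemma enormZ a u : enorm (a *: u) = `|a| * enorm u.
Proof.
by rewrite /enorm !dot_linear mulrA -expr2 sqrtrM ?sqr_ge0// sqrtr_sqr.
Qed.

(** Equality case of the triangle inequality: the hypotheses force <u, v> >= p q, hence |q u - p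
    v|^2 <= 0. It turns a curve as long as its chord into a segment. *)
Lemma enorm_aligned u v (p q : R) : 0 <= p -> 0 <= q ->
  enorm u <= p -> enorm v <= q -> p + q <= enorm (u + v) -> q *: u = p *: v.
Proof.
move=> p0 q0; rewrite !enorm_le// => up vq pq.
have {}pq : (p + q) ^+ 2 <= dot (u + v) (u + v).
  by rewrite -enorm_sqr lerXn2r// nnegrE ?addr_ge0// enorm_ge0.
apply/eqP; rewrite -subr_eq0; apply/eqP/dot_eq0/eqP.
rewrite eq_le dot_ge0 andbT !dot_linear (dotC v u).
move: pq; rewrite !dot_linear (dotC v u).
move: (dot u u) (dot v v) (dot u v) up vq => a b c up vq pq.
have cpq : p * q <= c by nra.
have : p * q * (p * q) <= p * q * c by rewrite ler_wpM2l// mulr_ge0.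
have : q ^+ 2 * a <= q ^+ 2 * p ^+ 2 by rewrite ler_wpM2l// sqr_ge0.
have : p ^+ 2 * b <= p ^+ 2 * q ^+ 2 by rewrite ler_wpM2l// sqr_ge0.
nra.
Qed.

End dot_product.

Section derivatives.
Context {R : realType}.

(** The division-free form includes h = 0, so estimates on increments can be combined before any
    quotient is formed. *)
Lemma is_deriveP_eps (V W : normedModType R) (f : V -> W) x v d :
  is_derive x v f d <->
  forall e : R, 0 < e ->
    \forall h \near (0 : R), `|f (h *: v + x) - f x - h *: d| <= e * `|h|.
Proof.
split=> [[/cvgrPdist_le df fd] e e0|H].
- move: df; rewrite -/('D_v f x) fd => df.
  have := df e e0; rewrite near_withinE; apply: filterS => h hh.
  have [->|h0] := eqVneq h 0.
    by rewrite !scale0r add0r subrr subr0 !normr0 mulr0.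
  have hi : 0 < `|h^-1| by rewrite normr_gt0 invr_eq0.
  rewrite -(ler_pM2l hi) -normrZ scalerBr scalerA mulVf// scale1r mulrCA -normrM mulVf//.
  by rewrite normr1 mulr1 distrC; exact: hh.
- have : (fun h => h^-1 *: (f (h *: v + x) - f x)) @ 0^' --> d.
    apply/cvgrPdist_le => e e0; rewrite near_withinE.
    apply: filterS (H e e0) => h + h0.
    have hi : 0 < `|h^-1| by rewrite normr_gt0 invr_eq0.
    rewrite distrC -(ler_pM2l hi) -normrZ scalerBr scalerA mulVf// scale1r mulrCA -normrM mulVf//.
    by rewrite normr1 mulr1.
  move=> /[dup] c /cvg_lim l; split; last exact: l.
  by apply/cvg_ex; exists d.
Qed.

Lemma is_derive_row n (x : R -> 'rV[R]_n) (t : R) (v : 'rV[R]_n) :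
  is_derive t 1 x v <-> forall i, is_derive t 1 (fun s => x s 0 i) (v 0 i).
Proof.
split=> [[dx xv] i|H].
- split; first exact: (derivable_mxP _ _ _).1.
  by rewrite -xv derive_mx// mxE.
- have dx : derivable x t 1 by apply/derivable_mxP => i j; rewrite (ord1 i); case: (H j).
  split=> //; rewrite derive_mx//; apply/rowP => i; rewrite mxE.
  by case: (H i).
Qed.

Lemma is_derive_dot n (x y : R -> 'rV[R]_n) (t : R) (u v : 'rV[R]_n) :
  is_derive t 1 x u -> is_derive t 1 y v ->
  is_derive t 1 (fun s => dot (x s) (y s)) (dot u (y t) + dot (x t) v).
Proof.
move=> /is_derive_row dx /is_derive_row dy.
rewrite (_ : (fun s => _) = \sum_i ((fun s => x s 0 i) * (fun s => y s 0 i))); last first.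
  by apply/funext => s; rewrite dotE fct_sumE.
have H i : is_derive t 1 ((fun s => x s 0 i) * (fun s => y s 0 i))
    (x t 0 i * v 0 i + y t 0 i * u 0 i).
  exact: is_deriveM (dx i) (dy i).
apply: is_derive_eq.
by rewrite !dotE -big_split/=; apply: eq_bigr => i _; rewrite addrC (mulrC (y t 0 i)).
Qed.

(** A chain rule that asks of g only a quadratic remainder at [x t]. Defining functions are handled
    through such expansions rather than through Frechet differentiability. *)
Lemma is_derive_taylor n (g : 'rV[R]_n -> R) (D : 'rV[R]_n) (L : R) (x : R -> 'rV[R]_n) (t : R) (v : 'rV[R]_n) :
  is_derive t 1 x v ->
  (\forall y \near x t, `|g y - g (x t) - dot D (y - x t)| <= L * `|y - x t| ^+ 2) ->
  is_derive t 1 (fun s => g (x s)) (dot D v).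
Proof.
(* Each of the two error terms receives half of e; the denominator 2 q + 1 is positive even if q =
   0. *)
have aux (q e : R) : 0 <= q -> 0 < e -> q * (e / (2 * q + 1)) <= e / 2.
  by move=> q0 e0; rewrite mulrA ler_pdivrMr ?ltr_pwDr ?mulr_ge0//; nra.
move=> dx tg; apply/is_deriveP_eps => e e0.
move: dx => /is_deriveP_eps dx.
pose k := `|v| + 1; have k0 : 0 < k by rewrite ltr_pwDr.
have kL : 0 < 2 * (`|L| * k ^+ 2) + 1 by rewrite ltr_pwDr// !mulr_ge0// ltW.
have nD : 0 < 2 * (n%:R * `|D|) + 1 by rewrite ltr_pwDr// !mulr_ge0.
move: tg => /nbhs_ballP[d /= d0 tg].
have n4 : \forall h \near (0 : R), `|h| <= e / (2 * (`|L| * k ^+ 2) + 1).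
  by apply: nbhs0_le; rewrite divr_gt0.
have n5 : \forall h \near (0 : R), `|h| < d / k by apply: nbhs0_lt; rewrite divr_gt0.
near=> h.
have h1 : `|x (h *: 1 + t) - x t - h *: v| <= `|h|.
  by rewrite -[leRHS]mul1r; near: h; exact: dx.
have h2 : `|x (h *: 1 + t) - x t - h *: v| <= e / (2 * (n%:R * `|D|) + 1) * `|h|.
  by near: h; apply: dx; rewrite divr_gt0.
have h3 : `|x (h *: 1 + t) - x t| <= k * `|h|.
  rewrite -[X in `|X|](subrK (h *: v)) (le_trans (ler_normD _ _))//.
  by rewrite normrZ /k mulrDl mul1r addrC (mulrC `|v|) lerD2l.
have h4 : `|h| <= e / (2 * (`|L| * k ^+ 2) + 1).
  by near: h; exact: n4.
have h5 : `|g (x (h *: 1 + t)) - g (x t) - dot D (x (h *: 1 + t) - x t)|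
      <= L * `|x (h *: 1 + t) - x t| ^+ 2.
  apply: tg; rewrite -ball_normE/= distrC (le_lt_trans h3)// mulrC -ltr_pdivlMr//.
  by near: h; exact: n5.
set X := x _ - x t in h1 h2 h3 h5 *; clearbody X.
rewrite (_ : _ - _ - _ = (g (x (h *: 1 + t)) - g (x t) - dot D X)
   + dot D (X - h *: v)); last by rewrite dotBr dotZr /GRing.scale/=; ring.
rewrite (le_trans (ler_normD _ _))// [leRHS](_ : _ = e / 2 * `|h| + e / 2 * `|h|); last by field.
apply: lerD.
- apply: (le_trans h5); apply: (@le_trans _ _ (`|L| * (k * `|h|) ^+ 2)).
    apply: (@le_trans _ _ (`|L| * `|X| ^+ 2)).
      by apply: ler_wpM2r; [exact: sqr_ge0|exact: ler_norm].
    by apply: ler_wpM2l => //; rewrite lerXn2r// nnegrE// mulr_ge0// ltW.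
  rewrite exprMn mulrA (expr2 `|h|) mulrA ler_wpM2r//.
  have : `|L| * k ^+ 2 * `|h| <= `|L| * k ^+ 2 * (e / (2 * (`|L| * k ^+ 2) + 1)).
    by rewrite ler_wpM2l// mulr_ge0// sqr_ge0.
  by move=> /le_trans; apply; apply: aux => //; apply: mulr_ge0 => //; exact: sqr_ge0.
- apply: (le_trans (norm_dot_le _ _)); apply: (@le_trans _ _ (n%:R * (`|D| * (e / (2 * (n%:R * `|D|) + 1) * `|h|)))).
    by rewrite !ler_wpM2l.
  have nD0 : 0 <= n%:R * `|D| by apply: mulr_ge0.
  by have := aux _ _ nD0 e0; rewrite !mulrA => ?; rewrite ler_wpM2r.
Unshelve. all: by end_near. Qed.

Lemma is_derive1_continuous (V : normedModType R) (f : R -> V) (t : R) d :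
  is_derive t 1 f d -> {for t, continuous f}.
Proof. by case=> df _; exact/differentiable_continuous/derivable1_diffP. Qed.

Lemma is_derive1_within (V : normedModType R) (f df : R -> V) (a b : R) :
  (forall t, a <= t <= b -> is_derive t 1 f (df t)) -> {within `[a, b], continuous f}.
Proof.
move=> H; apply: continuous_in_subspaceT => t; rewrite inE/= in_itv/= => /H.
exact: is_derive1_continuous.
Qed.

Lemma is_derive_le (f df : R -> R) (a b : R) : a <= b ->
  (forall t, a <= t <= b -> is_derive t 1 f (df t)) ->
  (forall t, a <= t <= b -> 0 <= df t) -> f a <= f b.
Proof.
move=> ab H df0; have [||c cab e] := @MVT_segment R f df a b ab.
- by move=> t /[!in_itv]/= /andP[/ltW at_ /ltW tb]; apply: H; rewrite at_.
- exact: is_derive1_within H.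
by rewrite -subr_ge0 e mulr_ge0 ?subr_ge0// df0.
Qed.

Lemma is_derive_le_lin (f df : R -> R) (a b c : R) : a <= b ->
  (forall t, a <= t <= b -> is_derive t 1 f (df t)) ->
  (forall t, a <= t <= b -> c <= df t) -> f a + c * (b - a) <= f b.
Proof.
move=> ab H dfc.
suff : f a - c * a <= f b - c * b by lra.
apply: (@is_derive_le (fun t => f t - c * t) (fun t => df t - c) a b ab).
- move=> t /H tab.
  have -> : (fun t => f t - c * t) = f - c \*: (id : R -> R) by apply/funext.
  by apply: is_derive_eq; rewrite scaler1.
- by move=> t /dfc; rewrite subr_ge0.
Qed.

Lemma is_derive_lip (f df : R -> R) (a b c : R) : a <= b ->
  (forall t, a <= t <= b -> is_derive t 1 f (df t)) ->
  (forall t, a <= t <= b -> `|df t| <= c) -> `|f b - f a| <= c * (b - a).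
Proof.
move=> ab H dfc.
have h1 : f a + - c * (b - a) <= f b.
  apply: (is_derive_le_lin ab H) => t /dfc; rewrite ler_norml => /andP[]//.
have h2 : - f a + - c * (b - a) <= - f b.
  apply: (@is_derive_le_lin (fun t => - f t) (fun t => - df t)) => // t tab.
    by have := H t tab => Ht; exact: is_deriveN.
  by have := dfc t tab; rewrite ler_norml lerN2 => /andP[].
by rewrite ler_norml; apply/andP; split; lra.
Qed.

Lemma is_derive_row_lip n (x dx : R -> 'rV[R]_n) (a b c : R) : a <= b -> 0 <= c ->
  (forall t, a <= t <= b -> is_derive t 1 x (dx t)) ->
  (forall t, a <= t <= b -> `|dx t| <= c) -> `|x b - x a| <= c * (b - a).
Proof.
move=> ab c0 H dxc; apply: norm_le_coord => [|i].
  by rewrite mulr_ge0// subr_ge0.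
rewrite !mxE; apply: (@is_derive_lip (fun t => x t 0 i) (fun t => dx t 0 i)) => // t tab.
  by have /is_derive_row := H t tab; apply.
exact: le_trans (coord_le_norm _ _) (dxc t tab).
Qed.

End derivatives.

(** * Taylor expansions of defining functions *)

Section taylor.
Context {R : realType} {n : nat}.
Implicit Types x y v p q : 'rV[R]_n.

Lemma is_derive_line (g : 'rV[R]_n -> R) x u (s d : R) :
  is_derive (x + s *: u) u g d -> is_derive s 1 (fun s => g (x + s *: u)) d.
Proof.
move=> /is_deriveP_eps H; apply/is_deriveP_eps => e e0.
apply: filterS (H e e0) => h.
by rewrite addrCA -scalerDl scaler1.
Qed.

(* Telescoping over the coordinates of v. *)
Lemma taylor_of_partials (g : 'rV[R]_n -> R) (D : 'rV[R]_n -> 'rV[R]_n) x v (w : R) :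
  (forall y, `|y - x| <= `|v| -> forall i, is_derive y (delta_mx 0 i) g (D y 0 i)) ->
  (forall y, `|y - x| <= `|v| -> `|D y - D x| <= w) ->
  `|g (x + v) - g x - dot (D x) v| <= n%:R * (w * `|v|).
Proof.
move=> gD Dw.
pose V k : 'rV[R]_n := \row_i (if (i < k)%N then v 0 i else 0).
have VN : V n = v by apply/rowP => i; rewrite mxE ltn_ord.
have V0 : V 0%N = 0 by apply/rowP => i; rewrite !mxE.
have VS (k : 'I_n) : V k.+1 = V k + v 0 k *: delta_mx 0 k.
  apply/rowP => i; rewrite !mxE ltnS eqxx/=.
  have [->|ik] := eqVneq i k; first by rewrite leqnn ltnn add0r mulr1.
  rewrite mulr0 addr0 leq_eqVlt.
  by have -> : (i == k :> nat) = false by apply/negbTE.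
have -> : g (x + v) - g x = \sum_(k < n) (g (x + V k.+1) - g (x + V k)).
  rewrite -(big_mkord xpredT (fun k => g (x + V k.+1) - g (x + V k))).
  by rewrite telescope_sumr// VN V0 addr0.
rewrite dotE -sumrB (le_trans (ler_norm_sum _ _ _))//.
apply: (@le_trans _ _ (\sum_(i < n) w * `|v|)); last first.
  by rewrite sumr_const card_ord mulr_natl.
apply: ler_sum => k _.
have w0 : 0 <= w by rewrite (le_trans _ (Dw x _))// subrr normr0.
pose F s := g (x + V k + s *: delta_mx 0 k) - s * D x 0 k.
have FE : g (x + V k.+1) - g (x + V k) - D x 0 k * v 0 k = F (v 0 k) - F 0.
  by rewrite /F VS scale0r mul0r subr0 addr0 addrA; ring.
(* In the sup norm the intermediate points of the coordinate path stay within [|v|] of x. *)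
have near_v (s : R) : `|s| <= `|v 0 k| -> `|x + V k + s *: delta_mx 0 k - x| <= `|v|.
  move=> sv; apply: norm_le_coord => // i; rewrite !mxE eqxx/= [X in `|X|](_ : _ =
     (if (i < k)%N then v 0 i else 0) + s * (i == k)%:R); last by ring.
  have [->|ik] := eqVneq i k.
    by rewrite ltnn add0r mulr1 (le_trans sv)// coord_le_norm.
  by rewrite mulr0 addr0; case: ifP => _; rewrite ?normr0// coord_le_norm.
have dF (s : R) : `|s| <= `|v 0 k| ->
    is_derive s 1 F (D (x + V k + s *: delta_mx 0 k) 0 k - D x 0 k).
  move=> /near_v sv.
  have h := is_derive_line (gD _ sv k).
  have -> : F = (fun s => g (x + V k + s *: delta_mx 0 k)) - D x 0 k \*: (id : R -> R).
    by apply/funext => r; rewrite /F mulrC.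
  by apply: is_derive_eq; rewrite scaler1.
have bF (s : R) : `|s| <= `|v 0 k| ->
    `|D (x + V k + s *: delta_mx 0 k) 0 k - D x 0 k| <= w.
  move=> /near_v /Dw; apply: le_trans.
  by have := coord_le_norm (D (x + V k + s *: delta_mx 0 k) - D x) k; rewrite !mxE.
rewrite FE (@le_trans _ _ (w * `|v 0 k|))//; last by rewrite ler_wpM2l// coord_le_norm.
have [vk|vk] := leP 0 (v 0 k).
- rewrite (ger0_norm vk) -[X in w * X](subr0 (v 0 k)).
  apply: (is_derive_lip vk (df := fun s => D (x + V k + s *: delta_mx 0 k) 0 k - D x 0 k)).
    by move=> s /andP[s0 sv]; apply: dF; rewrite !ger0_norm.
  by move=> s /andP[s0 sv]; apply: bF; rewrite !ger0_norm.
- rewrite (ltr0_norm vk) distrC -[X in w * X]add0r.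
  apply: (is_derive_lip (ltW vk) (df := fun s => D (x + V k + s *: delta_mx 0 k) 0 k - D x 0 k)).
    by move=> s /andP[s0 sv]; apply: dF; rewrite (ltr0_norm vk) (ler0_norm sv) lerN2.
  by move=> s /andP[s0 sv]; apply: bF; rewrite (ltr0_norm vk) (ler0_norm sv) lerN2.
Qed.

(** [taylor_of_partials] needs a full cube around x inside W, so it is used only locally, to
    differentiate g along the segment from x to y; the mean value inequality on that segment then
    gives the global bound. *)
Lemma taylor_convex (W : set 'rV[R]_n) (g : 'rV[R]_n -> R) (D : 'rV[R]_n -> 'rV[R]_n) (L : R) :
  open W ->
  (forall x y s, W x -> W y -> 0 <= s <= 1 -> W (x + s *: (y - x))) ->
  (forall x, W x -> forall i, is_derive x (delta_mx 0 i) g (D x 0 i)) ->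
  0 <= L -> (forall x y, W x -> W y -> `|D y - D x| <= L * `|y - x|) ->
  forall x y, W x -> W y -> `|g y - g x - dot (D x) (y - x)| <= n%:R * L * `|y - x| ^+ 2.
Proof.
move=> oW cW gD L0 DL x y Wx Wy.
pose z s := x + s *: (y - x).
have Wz s : 0 <= s <= 1 -> W (z s) by exact: cW.
have dz (s : R) : is_derive s 1 z (y - x).
  apply/is_derive_row => i; rewrite !mxE.
  have -> : (fun s => z s 0 i) = cst (x 0 i) + (y 0 i - x 0 i) \*: (id : R -> R).
    by apply/funext => t; rewrite /z !mxE mulrC.
  by apply: is_derive_eq; rewrite scaler1 add0r.
have loc a : W a -> \forall b \near a, `|g b - g a - dot (D a) (b - a)| <= n%:R * L * `|b - a| ^+ 2.
  move=> Wa; have /nbhs_ballP[r /= r0 rW] : nbhs a W by exact: open_nbhs_nbhs.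
  apply/nbhs_ballP; exists r => //= b; rewrite -ball_normE/= distrC => ab.
  have Wc c : `|c - a| <= `|b - a| -> W c.
    by move=> ca; apply: rW; rewrite -ball_normE/= distrC (le_lt_trans ca).
  have := @taylor_of_partials g D a (b - a) (L * `|b - a|).
  rewrite [in X in _ -> _ -> X](addrC a) subrK expr2 !mulrA; apply.
    by move=> c /Wc; exact: gD.
  by move=> c ca; rewrite (le_trans (DL _ _ Wa (Wc _ ca)))// ler_wpM2l.
pose F s := g (z s) - s * dot (D x) (y - x).
have FE : g y - g x - dot (D x) (y - x) = F 1 - F 0.
  by rewrite /F /z scale0r addr0 scale1r (addrC x) subrK; ring.
rewrite FE -[leRHS]mulr1 -[X in _ * X](subr0 (1 : R)).
apply: (is_derive_lip ler01 (df := fun s => dot (D (z s)) (y - x) - dot (D x) (y - x))).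
- move=> s s01; have h := is_derive_taylor (dz s) (loc _ (Wz s s01)).
  have -> : F = (fun s => g (z s)) - dot (D x) (y - x) \*: (id : R -> R).
    by apply/funext => r; rewrite /F mulrC.
  by apply: is_derive_eq; rewrite scaler1.
- move=> s s01; rewrite -dotBl (le_trans (norm_dot_le _ _))// -mulrA ler_wpM2l//.
  rewrite expr2 mulrA ler_wpM2r//.
  rewrite (le_trans (DL _ _ Wx (Wz _ s01)))// ler_wpM2l// /z addrAC subrr add0r normrZ.
  by move: s01 => /andP[s0 s1]; rewrite ger0_norm// ler_piMl.
Qed.

Lemma cvg_dot (T : Type) (F : set_system T) (FF : Filter F) (a b : T -> 'rV[R]_n) u v :
  a @ F --> u -> b @ F --> v -> (fun t => dot (a t) (b t)) @ F --> dot u v.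
Proof.
move=> au bv; rewrite dotE.
rewrite (_ : (fun t => dot (a t) (b t)) = (fun t => \sum_i a t 0 i * b t 0 i)); last first.
  by apply/funext => t; rewrite dotE.
apply: cvg_big => [|i _]; first exact: add_continuous.
apply: cvgM.
  exact: (cvg_comp a (fun u : 'rV[R]_n => u 0 i) au (@coord_continuous R 1 n 0 i u)).
exact: (cvg_comp b (fun u : 'rV[R]_n => u 0 i) bv (@coord_continuous R 1 n 0 i v)).
Qed.

End taylor.

Lemma lipschitz_bound (R : realType) (V W : normedModType R) (A : set V) (f : V -> W) :
  [lipschitz f x | x in A] ->
  exists2 L : R, 0 < L & forall x y, A x -> A y -> `|f y - f x| <= L * `|y - x|.
Proof.
move=> /pinfty_ex_gt0[L L0 H]; exists L => // x y Ax Ay.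
by have := H (y, x); apply; split.
Qed.

Section embedding.
Context {R : realType} {n : nat}.
Implicit Types x y : 'rV[R]_n.

Lemma ptEl x (z : R) i : pt x z 0 (lshift 1 i) = x 0 i.
Proof. by rewrite /pt row_mxEl. Qed.

Lemma ptEr x (z : R) i : pt x z 0 (rshift n i) = z.
Proof. by rewrite /pt row_mxEr mxE. Qed.

Lemma norm_pt_le x (z e : R) : 0 <= e -> (`|pt x z| <= e) = (`|x| <= e) && (`|z| <= e).
Proof.
move=> e0; apply/idP/andP => [h|[xe ze]].
- split; last by rewrite -(ptEr x z 0) (le_trans (coord_le_norm _ _)).
  by apply: norm_le_coord => // i; rewrite -(ptEl x z) (le_trans (coord_le_norm _ _)).
- apply: norm_le_coord => // i; case: (splitP i) => j /= ij.
    have -> : i = lshift 1 j by apply/val_inj.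
    by rewrite ptEl (le_trans (coord_le_norm _ _)).
  have -> : i = rshift n j by apply/val_inj.
  by rewrite ptEr.
Qed.

Lemma norm_pt_lt x (z e : R) : 0 < e -> (`|pt x z| < e) = (`|x| < e) && (`|z| < e).
Proof.
move=> e0; apply/idP/andP => [h|[xe ze]].
  have := lexx `|pt x z|; rewrite norm_pt_le// => /andP[a b].
  by split; [exact: le_lt_trans a h|exact: le_lt_trans b h].
have : `|pt x z| <= Num.max `|x| `|z|.
  by rewrite norm_pt_le ?le_max ?normr_ge0// !lexx orbT.
by move=> /le_lt_trans; apply; rewrite gt_max xe ze.
Qed.

Lemma ptB x y (z w : R) : pt x z - pt y w = pt (x - y) (z - w).
Proof.
rewrite /pt opp_row_mx add_row_mx; congr row_mx.
by apply/rowP => i; rewrite !mxE.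
Qed.

Lemma dot_pt x y (z w : R) : dot (pt x z) (pt y w) = dot x y + z * w.
Proof.
rewrite !dotE big_split_ord/= big_ord_recl big_ord0 addr0 !ptEr; congr (_ + _).
by apply: eq_bigr => i _; rewrite !ptEl.
Qed.

Lemma slice_nbhs (U : set 'rV[R]_(n + 1)) x : open U -> U (emb x) ->
  exists2 r : R, 0 < r & forall y, `|y - x| < r -> U (emb y).
Proof.
move=> oU Ux; have /nbhs_ballP[r /= r0 rU] : nbhs (emb x) U by exact: open_nbhs_nbhs.
exists r => // y yx; apply: rU.
by rewrite -ball_normE/= /emb ptB subrr norm_pt_lt// normr0 r0 distrC yx.
Qed.

End embedding.

(** * Convex sets and segments towards interior points *)

Section convex_sets.
Context {R : realType} {n : nat}.
Implicit Types x y q p : 'rV[R]_n.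

Lemma convex_setP (K : set 'rV[R]_n) :
  convex_set (K : set (convex_lmodType 'rV[R]_n)) ->
  forall x y (s : R), K x -> K y -> 0 <= s <= 1 -> K (x + s *: (y - x)).
Proof.
move=> cK x y s Kx Ky /andP[s0 s1].
have := cK y x (Itv01 s0 s1); rewrite !inE => /(_ Ky Kx).
change (K (s *: y + (1 - s) *: x) -> K (x + s *: (y - x))).
by rewrite scalerBl scale1r addrCA -scalerBr.
Qed.

Lemma interior_ballP (K : set 'rV[R]_n) x :
  K° x <-> exists2 r : R, 0 < r & forall y, `|y - x| < r -> K y.
Proof.
rewrite /interior; split=> [/nbhs_ballP[r /= r0 rK]|[r r0 rK]].
  by exists r => // y yx; apply: rK; rewrite -ball_normE/= distrC.
by apply/nbhs_ballP; exists r => // y; rewrite -ball_normE/= distrC; exact: rK.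
Qed.

Definition segment_closed (K : set 'rV[R]_n) :=
  forall x y (s : R), K x -> K y -> 0 <= s <= 1 -> K (x + s *: (y - x)).

(** The homothety with centre x and ratio s carries the ball around q onto the ball in question; q'
    is the preimage of y. *)
Lemma segment_ball (K : set 'rV[R]_n) x q (r s : R) : segment_closed K ->
  K x -> (forall y, `|y - q| < r -> K y) -> 0 < s <= 1 ->
  forall y, `|y - (x + s *: (q - x))| < s * r -> K y.
Proof.
move=> cK Kx qr /andP[s0 s1] y yr.
pose q' := q + s^-1 *: (y - (x + s *: (q - x))).
have -> : y = x + s *: (q' - x).
  rewrite /q' [q + _]addrC -addrA scalerDr scalerA mulfV ?gt_eqF// scale1r.
  move: (s *: _) => z; have -> : y - (x + z) + z = y - x by rewrite opprD addrA subrK.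
  by rewrite addrC subrK.
apply: cK => //; last by rewrite ltW.
apply: qr.
by rewrite /q' addrAC subrr add0r normrZ gtr0_norm ?invr_gt0// mulrC ltr_pdivrMr// mulrC.
Qed.

Lemma segment_interior (K : set 'rV[R]_n) x q (s : R) : segment_closed K ->
  K x -> K° q -> 0 < s <= 1 -> K° (x + s *: (q - x)).
Proof.
move=> cK Kx /interior_ballP[r r0 qr] s01; apply/interior_ballP.
exists (s * r); first by rewrite mulr_gt0//; case/andP: s01.
exact: segment_ball.
Qed.

Lemma closure_interior_near (O K : set 'rV[R]_n) p : open O -> K = closure O -> K p ->
  forall r : R, 0 < r -> exists2 q, K° q & `|q - p| < r.
Proof.
move=> oO -> Op r r0.
have /Op[q [Oq pq]] : nbhs p (ball p r) by exact: nbhsx_ballx.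
exists q; last by move: pq; rewrite -ball_normE/= distrC.
rewrite /interior; apply: (@filterS _ _ _ O); first exact: subset_closure.
exact: open_nbhs_nbhs.
Qed.

Lemma boundary_closed (K : set 'rV[R]_n) p : closed K ->
  boundary K p <-> K p /\ ~ K° p.
Proof. by move=> /closure_id {2}->; split. Qed.

Lemma cvg_segment (V : normedModType R) (A : set 'rV[R]_n) (g : 'rV[R]_n -> V) x q :
  {within A, continuous g} -> A x ->
  (forall s : R, 0 < s <= 1 -> A (x + s *: (q - x))) ->
  g (x + s *: (q - x)) @[s --> 0^'+] --> g x.
Proof.
move=> /subspace_continuousP gA Ax As.
have near_A : \forall s \near 0^'+, A (x + s *: (q - x)).
  near=> s; apply: As; apply/andP; split; first by near: s; exact: nbhs_right_gt.
  by near: s; exact: nbhs_right_le.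
have cx : x + s *: (q - x) @[s --> 0^'+] --> x.
  have : x + s *: (q - x) @[s --> (0 : R)^'+] --> x + (0 : R) *: (q - x).
    apply: cvgD; first exact: cvg_cst.
    by apply: cvgZr_tmp; exact: cvg_at_right_filter cvg_id.
  by rewrite scale0r addr0.
move=> B /(gA x Ax) /= BA.
have : \forall s \near 0^'+, A (x + s *: (q - x)) -> B (g (x + s *: (q - x))).
  exact: cx BA.
by apply: filter_app; apply: filterS near_A => s h; apply.
Unshelve. all: by end_near. Qed.
End convex_sets.

Section defining_functions.
Context {R : realType} {n : nat}.
Implicit Types x y q p : 'rV[R]_n.

Lemma norm_row_le (A : 'M[R]_n) i : `|row i A| <= `|A|.
Proof.
apply: norm_le_coord => // j; rewrite mxE.
by rewrite [leRHS]/Num.Def.normr/= mx_normrE; exact: (le_bigmax _ _ (i, j)).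
Qed.

Definition taylor_on (A : set 'rV[R]_n) (g : 'rV[R]_n -> R) (D : 'rV[R]_n -> 'rV[R]_n) (C : R) :=
  forall x y, A x -> A y -> `|g y - g x - dot (D x) (y - x)| <= C * `|y - x| ^+ 2.

(** Inside K the Lipschitz bound on [d2f] and its value at one interior point q bound [d2f];
    integration along segments of the convex set W then bounds the increments of [df] and the
    remainder of f. The constants do not depend on the distance to the boundary, which permits the
    passage to the limit. *)
Lemma defining_taylor (K : set 'rV[R]_n) p U f df : segment_closed K ->
  (forall r : R, 0 < r -> exists2 q, K° q & `|q - p| < r) ->
  defining_near K p U f df ->
  exists (d2f : 'rV[R]_n -> 'M[R]_n) (r C : R),
    let A := [set x | K x /\ `|x - p| < r] in
    [/\ 0 < r, 0 < C & forall x, `|x - p| < r -> U (emb x)] /\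
    [/\ taylor_on A f df C,
        forall i, taylor_on A (fun x => df x 0 i) (fun x => row i (d2f x)) C,
        forall x y, A x -> A y -> `|df y - df x| <= C * `|y - x| &
        forall x y, A x -> A y -> `|d2f y - d2f x| <= C * `|y - x|].
Proof.
move=> cK Kp [[oU _ Up] [[d2f [[_ _] [[cf cdf cd2f] [Hf Hdf Hd2f]]]] _]].
have [r r0 rU] := slice_nbhs oU Up.
set Om := K `&` slice (closure U) in cf cdf cd2f Hf Hdf Hd2f.
have AOm x : K x -> `|x - p| < r -> Om x.
  by move=> Kx xr; split=> //; apply: subset_closure; exact: rU.
pose W := [set x | K° x /\ `|x - p| < r].
have ball_cvx x y (s : R) : `|x - p| < r -> `|y - p| < r -> 0 <= s <= 1 ->
    `|x + s *: (y - x) - p| < r.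
  move=> xr yr /andP[s0 s1].
  have -> : x + s *: (y - x) - p = (1 - s) *: (x - p) + s *: (y - p).
    by apply/rowP => i; rewrite !mxE; ring.
  rewrite (le_lt_trans (ler_normD _ _))// !normrZ !ger0_norm ?subr_ge0//.
  have [->|sn] := eqVneq s 0; first by rewrite subr0 mul1r mul0r addr0.
  have {}s0 : 0 < s by rewrite lt_neqAle eq_sym sn.
  have : s * `|y - p| < s * r by rewrite ltr_pM2l.
  have : (1 - s) * `|x - p| <= (1 - s) * r by rewrite ler_wpM2l ?subr_ge0// ltW.
  by lra.
have WOm x : W x -> Om° x.
  move=> [/interior_ballP[r1 r10 H1] xr]; apply/interior_ballP.
  exists (Num.min r1 (r - `|x - p|)); first by rewrite lt_min r10 subr_gt0.
  move=> y; rewrite lt_min => /andP[y1 y2]; apply: AOm; first exact: H1.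
  rewrite -(subrK x y) -addrA (le_lt_trans (ler_normD _ _))//.
  by rewrite -ltrBrDr.
have oW : open W.
  rewrite openE => x Wx; apply/interior_ballP.
  have [/interior_ballP[r1 r10 H1] xr] := Wx.
  exists (Num.min r1 (r - `|x - p|)); first by rewrite lt_min r10 subr_gt0.
  move=> y; rewrite lt_min => /andP[y1 y2]; split.
    apply/interior_ballP; exists (r1 - `|y - x|); first by rewrite subr_gt0.
    move=> z; rewrite ltrBrDr => zr; apply: H1.
    by rewrite -(subrK y z) -addrA (le_lt_trans (ler_normD _ _)).
  rewrite -(subrK x y) -addrA (le_lt_trans (ler_normD _ _))//.
  by rewrite -ltrBrDr.
have cW x y (s : R) : W x -> W y -> 0 <= s <= 1 -> W (x + s *: (y - x)).
  move=> [Kx xr] [Ky yr] s01; split; last exact: ball_cvx.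
  have [->|sn] := eqVneq s 0; first by rewrite scale0r addr0.
  apply: segment_interior => //; first exact: interior_subset.
  by rewrite lt_neqAle eq_sym sn.
have [L L0 lipL] := lipschitz_bound Hd2f.
have [q Kq qr] := Kp r r0.
have Wq : W q by [].
pose M := `|d2f q| + L * (2 * r).
have M0 : 0 <= M by rewrite addr_ge0// !mulr_ge0// ltW.
have diam x y : `|x - p| < r -> `|y - p| < r -> `|y - x| <= 2 * r.
  move=> xr yr; rewrite -(subrK p y) -addrA (le_trans (ler_normD _ _))// (distrC p).
  by lra.
have d2M x : W x -> `|d2f x| <= M.
  move=> Wx; rewrite -(subrK (d2f q) (d2f x)) (le_trans (ler_normD _ _))// addrC lerD2l.
  rewrite (le_trans (lipL _ _ (WOm _ Wq) (WOm _ Wx)))//.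
  by rewrite ler_pM2l// diam//; case: Wx.
have T2 i x y : W x -> W y ->
    `|df y 0 i - df x 0 i - dot (row i (d2f x)) (y - x)| <= n%:R * L * `|y - x| ^+ 2.
  move=> Wx Wy.
  apply: (@taylor_convex _ _ W (fun y => df y 0 i) (fun x => row i (d2f x))) => //.
  - by move=> z Wz j; rewrite mxE; apply: Hdf; exact: WOm.
  - exact: ltW.
  - move=> z w Wz Ww; rewrite -linearB (le_trans (norm_row_le _ _))//.
    by apply: lipL; exact: WOm.
pose L1 := n%:R * M + n%:R * L * (2 * r).
have L10 : 0 <= L1 by rewrite addr_ge0// !mulr_ge0// ltW.
have lip1 x y : W x -> W y -> `|df y - df x| <= L1 * `|y - x|.
  move=> Wx Wy; apply: norm_le_coord => [|i]; first by rewrite mulr_ge0.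
  rewrite !mxE -(subrK (dot (row i (d2f x)) (y - x)) (_ - _)).
  rewrite (le_trans (ler_normD _ _))// /L1 mulrDl addrC lerD//.
    rewrite (le_trans (norm_dot_le _ _))// mulrA ler_wpM2r// ler_wpM2l//.
    exact: le_trans (norm_row_le _ _) (d2M _ Wx).
  rewrite (le_trans (T2 _ _ _ Wx Wy))// expr2 [leLHS]mulrA ler_wpM2r// ler_wpM2l//.
    by rewrite mulr_ge0// ltW.
  by apply: diam; [case: Wx|case: Wy].
have T1 x y : W x -> W y ->
    `|f y - f x - dot (df x) (y - x)| <= n%:R * L1 * `|y - x| ^+ 2.
  apply: taylor_convex => // z Wz i; apply: Hf; exact: WOm.
(* Both expansions extend to K along the segments towards an interior point. *)
pose seg x (s : R) := x + s *: (q - x).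
have segW x (s : R) : K x -> `|x - p| < r -> 0 < s <= 1 -> W (seg x s).
  move=> Kx xr /andP[s0 s1]; split; last by apply: ball_cvx => //; rewrite ltW.
  by apply: segment_interior => //; rewrite s0.
have segcl x (s : R) : K x -> `|x - p| < r -> 0 < s <= 1 -> closure Om (seg x s).
  move=> Kx xr s01; apply: subset_closure; apply: interior_subset.
  by apply: WOm; exact: segW.
have clx x : K x -> `|x - p| < r -> closure Om x.
  by move=> Kx xr; apply: subset_closure; exact: AOm.
have cvg_on (V : normedModType R) (g : 'rV[R]_n -> V) x : {within closure Om, continuous g} ->
    K x -> `|x - p| < r -> g (seg x s) @[s --> 0^'+] --> g x.
  by move=> cg Kx xr; apply: (cvg_segment cg) => [|s s01]; [exact: clx|exact: segcl].
have cvg_seg x : seg x s @[s --> 0^'+] --> x.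
  have : seg x s @[s --> (0 : R)^'+] --> x + (0 : R) *: (q - x).
    apply: cvgD; first exact: cvg_cst.
    by apply: cvgZr_tmp; exact: cvg_at_right_filter cvg_id.
  by rewrite scale0r addr0.
have near01 : \forall s \near (0 : R)^'+, 0 < s <= 1.
  near=> s; apply/andP; split; first by near: s; exact: nbhs_right_gt.
  by near: s; exact: nbhs_right_le.
have nn x y (D : R) (k : nat) : D * `|seg y s - seg x s| ^+ k @[s --> 0^'+] --> D * `|y - x| ^+ k.
  apply: cvgMr; apply: (cvg_comp _ (fun u : R => u ^+ k)); last exact: exprn_continuous.
  by apply: cvg_norm; apply: cvgB; exact: cvg_seg.
pose C := 1 + L + n%:R * L + L1 + n%:R * L1.
have nL : 0 <= n%:R * L by rewrite mulr_ge0// ltW.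
have nL1 : 0 <= n%:R * L1 by rewrite mulr_ge0.
exists d2f, r, C; split; first by split=> //; rewrite /C; lra.
have up (a D b : R) : a <= D * b -> 0 <= b -> D <= C -> a <= C * b.
  by move=> aD b0 DC; apply: (le_trans aD); rewrite ler_wpM2r.
split.
- move=> x y [Kx xr] [Ky yr].
  apply: (up _ (n%:R * L1)); [|exact: sqr_ge0|rewrite /C; lra].
  apply: (@ler_cvg_to _ _ _ _ (fun s => `|f (seg y s) - f (seg x s) - dot (df (seg x s)) (seg y s - seg x s)|) _ _ _ _ (nn x y _ 2)).
    apply: cvg_norm; apply: cvgB; first by apply: cvgB; exact: (cvg_on R^o).
    by apply: cvg_dot; [exact: cvg_on|apply: cvgB; exact: cvg_seg].
  by apply: filterS near01 => s s01; apply: T1; exact: segW.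
- move=> i x y [Kx xr] [Ky yr].
  apply: (up _ (n%:R * L)); [|exact: sqr_ge0|rewrite /C; lra].
  apply: (@ler_cvg_to _ _ _ _ (fun s => `|df (seg y s) 0 i - df (seg x s) 0 i - dot (row i (d2f (seg x s))) (seg y s - seg x s)|) _ _ _ _ (nn x y _ 2)).
    apply: cvg_norm; apply: cvgB.
      apply: cvgB; [apply: (cvg_comp (fun s => df (seg y s)) (fun u : 'rV[R]_n => u 0 i) _ (@coord_continuous R 1 n 0 i (df y)))|
         apply: (cvg_comp (fun s => df (seg x s)) (fun u : 'rV[R]_n => u 0 i) _ (@coord_continuous R 1 n 0 i (df x)))]; exact: cvg_on.
    apply: cvg_dot; last by apply: cvgB; exact: cvg_seg.
    apply/cvgrPdist_le => e e0.
    have /cvgrPdist_le/(_ e e0) := cvg_on _ _ _ cd2f Kx xr.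
    apply: filterS => s; apply: le_trans.
    by rewrite -linearB; exact: norm_row_le.
  by apply: filterS near01 => s s01; apply: T2; exact: segW.
- move=> x y [Kx xr] [Ky yr].
  apply: (up _ L1); [|exact: normr_ge0|rewrite /C; lra].
  rewrite -[`|y - x|]expr1.
  apply: (@ler_cvg_to _ _ _ _ (fun s => `|df (seg y s) - df (seg x s)|) _ _ _ _ (nn x y _ 1%N)).
    by apply: cvg_norm; apply: cvgB; exact: cvg_on.
  by apply: filterS near01 => s s01; apply: lip1; exact: segW.
- move=> x y [Kx xr] [Ky yr].
  apply: (up _ L); [|exact: normr_ge0|rewrite /C; lra].
  rewrite -[`|y - x|]expr1.
  apply: (@ler_cvg_to _ _ _ _ (fun s => `|d2f (seg y s) - d2f (seg x s)|) _ _ _ _ (nn x y _ 1%N)).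
    by apply: cvg_norm; apply: cvgB; exact: cvg_on.
  by apply: filterS near01 => s s01; rewrite expr1; apply: lipL; apply: WOm; exact: segW.
Unshelve. all: by end_near. Qed.

End defining_functions.

(** * A defining function on a full neighbourhood *)

Section bounded_lipschitz.
Context {R : realType} {V : normedModType R}.
Implicit Types A : set V.

(** Boundedness is part of the class because products of Lipschitz functions need it; one constant
    serves both bounds. *)
Definition blip (W : normedModType R) A (g : V -> W) :=
  exists2 C : R, 0 <= C & forall x y, A x -> A y ->
    `|g x| <= C /\ `|g y - g x| <= C * `|y - x|.

Lemma blip_cst (W : normedModType R) A (c : W) : blip A (fun _ : V => c).
Proof. by exists `|c| => // x y _ _; rewrite subrr normr0 mulr_ge0. Qed.

Lemma blipD (W : normedModType R) A (g h : V -> W) :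
  blip A g -> blip A h -> blip A (fun x => g x + h x).
Proof.
move=> [C C0 gC] [E E0 hE]; exists (C + E) => [|x y Ax Ay]; first exact: addr_ge0.
have [g1 g2] := gC _ _ Ax Ay; have [h1 h2] := hE _ _ Ax Ay; split.
  by rewrite (le_trans (ler_normD _ _))// lerD.
rewrite (_ : _ - _ = (g y - g x) + (h y - h x)); last by rewrite opprD addrACA.
by rewrite (le_trans (ler_normD _ _))// mulrDl lerD.
Qed.

Lemma blipZ (W : normedModType R) A (g : V -> R) (h : V -> W) :
  blip A g -> blip A h -> blip A (fun x => g x *: h x).
Proof.
move=> [C C0 gC] [E E0 hE]; exists (C * E + C * E) => [|x y Ax Ay].
  by rewrite addr_ge0// mulr_ge0.
have [g1 g2] := gC _ _ Ax Ay; have [h1 h2] := hE _ _ Ax Ay.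
have [g3 _] := gC _ _ Ay Ay; split.
  by rewrite normrZ -[leLHS]addr0 lerD ?mulr_ge0// ler_pM.
rewrite (_ : _ - _ = g y *: (h y - h x) + (g y - g x) *: h x); last first.
  by rewrite scalerBr scalerBl addrA subrK.
rewrite (le_trans (ler_normD _ _))// !normrZ mulrDl lerD//.
  by rewrite -mulrA ler_pM.
by rewrite mulrAC ler_pM.
Qed.

Lemma blipM A (g h : V -> R) : blip A g -> blip A h -> blip A (fun x => g x * h x).
Proof. exact: (@blipZ R^o). Qed.

Lemma blipN (W : normedModType R) A (g : V -> W) : blip A g -> blip A (fun x => - g x).
Proof.
move=> [C C0 gC]; exists C => // x y Ax Ay; have [g1 g2] := gC _ _ Ax Ay.
by rewrite normrN -opprD normrN.
Qed.

Lemma blipB (W : normedModType R) A (g h : V -> W) :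
  blip A g -> blip A h -> blip A (fun x => g x - h x).
Proof. by move=> bg bh; exact: blipD bg (blipN bh). Qed.

Lemma blip_sum (W : normedModType R) (I : Type) (s : seq I) A (g : I -> V -> W) :
  (forall i, blip A (g i)) -> blip A (fun x => \sum_(i <- s) g i x).
Proof.
move=> bg; elim: s => [|i s ih].
  rewrite (_ : (fun _ => _) = fun _ => 0); first exact: blip_cst.
  by apply/funext => x; rewrite big_nil.
rewrite (_ : (fun _ => _) = fun x => g i x + \sum_(i <- s) g i x); first exact: blipD.
by apply/funext => x; rewrite big_cons.
Qed.

Lemma blipV A (g : V -> R) (c : R) : 0 < c -> (forall x, A x -> c <= g x) ->
  blip A g -> blip A (fun x => (g x)^-1).
Proof.
move=> c0 cg [C C0 gC]; exists (c^-1 + C * (c^-1 * c^-1)) => [|x y Ax Ay].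
  by rewrite addr_ge0 ?mulr_ge0// invr_ge0 ltW.
have [g1 g2] := gC _ _ Ax Ay.
have cx := cg _ Ax; have cy := cg _ Ay.
have gx : 0 < g x by exact: lt_le_trans cx.
have gy : 0 < g y by exact: lt_le_trans cy.
have ic : 0 <= c^-1 by rewrite invr_ge0 ltW.
have ix : (g x)^-1 <= c^-1 by rewrite lef_pV2.
have iy : (g y)^-1 <= c^-1 by rewrite lef_pV2.
have ix0 : 0 <= (g x)^-1 by rewrite invr_ge0 ltW.
have iy0 : 0 <= (g y)^-1 by rewrite invr_ge0 ltW.
split; first by rewrite ger0_norm// (le_trans ix)// lerDl !mulr_ge0.
rewrite (_ : _ - _ = - (g y - g x) * ((g x)^-1 * (g y)^-1)); last first.
  by field; rewrite !gt_eqF.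
rewrite normrM normrN mulrDl (@le_trans _ _ (C * (c^-1 * c^-1) * `|y - x|))//; last first.
  by rewrite lerDr mulr_ge0.
by rewrite mulrAC ler_pM// ger0_norm ?mulr_ge0// ler_pM.
Qed.

Lemma blip_mx m k A (g : V -> 'M[R]_(m, k)) :
  (forall i j, blip A (fun x => g x i j)) -> blip A g.
Proof.
move=> bg; pose C i j := sval (cid2 (bg i j)).
have C0 i j : 0 <= C i j by rewrite /C; case: cid2.
have CP i j x y : A x -> A y ->
    `|g x i j| <= C i j /\ `|g y i j - g x i j| <= C i j * `|y - x|.
  by move=> Ax Ay; rewrite /C; case: cid2 => /= D D0; apply.
have CS i j : C i j <= \sum_i \sum_j C i j.
  rewrite (bigD1 i)//= (bigD1 j)//= -addrA lerDl addr_ge0 ?sumr_ge0// => k' _.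
  by rewrite sumr_ge0.
have S0 : 0 <= \sum_i \sum_j C i j by rewrite sumr_ge0// => i _; rewrite sumr_ge0.
exists (\sum_i \sum_j C i j) => // x y Ax Ay.
split; rewrite [leLHS]/Num.Def.normr/= mx_normrE; apply/bigmax_le.
- exact: S0.
- by move=> -[i j] _ /=; have [h _] := CP i j x y Ax Ay; exact: le_trans (CS i j).
- by rewrite mulr_ge0.
- move=> -[i j] _ /=; have [_ h] := CP i j x y Ax Ay.
  by rewrite !mxE (le_trans h)// ler_wpM2r.
Qed.

Lemma blip_coord m k A (g : V -> 'M[R]_(m, k)) i j : blip A g -> blip A (fun x => g x i j).
Proof.
have H (u : 'M[R]_(m, k)) : `|u i j| <= `|u|.
  by rewrite [leRHS]/Num.Def.normr/= mx_normrE; exact: (le_bigmax _ _ (i, j)).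
move=> [C C0 gC]; exists C => // x y Ax Ay; have [g1 g2] := gC _ _ Ax Ay.
split; first exact: le_trans g1.
by have := H (g y - g x); rewrite !mxE => /le_trans; apply.
Qed.

Lemma blip_row m k A (g : V -> 'M[R]_(m, k)) i : blip A g -> blip A (fun x => row i (g x)).
Proof.
move=> bg; apply: blip_mx => i' j.
rewrite (_ : (fun _ => _) = (fun x => g x i j)); first exact: blip_coord.
by apply/funext => x; rewrite mxE.
Qed.

Lemma blip_dot k A (g h : V -> 'rV[R]_k) : blip A g -> blip A h ->
  blip A (fun x => dot (g x) (h x)).
Proof.
move=> bg bh; rewrite (_ : (fun _ => _) = (fun x => \sum_i g x 0 i * h x 0 i)); last first.
  by apply/funext => x; rewrite dotE.
by apply: blip_sum => i; apply: blipM; exact: blip_coord.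
Qed.

Lemma lipschitz_blip (W : normedModType R) A (g : V -> W) (C : R) (p : V) (r : R) :
  0 <= C -> 0 <= r -> A p ->
  (forall x, A x -> `|x - p| <= r) ->
  (forall x y, A x -> A y -> `|g y - g x| <= C * `|y - x|) -> blip A g.
Proof.
move=> C0 r0 Ap Ar gC; exists (C + (`|g p| + C * r)) => [|x y Ax Ay].
  by rewrite !addr_ge0// mulr_ge0.
have h0 : 0 <= `|g p| + C * r by rewrite !addr_ge0// mulr_ge0.
split; last by rewrite (le_trans (gC _ _ Ax Ay))// ler_wpM2r// lerDl.
rewrite -(subrK (g p) (g x)) (le_trans (ler_normD _ _))// addrC.
rewrite (@le_trans _ _ (`|g p| + C * r))//; last by rewrite lerDr.
by rewrite lerD2l (le_trans (gC _ _ Ap Ax))// ler_wpM2l// Ar.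
Qed.

End bounded_lipschitz.

Lemma blip_comp (R : realType) (V W W' : normedModType R) (A : set V) (B : set W) (b : V -> W) (g : W -> W') :
  blip B g -> (forall x, A x -> B (b x)) ->
  (exists2 C : R, 0 <= C & forall x y, A x -> A y -> `|b y - b x| <= C * `|y - x|) ->
  blip A (fun x => g (b x)).
Proof.
move=> [C C0 gC] AB [E E0 bE]; exists (C + C * E) => [|x y Ax Ay].
  by rewrite addr_ge0// mulr_ge0.
have [g1 g2] := gC _ _ (AB _ Ax) (AB _ Ay); split.
  by rewrite (le_trans g1)// lerDl mulr_ge0.
rewrite (le_trans g2)// mulrDl -mulrA (@le_trans _ _ (C * (E * `|y - x|)))//.
  by rewrite ler_wpM2l// bE.
by rewrite lerDr mulr_ge0.
Qed.

(** * Calculus of functions of class C^{1,1} *)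

Section C11_functions.
Context {R : realType} {n : nat}.
Implicit Types (A : set 'rV[R]_n) (g h : 'rV[R]_n -> R) (D E : 'rV[R]_n -> 'rV[R]_n).

(** The quadratic remainder replaces differentiability: it passes to sums, products and inverses by
    algebraic identities, and partial derivatives are recovered from it by [taylor_on_is_derive]. *)
Definition C11 A g D := [/\ blip A g, blip A D & exists2 C : R, 0 <= C & taylor_on A g D C].

Lemma C11_sum (I : Type) (s : seq I) (c : I -> R) A (g : I -> 'rV[R]_n -> R) (D : I -> 'rV[R]_n -> 'rV[R]_n) :
  (forall i, C11 A (g i) (D i)) ->
  C11 A (fun x => \sum_(i <- s) c i * g i x) (fun x => \sum_(i <- s) c i *: D i x).
Proof.
move=> H; split.
- by apply: blip_sum => i; have [bg _ _] := H i; apply: blipM => //; exact: blip_cst.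
- by apply: blip_sum => i; have [_ bD _] := H i; apply: blipZ => //; exact: blip_cst.
- elim: s => [|i s [C C0 ih]].
    by exists 0 => // x y _ _; rewrite !big_nil dot0l !subr0 normr0 mul0r.
  have [_ _ [E E0 gE]] := H i; exists (C + `|c i| * E) => [|x y Ax Ay].
    by rewrite addr_ge0// mulr_ge0.
  rewrite !big_cons dotDl dotZl.
  set sy := \sum_(_ <- _) _; set sx := \sum_(_ <- _) _; set sd := \sum_(_ <- _) _.
  rewrite (_ : _ - _ - _ = (sy - sx - dot sd (y - x)) +
     c i * (g i y - g i x - dot (D i x) (y - x))); last by ring.
  rewrite (le_trans (ler_normD _ _))// mulrDl lerD//; first exact: ih.
  by rewrite normrM -mulrA ler_wpM2l//; exact: gE.
Qed.

Lemma C11_mul A g h D E : C11 A g D -> C11 A h E ->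
  C11 A (fun x => g x * h x) (fun x => g x *: E x + h x *: D x).
Proof.
move=> [bg bD [C C0 tg]] [bh bE [C' C'0 th]]; split.
- exact: blipM.
- by apply: blipD; exact: blipZ.
have [M M0 gM] := bg; have [N N0 hN] := bh.
exists (M * C' + N * C + M * N) => [|x y Ax Ay].
  by rewrite !addr_ge0// mulr_ge0.
have [g1 g2] := gM _ _ Ax Ay; have [h1 h2] := hN _ _ Ax Ay.
rewrite dotDl !dotZl.
have t1 := tg _ _ Ax Ay; have t2 := th _ _ Ax Ay.
rewrite (_ : _ - _ - _ = g x * (h y - h x - dot (E x) (y - x)) +
  h x * (g y - g x - dot (D x) (y - x)) + (g y - g x) * (h y - h x)); last by ring.
rewrite (le_trans (ler_normD _ _))// [leRHS]mulrDl lerD//.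
  rewrite (le_trans (ler_normD _ _))// [leRHS]mulrDl lerD//.
    by rewrite normrM -mulrA ler_pM.
  by rewrite normrM -mulrA ler_pM.
rewrite normrM expr2 [leRHS](_ : _ = (M * `|y - x|) * (N * `|y - x|)); last by ring.
by rewrite ler_pM.
Qed.

Lemma C11_inv A g D (c : R) : 0 < c -> (forall x, A x -> c <= g x) -> C11 A g D ->
  C11 A (fun x => (g x)^-1) (fun x => - (((g x)^-1 * (g x)^-1) *: D x)).
Proof.
move=> c0 cg [bg bD [C C0 tg]]; have bi := blipV c0 cg bg; split => //.
  by apply: blipN; apply: blipZ => //; exact: blipM.
have [M M0 iM] := bi; have [N N0 gN] := bg; have [P P0 DP] := bD.
exists (M * M * C + M * M * M * (N * (n%:R * P))) => [|x y Ax Ay].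
  by rewrite addr_ge0// !mulr_ge0.
have [i1 i2] := iM _ _ Ax Ay; have [i3 _] := iM _ _ Ay Ay.
have [g1 g2] := gN _ _ Ax Ay; have [d1 _] := DP _ _ Ax Ay.
have t1 := tg _ _ Ax Ay.
have gx : g x != 0 by rewrite gt_eqF// (lt_le_trans c0)// cg.
have gy : g y != 0 by rewrite gt_eqF// (lt_le_trans c0)// cg.
rewrite dotNl dotZl.
rewrite (_ : _ - _ - _ = - ((g x)^-1 * (g y)^-1 * (g y - g x - dot (D x) (y - x))) +
  (g x)^-1 * (g x)^-1 * (g y)^-1 * ((g y - g x) * dot (D x) (y - x))); last first.
  by field; rewrite gx gy.
rewrite (le_trans (ler_normD _ _))// [leRHS]mulrDl lerD//.
  by rewrite normrN normrM -mulrA -[leRHS]mulrA [leRHS]mulrA ler_pM// normrM ler_pM.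
rewrite normrM -[leRHS]mulrA ler_pM//.
  by rewrite !normrM !ler_pM// mulr_ge0.
rewrite normrM [leRHS](_ : _ = (N * `|y - x|) * (n%:R * (P * `|y - x|))); last by ring.
rewrite ler_pM// (le_trans (norm_dot_le _ _))// ler_wpM2l// ler_wpM2r//.
Qed.

End C11_functions.

(** * Depth of a point in a convex set along a fixed direction *)

Section depth_function.
Context {R : realType} {n : nat}.
Variables (K : set 'rV[R]_n) (p0 e : 'rV[R]_n) (r k d tau : R).
Hypothesis closedK : closed K.
Hypothesis cK : segment_closed K.
Hypothesis Kp0 : K p0.
Hypothesis nKp0 : ~ K° p0.
Hypothesis r0 : 0 < r.
Hypothesis kr : k * r = 2.
Hypothesis kdtau : k * d < tau.
Hypothesis tau1 : tau <= 1.
Hypothesis tau_e : tau * `|e| <= r / 2.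
Hypothesis dr : d <= r / 4.
Hypothesis kdr : (1 + k * `|e|) * d <= r / 2.
Hypothesis cone : forall b w (s : R), K b -> `|b - p0| <= r -> 0 <= s <= 1 -> `|w| < r ->
  K (b + s *: (e + w)).
Implicit Types x y b : 'rV[R]_n.

(** Decreasing t moves the point inwards, so near p0 only negative t qualify for x outside K, and
    the value is negative there. A set without supremum would get the default value of [sup];
    [has_sup_depth] excludes this near p0. *)
Definition depth x : R := sup [set t | K (x - t *: e)].

Let k0 : 0 < k.
Proof. by rewrite -(pmulr_lgt0 _ r0) kr. Qed.

(** The slope k = 2 / r, rather than 1 / r, makes the rescaled displacement strictly shorter than r,
    as [cone] requires. *)
Lemma cone_shift b h : K b -> `|b - p0| <= r -> k * `|h| <= 1 ->
  K (b + h + (k * `|h|) *: e).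
Proof.
move=> Kb br kh; have [->|h0] := eqVneq h 0.
  by rewrite normr0 mulr0 scale0r !addr0.
have hp : 0 < k * `|h| by rewrite mulr_gt0// normr_gt0.
have -> : b + h + (k * `|h|) *: e = b + (k * `|h|) *: (e + (k * `|h|)^-1 *: h).
  by rewrite scalerDr scalerA mulfV ?gt_eqF// scale1r -addrA [h + _]addrC.
apply: cone => //; first by rewrite kh ltW.
rewrite normrZ gtr0_norm ?invr_gt0// invfM -mulrA mulVf ?normr_eq0// mulr1.
by rewrite invf_plt ?posrE// -(ltr_pM2r r0) kr mulVf ?gt_eqF// ltr1n.
Qed.

Let plus_e x : `|x - p0| <= d -> K (x + e).
Proof.
move=> xd; have -> : x + e = p0 + 1 *: (e + (x - p0)).
  by rewrite scale1r [e + _]addrC addrA [p0 + _]addrC subrK.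
apply: cone; rewrite ?subrr ?normr0 ?ler01 ?lexx//; first exact: ltW.
by move: xd dr r0 => *; lra.
Qed.

Let line x (t u : R) : `|x - p0| <= d -> -1 <= u <= t -> K (x - t *: e) -> K (x - u *: e).
Proof.
move=> xd /andP[u1 ut] Kt.
have [-> //|neq] := eqVneq u t.
have ltu : u < t by rewrite lt_neqAle neq.
have t1 : 0 < 1 + t by lra.
have -> : x - u *: e = (x - t *: e) + ((t - u) / (1 + t)) *: ((x + e) - (x - t *: e)).
  by apply/rowP => i; rewrite !mxE; field; rewrite gt_eqF.
apply: cK => //; first exact: plus_e.
apply/andP; split; first by rewrite divr_ge0; lra.
by rewrite ler_pdivrMr//; lra.
Qed.

(* Otherwise p0 would be an interior point of the cone at a point of K behind p0. *)
Let upper x (t : R) : `|x - p0| <= d -> K (x - t *: e) -> t <= k * `|x - p0|.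
Proof.
move=> xd Kt; rewrite leNgt; apply/negP => kt.
(* Cutting t off at tau keeps the point within r of p0, where [cone] applies. *)
pose t' := Num.min t tau.
have xr : 0 <= k * `|x - p0| by rewrite mulr_ge0// ltW.
have kt' : k * `|x - p0| < t'.
  by rewrite lt_min kt/= (le_lt_trans _ kdtau)// ler_pM2l.
have t't : t' <= t by rewrite ge_min lexx.
have t'tau : t' <= tau by rewrite ge_min lexx orbT.
have t'0 : 0 < t' by exact: le_lt_trans kt'.
clearbody t'.
have Kb : K (x - t' *: e).
  by apply: line Kt => //; rewrite t't andbT (le_trans _ (ltW t'0))// lerN10.
have br : `|x - t' *: e - p0| <= r.
  rewrite addrAC (le_trans (ler_normB _ _))// normrZ gtr0_norm//.
  have : t' * `|e| <= tau * `|e| by rewrite ler_wpM2r.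
  by move: xd dr r0 tau_e => *; lra.
apply: nKp0; apply/interior_ballP; exists (t' * r - `|p0 - x|).
  rewrite subr_gt0 distrC -(ltr_pM2l k0) mulrCA kr; lra.
move=> y yr; have -> : y = x - t' *: e + t' *: (e + t'^-1 *: (y - x)).
  rewrite scalerDr scalerA mulfV ?gt_eqF// scale1r addrA subrK.
  by rewrite addrC subrK.
apply: cone => //; first by rewrite (ltW t'0) (le_trans t'tau).
rewrite normrZ gtr0_norm ?invr_gt0// mulrC ltr_pdivrMr// mulrC.
rewrite -(subrK p0 y) -addrA (le_lt_trans (ler_normD _ _))//.
by rewrite -ltrBrDr.
Qed.

Let has_sup_depth x : `|x - p0| <= d -> has_sup [set t | K (x - t *: e)].
Proof.
move=> xd; split; last by exists (k * `|x - p0|) => t; exact: upper.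
by exists (-1); rewrite /= scaleN1r opprK; exact: plus_e.
Qed.

Let ge_depth x (t : R) : `|x - p0| <= d -> K (x - t *: e) -> t <= depth x.
Proof. by move=> /has_sup_depth[_ hs] Kt; apply: ub_le_sup. Qed.

Let depth_lower x : `|x - p0| <= d -> - (k * `|x - p0|) <= depth x.
Proof.
move=> xd; apply: ge_depth => //; rewrite scaleNr opprK.
have := @cone_shift p0 (x - p0) Kp0.
rewrite subrr normr0 [p0 + _]addrC subrK; apply; first exact: ltW.
by rewrite (le_trans _ tau1)// (le_trans _ (ltW kdtau))// ler_pM2l.
Qed.

Let depth_upper x : `|x - p0| <= d -> depth x <= k * `|x - p0|.
Proof. by move=> xd; apply: ge_sup; [case: (has_sup_depth xd)|move=> t; exact: upper]. Qed.

Lemma norm_depth x : `|x - p0| <= d -> `|depth x| <= k * `|x - p0|.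
Proof. by move=> xd; rewrite ler_norml depth_lower//= depth_upper. Qed.

Lemma depth_attained x : `|x - p0| <= d -> K (x - depth x *: e).
Proof.
move=> xd; apply: contrapT => nK.
have /nbhs_ballP[s /= s0 sK] : nbhs (x - depth x *: e) (~` K).
  by apply: open_nbhs_nbhs; split; [exact: closed_openC|].
have e0 : 0 < 1 + `|e| by rewrite ltr_pwDl.
have [t Kt] := sup_adherent (divr_gt0 s0 e0) (has_sup_depth xd).
rewrite -/(depth x) => tx.
have td := ge_depth xd Kt.
apply: (sK (x - t *: e)) Kt; rewrite -ball_normE/=.
rewrite (_ : _ - _ = - ((depth x - t) *: e)); last by apply/rowP => i; rewrite !mxE; ring.
rewrite normrN normrZ ger0_norm ?subr_ge0// (@le_lt_trans _ _ ((depth x - t) * (1 + `|e|)))//.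
  by rewrite ler_wpM2l ?subr_ge0// lerDr.
by rewrite -ltr_pdivlMr//; lra.
Qed.

Lemma foot_near x : `|x - p0| <= d -> `|x - depth x *: e - p0| <= (1 + k * `|e|) * `|x - p0|.
Proof.
move=> xd; rewrite addrAC (le_trans (ler_normB _ _))// normrZ mulrDl mul1r lerD2l.
by rewrite mulrAC ler_wpM2r// norm_depth.
Qed.

Let foot_r x : `|x - p0| <= d -> `|x - depth x *: e - p0| <= r.
Proof.
move=> xd; rewrite (le_trans (foot_near xd))//.
have : (1 + k * `|e|) * `|x - p0| <= (1 + k * `|e|) * d.
  by rewrite ler_wpM2l// addr_ge0// mulr_ge0// ltW.
by move: kdr r0 => *; lra.
Qed.

(** Translating the foot of x by y - x and then pushing it by k |y - x| along e stays in K, so the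
    depth drops by at most k |y - x|; exchanging x and y gives the other bound. *)
Lemma depth_lip x y : `|x - p0| <= d -> `|y - p0| <= d ->
  k * `|y - x| <= 1 -> `|depth y - depth x| <= k * `|y - x|.
Proof.
have H x' y' : `|x' - p0| <= d -> `|y' - p0| <= d ->
    k * `|y' - x'| <= 1 -> depth x' - k * `|y' - x'| <= depth y'.
  move=> xd yd kxy; apply: ge_depth => //.
  have := cone_shift (depth_attained xd) (foot_r xd) kxy.
  rewrite (_ : _ + _ + _ = y' - (depth x' - k * `|y' - x'|) *: e)//.
  by move: (k * _) => q; apply/rowP => i; rewrite !mxE; ring.
move=> xd yd kxy; have := H _ _ xd yd kxy; have := H _ _ yd xd.
by rewrite distrC => /(_ kxy) ? ?; rewrite ler_norml; apply/andP; split; lra.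
Qed.

Lemma depth_ge0 x : `|x - p0| <= d -> (0 <= depth x) <-> K x.
Proof.
move=> xd; split=> [x0|Kx]; last by apply: ge_depth => //; rewrite scale0r subr0.
rewrite -[x]subr0 -(scale0r e); apply: line (depth_attained xd) => //.
by rewrite x0 lerN10.
Qed.

Lemma foot_not_interior x : `|x - p0| < d -> ~ K° (x - depth x *: e).
Proof.
move=> xd /interior_ballP[s s0 sK].
have e0 : 0 < 1 + `|e| by rewrite ltr_pwDl.
suff : depth x + s / (2 * (1 + `|e|)) <= depth x.
  by rewrite gerDl leNgt divr_gt0// mulr_gt0.
apply: ge_depth; first exact: ltW.
apply: sK; rewrite (_ : _ - _ = - ((s / (2 * (1 + `|e|))) *: e)); last first.
  by move: (s / _) => q; apply/rowP => i; rewrite !mxE; ring.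
rewrite normrN normrZ gtr0_norm ?divr_gt0 ?mulr_gt0// mulrAC ltr_pdivrMr ?mulr_gt0//.
by rewrite ltr_pM2l//; lra.
Qed.

(** If the depth were positive, x would lie inside the cone issued from its foot and be interior to
    K. *)
Lemma depth_eq0 x : `|x - p0| < d -> depth x = 0 <-> (K x /\ ~ K° x).
Proof.
move=> xd; have xd' := ltW xd; split=> [x0|[Kx nKx]].
  split; first by apply/depth_ge0 => //; rewrite x0.
  by have := foot_not_interior xd; rewrite x0 scale0r subr0.
apply/eqP; rewrite eq_le (depth_ge0 xd').2// andbT leNgt; apply/negP => x0.
apply: nKx; apply/interior_ballP; exists (depth x * r); first by rewrite mulr_gt0.
move=> y yr; have -> : y = x - depth x *: e + depth x *: (e + (depth x)^-1 *: (y - x)).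
  rewrite scalerDr scalerA mulfV ?gt_eqF// scale1r addrA subrK.
  by rewrite addrC subrK.
apply: cone; [exact: depth_attained|exact: foot_r| |].
  rewrite ltW//= (le_trans (depth_upper xd'))//.
  by rewrite (le_trans _ tau1)// (le_trans _ (ltW kdtau))// ler_pM2l.
by rewrite normrZ gtr0_norm ?invr_gt0// mulrC ltr_pdivrMr// mulrC.
Qed.

End depth_function.
Section defining_near_boundary.
Context {R : realType} {n : nat}.
Implicit Types x y p v : 'rV[R]_n.

Definition oball p (r : R) : set 'rV[R]_n := [set x | `|x - p| < r].

Lemma gradient_inward (K : set 'rV[R]_n) p U f df v : segment_closed K ->
  (forall r : R, 0 < r -> exists2 q, K° q & `|q - p| < r) ->
  defining_near K p U f df -> K p -> f p = 0 -> K (p + v) -> 0 <= dot (df p) v.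
Proof.
move=> cK Kp Hf Kpp fp Kv.
have [d2f [r [C /= [[r0 C0 rU] [T1 _ _ _]]]]] := defining_taylor cK Kp Hf.
have [_ [_ [fge0 _ _]]] := Hf.
rewrite leNgt; apply/negP => D0.
pose q := C * `|v| ^+ 2 + 1.
have q0 : 0 < q by rewrite ltr_pwDr// mulr_ge0 ?sqr_ge0// ltW.
(* The point p + v may be far away; convexity allows v to be shrunk. The three bounds keep p + s v
   in K, keep it in the ball of the expansion, and make the quadratic term smaller than the linear
   one. *)
pose s := Num.min 1 (Num.min (r / (2 * (1 + `|v|))) (- dot (df p) v / (2 * q))).
have v0 : 0 < 1 + `|v| by rewrite ltr_pwDl.
have s0 : 0 < s by rewrite !lt_min ltr01 !divr_gt0 ?mulr_gt0// oppr_gt0.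
have s1 : s <= 1 by rewrite ge_min lexx.
have sr : s <= r / (2 * (1 + `|v|)) by rewrite !ge_min lexx orbT.
have sq : s <= - dot (df p) v / (2 * q) by rewrite !ge_min lexx !orbT.
clearbody s.
have Ks : K (p + s *: v).
  have := cK p (p + v) s Kpp Kv; rewrite [p + v]addrC addrK; apply.
  by rewrite s1 ltW.
have psr : `|p + s *: v - p| < r.
  rewrite [p + _]addrC addrK normrZ gtr0_norm//.
  have : s * (2 * (1 + `|v|)) <= r by rewrite -ler_pdivlMr// mulr_gt0.
  by have := mulr_gt0 s0 v0; lra.
have fs := fge0 _ Ks (rU _ psr).
have := @T1 p (p + s *: v); rewrite /= subrr normr0 => /(_ (conj Kpp r0) (conj Ks psr)).
rewrite fp subr0 [p + _]addrC addrK dotZr normrZ gtr0_norm// exprMn => h.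
have {}h : f (s *: v + p) <= s * dot (df p) v + C * (s ^+ 2 * `|v| ^+ 2).
  by move: h; rewrite ler_norml => /andP[_]; lra.
have {}h : 0 <= s * (dot (df p) v + s * (C * `|v| ^+ 2)).
  rewrite [p + _]addrC in fs; rewrite (le_trans fs)// (le_trans h)//.
  by rewrite le_eqVlt; apply/orP; left; apply/eqP; ring.
rewrite pmulr_rge0// in h.
have : s * (2 * q) <= - dot (df p) v by rewrite -ler_pdivlMr// mulr_gt0.
have : 0 <= s * (C * `|v| ^+ 2) by rewrite !mulr_ge0// ?ltW// exprn_gt0//.
rewrite /q; nra.
Qed.

(** The normalisation along e is the identity f(x + s e) = f(x) + s, differentiated; it keeps [df]
    away from zero on the whole ball, not only on the boundary. *)
Definition good_defining (K : set 'rV[R]_n) p (f : 'rV[R]_n -> R)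
    (df : 'rV[R]_n -> 'rV[R]_n) (d2f : 'rV[R]_n -> 'M[R]_n) (e : 'rV[R]_n) (rho : R) :=
  [/\ 0 < rho,
      forall x, oball p rho x -> (0 <= f x <-> K x),
      forall x, oball p rho x -> (f x = 0 <-> boundary K x) &
      forall x, oball p rho x -> dot (df x) e = 1] /\
  C11 (oball p rho) f df /\
  forall i, C11 (oball p rho) (fun x => df x 0 i) (fun x => row i (d2f x)).

(** Implicit differentiation: the feet [b x] lie on the zero set of f0, and expanding f0 between the
    feet of x and y gives the gradient a / <a, e>, with a the gradient of f0 at the foot. Regularity
    is bootstrapped: f is Lipschitz, hence b, hence a and [df]; then come the remainders of f, of a
    and of [df]. *)
Lemma exists_good_defining (K : set 'rV[R]_n) p0 : billiard_table K ->
  convex_set (K : set (convex_lmodType 'rV[R]_n)) -> boundary K p0 ->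
  exists f df d2f e rho, good_defining K p0 f df d2f e rho.
Proof.
move=> [[G [oG _ KG]] HK] /convex_setP cK bp0.
have clK : closed K by rewrite KG; exact: closed_closure.
have [Kp0 nKp0] := (boundary_closed p0 clK).1 bp0.
have near_int := closure_interior_near oG KG Kp0.
have [U [f0 [df0 Hf0]]] := HK p0 bp0.
have [q Kq _] := near_int 1 ltr01.
have [rq rq0 qK] := (interior_ballP K q).1 Kq.
pose e := q - p0.
(* One half of the radius absorbs the displacement of the apex b from p0, the other half the
   perturbation w. *)
pose r := rq / 2.
have r0 : 0 < r by rewrite divr_gt0.
have cone b w (s : R) : K b -> `|b - p0| <= r -> 0 <= s <= 1 -> `|w| < r ->
    K (b + s *: (e + w)).
  move=> Kb br /andP[s0 s1] wr; have [->|sn] := eqVneq s 0.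
    by rewrite scale0r addr0.
  have {sn}s0 : 0 < s by rewrite lt_neqAle eq_sym sn.
  apply: (segment_ball cK Kb qK (s := s)); first by rewrite s0.
  rewrite (_ : _ - _ = s *: (w + (b - p0))); last first.
    by apply/rowP => i; rewrite !mxE; ring.
  rewrite normrZ gtr0_norm// ltr_pM2l// (le_lt_trans (ler_normD _ _))//.
  by rewrite [ltRHS](_ : _ = r + r); [rewrite ltr_leD|rewrite /r; field].
have [d2f0 [r1 [C /= [[r10 C0 rU] [T1 T2 L1 L2]]]]] := defining_taylor cK near_int Hf0.
have [_ [_ [fge0 fbd fn0]]] := Hf0.
have fp0 : f0 p0 = 0.
  have : (boundary K `&` slice U) p0.
    by split=> //; apply: rU; rewrite subrr normr0.
  by rewrite fbd => -[].
(* [gradient_inward] gives a weak inequality; applied to e tilted slightly against the gradient, it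
   becomes strict. *)
have dfe : 0 < dot (df0 p0) e.
  have g0 : df0 p0 != 0.
    by apply: fn0 => //; apply: subset_closure; apply: rU; rewrite subrr normr0.
  pose eta := r / (2 * `|df0 p0|).
  have ng : 0 < `|df0 p0| by rewrite normr_gt0.
  have eta0 : 0 < eta by rewrite divr_gt0// mulr_gt0.
  have : 0 <= dot (df0 p0) (e - eta *: df0 p0).
    apply: (gradient_inward cK near_int Hf0 Kp0 fp0).
    rewrite -[e - _]scale1r; apply: cone => //; rewrite ?subrr ?normr0 ?ler01 ?lexx ?ltW//.
    rewrite normrN normrZ gtr0_norm// /eta invfM mulrA mulfVK ?gt_eqF//; lra.
  rewrite dotBr dotZr; have := mulr_gt0 eta0 (dot_gt0 g0).
  by lra.
pose c0 := dot (df0 p0) e / 2.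
have c00 : 0 < c0 by rewrite divr_gt0.
pose m := n%:R * (C * `|e|) + 1.
have m0 : 0 < m by rewrite ltr_pwDr// !mulr_ge0// ltW.
(* Within r2 of p0 the product of the gradient with e loses at most half of its value at p0. *)
pose r2 := Num.min r1 (c0 / m).
have r20 : 0 < r2 by rewrite lt_min r10 divr_gt0.
have r21 : r2 <= r1 by rewrite ge_min lexx.
have r2c : r2 <= c0 / m by rewrite ge_min lexx orbT.
clearbody r2.
pose A1 := [set x | K x /\ `|x - p0| < r1].
pose A2 := [set x | K x /\ `|x - p0| < r2].
have A21 x : A2 x -> A1 x by case=> Kx xr; split=> //; exact: lt_le_trans r21.
have Ap0 : A2 p0 by split=> //; rewrite subrr normr0.
have uc x : A2 x -> c0 <= dot (df0 x) e.
  move=> [Kx xr].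
  have -> : dot (df0 x) e = 2 * c0 + dot (df0 x - df0 p0) e by rewrite dotBl /c0; field.
  have : `|dot (df0 x - df0 p0) e| <= c0.
    rewrite (le_trans (norm_dot_le _ _))//.
    have h : `|df0 x - df0 p0| <= C * `|x - p0| by apply: L1; apply: A21.
    apply: (@le_trans _ _ (n%:R * (C * `|x - p0| * `|e|))).
      by rewrite ler_wpM2l// ler_wpM2r.
    rewrite [leLHS](_ : _ = (m - 1) * `|x - p0|); last by rewrite /m; ring.
    have : m * `|x - p0| <= c0 by rewrite mulrC -ler_pdivlMr// ltW// (lt_le_trans xr).
    by have := normr_ge0 (x - p0); lra.
  by rewrite ler_norml => /andP[]; lra.
pose k := 2 / r.
have kr : k * r = 2 by rewrite /k mulfVK ?gt_eqF.
have k0 : 0 < k by rewrite divr_gt0.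
have e1 : 0 < 1 + `|e| by rewrite ltr_pwDl.
have ke1 : 0 < 1 + k * `|e| by rewrite ltr_pwDl// mulr_ge0// ltW.
pose tau := Num.min 1 (r / (2 * (1 + `|e|))).
have tau0 : 0 < tau by rewrite lt_min ltr01 divr_gt0// mulr_gt0.
have tau1 : tau <= 1 by rewrite ge_min lexx.
have tau_e : tau * `|e| <= r / 2.
  have : tau * (2 * (1 + `|e|)) <= r.
    by rewrite -ler_pdivlMr ?mulr_gt0// ge_min lexx orbT.
  by lra.
clearbody tau k e.
pose d := Num.min (r / 4) (Num.min (tau / (2 * k)) (r / (2 * (1 + k * `|e|)))).
have d0 : 0 < d by rewrite !lt_min !divr_gt0// mulr_gt0.
have dr : d <= r / 4 by rewrite ge_min lexx.
have kdtau : k * d < tau.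
  have : d * (2 * k) <= tau by rewrite -ler_pdivlMr ?mulr_gt0// !ge_min lexx orbT.
  by have := mulr_gt0 k0 d0; lra.
have kdr : (1 + k * `|e|) * d <= r / 2.
  have : d * (2 * (1 + k * `|e|)) <= r.
    by rewrite -ler_pdivlMr ?mulr_gt0// !ge_min lexx !orbT.
  by lra.
clearbody d.
pose rho := Num.min d (Num.min (r2 / (1 + k * `|e|)) (1 / (2 * k))).
have rho0 : 0 < rho by rewrite !lt_min !divr_gt0// ?mulr_gt0// d0.
have rhod : rho <= d by rewrite ge_min lexx.
have rho2 : rho * (1 + k * `|e|) <= r2 by rewrite -ler_pdivlMr// !ge_min lexx orbT.
have rhok : rho * (2 * k) <= 1 by rewrite -ler_pdivlMr ?mulr_gt0// !ge_min lexx !orbT.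
clearbody rho.
pose f := depth K e.
pose b x := x - f x *: e.
pose B := oball p0 rho.
have Bd x : B x -> `|x - p0| < d by move=> /lt_le_trans; apply.
have Bd' x : B x -> `|x - p0| <= d by move=> /Bd/ltW.
have flip x y : B x -> B y -> `|f y - f x| <= k * `|y - x|.
  move=> Bx By; apply: (depth_lip clK cK Kp0 nKp0 r0 kr kdtau tau1 tau_e dr kdr cone).
  - exact: Bd'.
  - exact: Bd'.
  - have : `|y - x| <= 2 * rho.
      rewrite -(subrK p0 y) -addrA (le_trans (ler_normD _ _))// (distrC p0).
      by have := ltW Bx; have := ltW By; rewrite /=; lra.
    by rewrite -(ler_pM2l k0); lra.
have bA x : B x -> A2 (b x).
  move=> Bx; split.
    by have := depth_attained clK cK Kp0 nKp0 r0 kr kdtau tau1 tau_e dr cone (Bd' _ Bx).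
  have := foot_near cK Kp0 nKp0 r0 kr kdtau tau1 tau_e dr cone (Bd' _ Bx).
  move=> /le_lt_trans; apply; rewrite (lt_le_trans _ rho2)// mulrC ltr_pM2r//.
have nb x : B x -> ~ K° (b x).
  move=> Bx.
  exact: (foot_not_interior cK Kp0 nKp0 r0 kr kdtau tau1 tau_e dr cone (Bd _ Bx)).
have f0b x : B x -> f0 (b x) = 0.
  move=> Bx; have [Kb br] := bA _ Bx.
  have : (boundary K `&` slice U) (b x).
    split; last by apply: rU; exact: lt_le_trans r21.
    by apply/(boundary_closed _ clK); split=> //; exact: nb.
  by rewrite fbd => -[].
have Bp0 : B p0 by rewrite /B /oball/= subrr normr0.
have Br x : B x -> `|x - p0| <= rho by move=> /ltW.
have bf : blip B f by apply: (@lipschitz_blip _ _ _ _ _ k p0 rho) => //; rewrite ltW.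
pose L := 1 + k * `|e|.
have L0 : 0 <= L by rewrite ltW.
have blip_b x y : B x -> B y -> `|b y - b x| <= L * `|y - x|.
  move=> Bx By; rewrite (_ : _ - _ = (y - x) - (f y - f x) *: e); last first.
    by apply/rowP => i; rewrite !mxE; ring.
  rewrite (le_trans (ler_normB _ _))// normrZ /L mulrDl mul1r lerD2l mulrAC.
  by rewrite ler_wpM2r// flip.
have blipA (W : normedModType R) (g : 'rV[R]_n -> W) :
    (forall x y, A1 x -> A1 y -> `|g y - g x| <= C * `|y - x|) -> blip B (fun x => g (b x)).
  move=> gC; apply: (@blip_comp _ _ _ _ B A2) => //; last by exists L.
  apply: (@lipschitz_blip _ _ _ _ _ C p0 r2) => //; try exact: ltW.
    by move=> x [_ /ltW].
  by move=> x y /A21 ? /A21 ?; exact: gC.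
pose a x := df0 (b x).
have ba : blip B a by exact: blipA.
have bM : blip B (fun x => d2f0 (b x)) by exact: blipA.
pose u x := dot (a x) e.
have bu : blip B u by apply: blip_dot => //; exact: blip_cst.
have cu x : B x -> c0 <= u x by move=> Bx; apply: uc; exact: bA.
have u0 x : B x -> u x != 0 by move=> /cu h; rewrite gt_eqF// (lt_le_trans c00).
pose df x := (u x)^-1 *: a x.
have bdf : blip B df by apply: blipZ => //; exact: blipV cu bu.
have bsq x y : B x -> B y -> C * `|b y - b x| ^+ 2 <= C * L ^+ 2 * `|y - x| ^+ 2.
  move=> Bx By; rewrite -mulrA -exprMn ler_wpM2l ?(ltW C0)// lerXn2r ?nnegrE ?mulr_ge0//.
  exact: blip_b.
have bE x y : b y - b x = (y - x) - (f y - f x) *: e.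
  by apply/rowP => i; rewrite !mxE; ring.
have Cf : C11 B f df.
  split=> //; exists (C * L ^+ 2 / c0) => [|x y Bx By].
    by rewrite divr_ge0 ?mulr_ge0 ?sqr_ge0// ltW.
  have := T1 _ _ (A21 _ (bA _ Bx)) (A21 _ (bA _ By)).
  rewrite !f0b// subrr sub0r normrN => /le_trans/(_ (bsq _ _ Bx By)) h.
  have -> : f y - f x - dot (df x) (y - x) = - ((u x)^-1 * dot (df0 (b x)) (b y - b x)).
    by rewrite /df dotZl (bE x y) !dotBr dotZr -/(a x) -/(u x); field; exact: u0.
  have ux : 0 < u x by rewrite (lt_le_trans c00)// cu.
  rewrite normrN normrM gtr0_norm ?invr_gt0// [leRHS]mulrAC [leRHS]mulrC.
  by rewrite ler_pM ?invr_ge0 ?(ltW ux)// lef_pV2 ?posrE// cu.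
have [M M0 MP] := bM.
(* Chain rule through the foot map, whose differential sends h to h - <df x, h> e. *)
pose D i x := row i (d2f0 (b x)) - dot (row i (d2f0 (b x))) e *: df x.
have Ca i : C11 B (fun x => a x 0 i) (D i).
  split.
  - exact: blip_coord.
  - apply: blipB; first exact: blip_row.
    by apply: blipZ => //; apply: blip_dot; [exact: blip_row|exact: blip_cst].
  - have [_ _ [Ef Ef0 tf]] := Cf.
    exists (C * L ^+ 2 + n%:R * (M * `|e|) * Ef) => [|x y Bx By].
      by rewrite addr_ge0 ?mulr_ge0 ?sqr_ge0// ltW.
    have := T2 i _ _ (A21 _ (bA _ Bx)) (A21 _ (bA _ By)).
    move=> /le_trans/(_ (bsq _ _ Bx By)) h.
    rewrite (_ : _ - _ - _ =
      (df0 (b y) 0 i - df0 (b x) 0 i - dot (row i (d2f0 (b x))) (b y - b x))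
      - dot (row i (d2f0 (b x))) e * (f y - f x - dot (df x) (y - x))); last first.
      by rewrite /D /a bE !dotBl !dotBr !dotZl !dotZr; ring.
    rewrite (le_trans (ler_normB _ _))// [leRHS]mulrDl lerD// normrM -[leRHS]mulrA.
    apply: ler_pM => //; last exact: tf.
    rewrite (le_trans (norm_dot_le _ _))// ler_wpM2l// ler_wpM2r//.
    rewrite (le_trans (norm_row_le _ _))//.
    by have [] := MP _ _ Bx Bx.
have Cu : C11 B u (fun x => \sum_j e 0 j *: D j x).
  rewrite (_ : u = fun x => \sum_j e 0 j * a x 0 j).
    exact: (C11_sum _ (fun j => e 0 j) (g := fun j x => a x 0 j)).
  by apply/funext => x; rewrite /u dotC dotE.
have Cdf i := C11_mul (C11_inv c00 cu Cu) (Ca i).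
pose D2 i x := (u x)^-1 *: D i x +
  a x 0 i *: (- (((u x)^-1 * (u x)^-1) *: \sum_j e 0 j *: D j x)).
exists f, df, (fun x => \matrix_(i, j) D2 i x 0 j), e, rho; split.
  split=> // x Bx.
  - exact: (depth_ge0 clK cK Kp0 nKp0 r0 kr kdtau tau1 tau_e dr cone (Bd' _ Bx)).
  - rewrite (boundary_closed _ clK).
    exact: (depth_eq0 clK cK Kp0 nKp0 r0 kr kdtau tau1 tau_e dr kdr cone (Bd _ Bx)).
  - by rewrite /df dotZl -/(u x) mulVf// u0.
split=> // i; have := Cdf i; congr C11.
- by apply/funext => x; rewrite /df !mxE.
- by apply/funext => x; apply/rowP => j; rewrite [RHS]mxE [RHS]mxE.
Qed.

End defining_near_boundary.

(** * Normals and the reflection law *)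

Section boundary_geometry.
Context {R : realType} {n : nat}.
Implicit Types x y p v w : 'rV[R]_n.

Lemma segment_closed_connected (A : set 'rV[R]_n) : segment_closed A -> connected A.
Proof.
move=> cA; have [->|/set0P[q Aq]] := eqVneq A set0; first exact: connected0.
have -> : A = \bigcup_(x in A) [set q + s *: (x - q) | s in `[(0 : R), 1]].
  apply/seteqP; split=> [x Ax|x [y Ay] /= [s]].
    exists x => //; exists 1; first by rewrite /= in_itv/= ler01 lexx.
    by rewrite scale1r addrC subrK.
  by rewrite in_itv/= => s01 <-; exact: cA.
apply: bigcup_connected => [|x Ax].
  exists q => x Ax; exists 0; first by rewrite /= in_itv/= ler01 lexx.
  by rewrite scale0r addr0.
apply: connected_continuous_connected; first exact: segment_connected.
apply: continuous_subspaceT => s.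
by apply: cvgD; [exact: cvg_cst|apply: cvgZr_tmp].
Qed.

Lemma blip_within (V W : normedModType R) (A B : set V) (g : V -> W) :
  open A -> B `<=` A -> blip A g -> {within B, continuous g}.
Proof.
move=> oA BA [C C0 gC]; apply: continuous_in_subspaceT => x /[!inE] /BA Ax.
apply/cvgrPdist_lt => e e0.
have C1 : 0 < C + 1 by rewrite ltr_pwDr.
have nA : \forall y \near x, A y by exact: open_nbhs_nbhs.
have nb : \forall y \near x, `|y - x| < e / (C + 1).
  apply/nbhs_ballP; exists (e / (C + 1)) => /=; first by rewrite divr_gt0.
  by move=> y; rewrite -ball_normE/= distrC.
near=> y.
have Ay : A y by near: y; exact: nA.
have yx : `|y - x| < e / (C + 1) by near: y; exact: nb.
have [_ h] := gC _ _ Ax Ay.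
rewrite distrC (le_lt_trans h)// (@le_lt_trans _ _ ((C + 1) * `|y - x|))//.
  by rewrite ler_wpM2r// lerDl.
by rewrite mulrC -ltr_pdivlMr.
Unshelve. all: by end_near. Qed.

Lemma blip_lipschitz (V W : normedModType R) (A : set V) (g : V -> W) :
  blip A g -> [lipschitz g x | x in A].
Proof.
move=> [C C0 gC]; exists C; split; first exact: num_real.
move=> M CM [x y] [/= Ax Ay]; rewrite /self_sub/=.
have [_ h] := gC _ _ Ay Ax.
by rewrite (le_trans h)// ler_wpM2r// ltW.
Qed.

Lemma oball_open p (r : R) : open (oball p r).
Proof.
rewrite (_ : oball p r = ball p r); first exact: ball_open.
by apply/seteqP; split=> x; rewrite -ball_normE /oball/= distrC.
Qed.

Lemma taylor_on_is_derive (A : set 'rV[R]_n) g D (C : R) x i : open A -> A x ->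
  taylor_on A g D C -> is_derive x (delta_mx 0 i : 'rV[R]_n) g (D x 0 i).
Proof.
move=> oA Ax tg.
have nA : \forall y \near x, A y by exact: open_nbhs_nbhs.
have dl : is_derive (0 : R) 1 (fun s : R => x + s *: (delta_mx 0 i : 'rV[R]_n)) (delta_mx 0 i).
  apply/is_derive_row => j; rewrite !mxE/=.
  have -> : (fun s : R => (x + s *: (delta_mx 0 i : 'rV[R]_n)) 0 j) =
     cst (x 0 j) + ((0 == 0 :> 'I_1) && (j == i))%:R \*: (id : R -> R).
    by apply/funext => s; rewrite !mxE mulrC.
  by apply: is_derive_eq; rewrite scaler1 add0r.
have nt : \forall y \near x + 0 *: (delta_mx 0 i : 'rV[R]_n),
    `|g y - g (x + 0 *: delta_mx 0 i) - dot (D x) (y - (x + 0 *: delta_mx 0 i))| <=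
    C * `|y - (x + 0 *: delta_mx 0 i)| ^+ 2.
  by rewrite scale0r addr0; apply: filterS nA => y Ay; exact: tg.
have /is_deriveP_eps H := is_derive_taylor dl nt.
apply/is_deriveP_eps => e e0.
have -> : D x 0 i = dot (D x) (delta_mx 0 i).
  rewrite dotE (bigD1 i)//= big1 ?addr0; first by rewrite mxE !eqxx mulr1.
  by move=> j ji; rewrite mxE (negbTE ji) andbF mulr0.
apply: filterS (H e e0) => h.
by rewrite scale0r !addr0 scaler1 [h *: _ + x]addrC.
Qed.

(** A ball of the sup norm: its trace on H is the ball of the same radius in R^n, and likewise for
    the closures. *)
Definition good_nbhd p (r : R) : set 'rV[R]_(n + 1) := [set y | `|y - emb p| < r].

Lemma good_nbhd_emb p (r : R) x : good_nbhd p r (emb x) <-> oball p r x.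
Proof.
rewrite /good_nbhd /oball/= /emb ptB subrr.
have [r0|r0] := ltP 0 r.
  by rewrite norm_pt_lt// normr0 r0 andbT.
by split=> h; exfalso; move: r0; rewrite leNgt => /negP; apply; apply: le_lt_trans h.
Qed.

Lemma good_nbhd_closure p (r : R) x : 0 < r ->
  closure (good_nbhd p r) (emb x) <-> `|x - p| <= r.
Proof.
move=> r0; have -> : good_nbhd p r = ball (emb p) r.
  by apply/seteqP; split=> y; rewrite -ball_normE /good_nbhd/= distrC.
rewrite closure_ballE closed_ballE// /closed_ball_/= distrC /emb ptB subrr norm_pt_le; last exact: ltW.
by rewrite normr0 (ltW r0) andbT.
Qed.

(** The radius is halved so that the closure of U, on which f and its derivatives must be
    controlled, has its trace in the ball of radius rho. *)
Lemma defining_near_good (K : set 'rV[R]_n) p0 f df d2f e (rho : R) p :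
  closed K -> segment_closed K ->
  (forall r : R, 0 < r -> exists2 q, K° q & `|q - p0| < r) ->
  good_defining K p0 f df d2f e rho -> oball p0 (rho / 2) p ->
  defining_near K p (good_nbhd p0 (rho / 2)) f df.
Proof.
move=> clK cK near_int [[rho0 fK fbd dfe] [[bf bdf [C C0 tf]] Cdf]] pp.
have rho2 : 0 < rho / 2 by rewrite divr_gt0.
have half x : `|x - p0| <= rho / 2 -> oball p0 rho x.
  by move=> /le_lt_trans; apply; lra.
have bd2 : blip (oball p0 rho) d2f.
  apply: blip_mx => i j; have [_ bD _] := Cdf i.
  rewrite (_ : (fun _ => _) = (fun x => row i (d2f x) 0 j)); first exact: blip_coord.
  by apply/funext => x; rewrite mxE.
split; last split.
- split; last exact/good_nbhd_emb.
    have -> : good_nbhd p0 (rho / 2) = ball (emb p0) (rho / 2).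
      by apply/seteqP; split=> y; rewrite -ball_normE /good_nbhd/= distrC.
    exact: ball_open.
  exists (`|emb p0| + rho / 2); split; first exact: num_real.
  move=> M hM y /= yr; rewrite (le_trans _ (ltW hM))// -(subrK (emb p0) y).
  by rewrite (le_trans (ler_normD _ _))// addrC lerD2l ltW.
- exists d2f; set Om := K `&` _.
  have OmE x : Om x <-> K x /\ `|x - p0| <= rho / 2.
    by rewrite /Om /slice/=; split=> -[Kx xr]; split=> //; exact/(good_nbhd_closure _ _ rho2).
  have Om_near : closure Om `<=` oball p0 rho.
    move=> x clx; apply: half.
    have : closure [set y | `|y - p0| <= rho / 2] x.
      by apply: closure_subset clx => y /OmE[].
    have cl : closed [set y : 'rV[R]_n | `|y - p0| <= rho / 2].
      rewrite (_ : [set _ | _] = closed_ball_ Num.Def.normr p0 (rho / 2)); first exact: closed_closed_ball_.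
      by apply/seteqP; split=> y; rewrite /closed_ball_/= distrC.
    by rewrite -(closure_id _).1.
  have Om_int x : Om° x -> oball p0 rho x.
    by move=> /interior_subset Ox; apply: Om_near; exact: subset_closure.
  have oB := @oball_open p0 rho.
  split; last split.
  + split.
      apply: segment_closed_connected => x y s /OmE[Kx xr] /OmE[Ky yr] s01.
      apply/OmE; split; first exact: cK.
      have -> : x + s *: (y - x) - p0 = (1 - s) *: (x - p0) + s *: (y - p0).
        by apply/rowP => i; rewrite !mxE; ring.
      move: s01 => /andP[s0 s1].
      rewrite (le_trans (ler_normD _ _))// !normrZ !ger0_norm ?subr_ge0//.
      have : s * `|y - p0| <= s * (rho / 2) by rewrite ler_wpM2l.
      have : (1 - s) * `|x - p0| <= (1 - s) * (rho / 2) by rewrite ler_wpM2l ?subr_ge0.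
      by lra.
    have [q /interior_ballP[r r0 rK] qr] := near_int _ rho2.
    exists q; apply/interior_ballP; exists (Num.min r (rho / 2 - `|q - p0|)).
      by rewrite lt_min r0 subr_gt0.
    move=> y; rewrite lt_min => /andP[y1 y2]; apply/OmE; split; first exact: rK.
    rewrite -(subrK q y) -addrA (le_trans (ler_normD _ _))//.
    by rewrite -lerBrDr ltW.
  + by split; apply: blip_within oB Om_near _.
  + split.
    * move=> x /Om_int xB i; exact: taylor_on_is_derive oB xB tf.
    * move=> x /Om_int xB i j; have [_ _ [C' C'0 t']] := Cdf i.
      by have := taylor_on_is_derive j oB xB t'; rewrite mxE.
    * apply: blip_lipschitz; have [E E0 EP] := bd2; exists E => // x y /Om_int ? /Om_int ?.
      exact: EP.
- split.
  + move=> x Kx /good_nbhd_emb xr; apply/fK => //; apply: half; exact: ltW.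
  + apply/seteqP; split=> x.
      move=> [bx Ux]; have xr : oball p0 rho x by apply: half; exact/ltW/good_nbhd_emb.
      split=> //; last exact/fbd.
      by have [] := (boundary_closed x clK).1 bx.
    move=> [Kx Ux fx]; split=> //; apply/fbd => //.
    by apply: half; exact/ltW/good_nbhd_emb.
  + move=> x Kx /(good_nbhd_closure _ _ rho2)/half xr _; apply/negP => /eqP h.
    by have := dfe _ xr; rewrite h dot0l => /esym/eqP; rewrite oner_eq0.
Qed.

(** If h had a nonzero part w orthogonal to g, then g minus a large multiple of w would stay in the
    half-space and have negative product with h. *)
Lemma halfspace_dual (g h : 'rV[R]_n) : g != 0 ->
  (forall v, 0 < dot g v -> 0 <= dot h v) -> exists2 c : R, 0 <= c & h = c *: g.
Proof.
move=> g0 H; have gg := dot_gt0 g0.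
have hg : 0 <= dot h g by exact: H.
exists (dot h g / dot g g); first by rewrite divr_ge0// ltW.
pose w := h - (dot h g / dot g g) *: g.
have gw : dot g w = 0.
  by rewrite dotBr dotZr (dotC g h) mulfVK ?subrr// gt_eqF.
have hw : dot h w = dot w w.
  by rewrite [in RHS]/w dotBl dotZl gw mulr0 subr0.
have [w0|w0] := eqVneq w 0; first by apply/eqP; rewrite -subr_eq0 -/w w0.
have ww := dot_gt0 w0; exfalso.
have := H (g - ((dot h g + 1) / dot w w) *: w).
rewrite dotBr dotZr gw mulr0 subr0 => /(_ gg).
rewrite dotBr dotZr hw mulfVK ?gt_eqF//; lra.
Qed.

(** [inner_unit_normal] ranges over all defining functions at p. Any v of positive slope for f
    points into K once shrunk, so the gradient of every other defining function is nonnegative on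
    that half-space, and [halfspace_dual] makes it a positive multiple of [df p]: the unit normal is
    unique. *)
Lemma good_defining_tangent (K : set 'rV[R]_n) p0 f df d2f e (rho : R) p :
  closed K -> segment_closed K ->
  (forall q, K q -> forall r : R, 0 < r -> exists2 q', K° q' & `|q' - q| < r) ->
  K p0 ->
  good_defining K p0 f df d2f e rho -> oball p0 (rho / 2) p -> boundary K p ->
  (forall w, boundary_tangent K p w <-> dot w (df p) = 0) /\
  (forall z, tangent_cone K p z -> 0 <= dot z (df p)).
Proof.
move=> clK cK near_int Kp0 good pp bp.
have dn := defining_near_good clK cK (near_int _ Kp0) good pp.
have [[rho0 fK fbd dfe] [[bf bdf [C C0 tf]] _]] := good.
have pr : oball p0 rho p by apply: (lt_trans pp); lra.
have [Kp _] := (boundary_closed p clK).1 bp.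
have g0 : df p != 0.
  apply/negP => /eqP h.
  by have := dfe _ pr; rewrite h dot0l => /esym/eqP; rewrite oner_eq0.
have gg := dot_gt0 g0.
have eg : 0 < enorm (df p) by rewrite sqrtr_gt0.
have fp : f p = 0 by exact/fbd.
have uniq_nu nu : inner_unit_normal K p nu -> nu = (enorm (df p))^-1 *: df p.
  move=> [U [f' [df' [dn' ->]]]].
  have [[_ _ Up] [_ [_ fbd' fn']]] := dn'.
  have fp' : f' p = 0.
    have : (boundary K `&` slice U) p by split.
    by rewrite fbd' => -[].
  have [v gv|c c0 hc] := halfspace_dual g0 (h := df' p).
    pose q := C * `|v| ^+ 2 + 1.
    have q0 : 0 < q by rewrite ltr_pwDr// mulr_ge0 ?sqr_ge0.
    have v0 : 0 < 1 + `|v| by rewrite ltr_pwDl.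
    have dd : 0 < rho - `|p - p0| by rewrite subr_gt0.
    pose s := Num.min ((rho - `|p - p0|) / (2 * (1 + `|v|))) (dot (df p) v / q).
    have s0 : 0 < s by rewrite lt_min !divr_gt0// mulr_gt0.
    have sr : s * (2 * (1 + `|v|)) <= rho - `|p - p0|.
      by rewrite -ler_pdivlMr ?mulr_gt0// ge_min lexx.
    have sq : s * q <= dot (df p) v by rewrite -ler_pdivlMr// ge_min lexx orbT.
    clearbody s.
    have Bs : oball p0 rho (p + s *: v).
      rewrite /oball/= addrAC (le_lt_trans (ler_normD _ _))// normrZ gtr0_norm//.
      by have := mulr_gt0 s0 v0; lra.
    have Ks : K (p + s *: v).
      apply/fK => //; have := tf _ _ pr Bs.
      rewrite fp subr0 [p + _]addrC addrK dotZr normrZ gtr0_norm// ler_norml exprMn => /andP[h _].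
      have : s * (s * q) <= s * dot (df p) v by rewrite ler_pM2l.
      have := mulr_gt0 s0 s0; rewrite /q.
      move: h; rewrite (_ : C * (s ^+ 2 * `|v| ^+ 2) = s * (s * (C * `|v| ^+ 2))); last by ring.
      move: (C * _) => X; nra.
    have := gradient_inward cK (near_int _ Kp) dn' Kp fp' Ks.
    by rewrite dotZr pmulr_rge0.
  have c1 : 0 < c.
    rewrite lt_neqAle c0 andbT eq_sym; apply/negP => /eqP cc.
    have : df' p != 0 by apply: fn' => //; exact: subset_closure.
    by rewrite hc cc scale0r eqxx.
  rewrite hc enormZ gtr0_norm// scalerA; congr (_ *: _).
  by field; rewrite !gt_eqF.
have nu_ok : inner_unit_normal K p ((enorm (df p))^-1 *: df p).
  by exists (good_nbhd p0 (rho / 2)), f, df.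
split=> [w|z].
  split=> [/(_ _ nu_ok)|w0 nu /uniq_nu ->]; last by rewrite dotZr w0 mulr0.
  rewrite dotZr => /eqP; rewrite mulf_eq0 invr_eq0 gt_eqF//= => /eqP//.
move=> [w [r [nu [bw r0 /uniq_nu nuE ->]]]].
have := bw _ nu_ok; rewrite dotZr => /eqP; rewrite mulf_eq0 invr_eq0 gt_eqF//= => /eqP w0.
by rewrite dotDl w0 add0r nuE scalerA dotZl mulr_ge0 ?divr_ge0// ltW.
Qed.

(** Tangent vectors lie in the cone with both signs, so u + v is orthogonal to all of them;
    transversality makes the normal parts strictly positive. *)
Lemma polar_reflection (K : set 'rV[R]_n) p (g u v : 'rV[R]_n) : g != 0 ->
  (forall w, boundary_tangent K p w <-> dot w g = 0) ->
  (forall z, tangent_cone K p z -> 0 <= dot z g) ->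
  (exists nu, inner_unit_normal K p nu) ->
  polar K p u v -> ~ boundary_tangent K p u -> ~ boundary_tangent K p v ->
  [/\ dot u u = 1, dot v v = 1, 0 < dot u g, 0 < dot v g &
      exists c, u + v = c *: g].
Proof.
move=> g0 tanP coneP [nu nuP] [u1 v1 cu cv uv] tu tv.
have pos z : tangent_cone K p z -> ~ boundary_tangent K p z -> 0 < dot z g.
  move=> /coneP h1 h2; rewrite lt_neqAle h1 andbT; apply/eqP => h.
  by apply: h2; exact/tanP.
split; rewrite -?enorm_eq1//; [exact: pos|exact: pos|].
have tang w : dot w g = 0 -> dot (u + v) w = 0.
  have cone_w w' : dot w' g = 0 -> tangent_cone K p w'.
    move=> h; exists w', 0, nu; split=> //; first exact/tanP.
    by rewrite scale0r addr0.
  move=> h; apply/eqP; rewrite eq_le uv ?andbT; last exact: cone_w.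
  rewrite -oppr_ge0 -dotNr uv//; apply: cone_w; by rewrite dotNl h oppr0.
have gg := dot_gt0 g0.
exists (dot (u + v) g / dot g g).
pose w := (u + v) - (dot (u + v) g / dot g g) *: g.
have wg : dot w g = 0 by rewrite dotBl dotZl mulfVK ?subrr// gt_eqF.
apply/eqP; rewrite -subr_eq0 -/w; apply/eqP/dot_eq0.
by rewrite {1}/w dotBl dotZl (dotC g w) wg mulr0 subr0 tang.
Qed.

End boundary_geometry.

(** * The Picard-Lindelof theorem *)

Section clamp.
Context {R : realType}.
Implicit Types B s t : R.

Definition clamp B t : R := Num.max (- B) (Num.min t B).

Lemma clamp_id B t : `|t| <= B -> clamp B t = t.
Proof.
by rewrite ler_norml => /andP[h1 h2]; rewrite /clamp min_l// max_r.
Qed.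

Lemma norm_clamp B t : 0 <= B -> `|clamp B t| <= B.
Proof.
move=> B0; rewrite ler_norml /clamp le_max lexx/= ge_max ge_min lexx orbT andbT.
by lra.
Qed.

Lemma clamp_lip B s t : `|clamp B t - clamp B s| <= `|t - s|.
Proof.
rewrite /clamp !maxEle !minEle.
case: (leP t B) => h1; case: (leP s B) => h2; rewrite ?(ltW h1) ?(ltW h2).
all: rewrite ?ler_norml ?lerN2.
all: have a1 := ler_norm (t - s); have a2 := ler_norm (- (t - s)); rewrite normrN in a2.
all: repeat match goal with |- context [if ?x <= ?y then _ else _] => case: (leP x y) => ? end.
all: by apply/andP; split; lra.
Qed.

Lemma clamp_continuous B : continuous (clamp B).
Proof.
move=> t; apply/cvgrPdist_lt => e e0; apply/nbhs_ballP; exists e => //= s.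
rewrite /ball_/= distrC [`|clamp B t - _|]distrC; apply: le_lt_trans.
exact: clamp_lip.
Qed.

End clamp.

Section picard_lindelof.
Context {R : realType}.

Lemma antiderivative (g : R -> R) (B : R) : continuous g ->
  exists G : R -> R, G 0 = 0 /\ forall t : R, `|t| < B -> is_derive t 1 G (g t).
Proof.
move=> cg; pose mu := @lebesgue_measure R.
pose G (x : R) := (\int[mu]_(t in `[(- B), x]) g t)%R.
exists (fun t => G t - G 0); split=> [|t]; first by rewrite subrr.
rewrite ltr_norml => /andP[Bt tB].
have [] := @continuous_FTC1_closed R g (- B) t B tB _ Bt (cg t).
  by apply: continuous_compact_integrable; [exact: segment_compact|exact: continuous_subspaceT].
rewrite -/mu -/(G) => d1 d2.
have {}d2 : 'D_1 G t = g t by rewrite -derive1E.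
have dG : is_derive t 1 G (g t) by exact: DeriveDef.
have -> : (fun t => G t - G 0) = G - cst (G 0) by [].
by apply: is_derive_eq; rewrite subr0.
Qed.

Lemma is_derive_row_lip_sym n (x dx : R -> 'rV[R]_n) (a b c : R) : 0 <= c ->
  (forall t : R, `|t - a| <= `|b - a| -> is_derive t 1 x (dx t)) ->
  (forall t : R, `|t - a| <= `|b - a| -> `|dx t| <= c) -> `|x b - x a| <= c * `|b - a|.
Proof.
move=> c0 H1 H2; have [ab|ba] := leP a b.
- rewrite [`|b - a|]ger0_norm ?subr_ge0//; apply: (is_derive_row_lip (dx := dx)) => // t /andP[at_ tb].
  + by apply: H1; rewrite !ger0_norm ?subr_ge0// lerD2r.
  + by apply: H2; rewrite !ger0_norm ?subr_ge0// lerD2r.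
- rewrite distrC [`|b - a|]distrC [`|a - b|]gtr0_norm ?subr_gt0//.
  apply: (is_derive_row_lip (dx := dx)) => //; first exact: ltW.
  + move=> t /andP[bt ta]; apply: H1.
    by rewrite distrC [`|b - a|]distrC !ger0_norm ?subr_ge0 ?(ltW ba)// lerD2l lerN2.
  + move=> t /andP[bt ta]; apply: H2.
    by rewrite distrC [`|b - a|]distrC !ger0_norm ?subr_ge0 ?(ltW ba)// lerD2l lerN2.
Qed.

Lemma is_derive_exp_scale (k t : R) : is_derive t 1 (fun s => expR (k * s)) (k * expR (k * t)).
Proof.
have d : is_derive t 1 (fun s : R => k * s) k.
  have -> : (fun s : R => k * s) = k \*: (id : R -> R) by apply/funext.
  by apply: is_derive_eq; rewrite scaler1.
rewrite mulrC; exact: (is_derive1_comp (f := expR) (g := fun s : R => k * s)).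
Qed.

(** The weight exp(k |t|) gains a factor 1 / k under integration. With k = 2 L the Picard iteration
    contracts by 1/2 on any interval, so solutions are obtained for all |t| < B at once, without
    gluing. *)
Lemma is_derive_exp_bound n (u du : R -> 'rV[R]_n) (A k B : R) : 0 <= A -> 0 < k ->
  u 0 = 0 ->
  (forall t : R, `|t| < B -> is_derive t 1 u (du t)) ->
  (forall t : R, `|t| < B -> `|du t| <= A * k * expR (k * `|t|)) ->
  forall t : R, `|t| < B -> `|u t| <= A * expR (k * `|t|).
Proof.
move=> A0 k0.
have aux (v dv : R -> 'rV[R]_n) : v 0 = 0 ->
    (forall t : R, `|t| < B -> is_derive t 1 v (dv t)) ->
    (forall t : R, `|t| < B -> `|dv t| <= A * k * expR (k * `|t|)) ->
    forall t : R, 0 <= t -> `|t| < B -> `|v t| <= A * expR (k * `|t|).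
  move=> v0 d1 d2 t t0 tB; rewrite (ger0_norm t0).
  have e0 : 0 <= A * expR (k * t) by rewrite mulr_ge0// expR_ge0.
  apply: norm_le_coord => // i.
  have sB (s : R) : 0 <= s <= t -> `|s| < B.
    by move=> /andP[s0 st]; move: tB; rewrite !ger0_norm//; apply: le_lt_trans.
  have dE (s : R) : is_derive s 1 (fun s => A * expR (k * s)) (A * k * expR (k * s)).
    have -> : (fun s => A * expR (k * s)) = A \*: (fun s => expR (k * s)) by apply/funext.
    have h := is_derive_exp_scale k s.
    by apply: is_derive_eq; rewrite /GRing.scale/= mulrA.
  have dvi (s : R) : 0 <= s <= t -> is_derive s 1 (fun s => v s 0 i) (dv s 0 i).
    by move=> /sB/d1/is_derive_row; apply.
  have bi (s : R) : 0 <= s <= t -> `|dv s 0 i| <= A * k * expR (k * s).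
    move=> s0t; rewrite (le_trans (coord_le_norm _ _))//.
    have := d2 _ (sB _ s0t); rewrite [`|s|]ger0_norm//; by case/andP: s0t.
  rewrite ler_norml; apply/andP; split.
  - have := @is_derive_le R (fun s => A * expR (k * s) + v s 0 i) _ 0 t t0
      (fun s h => is_deriveD (dE s) (dvi s h)).
    rewrite v0 mxE addr0 mulr0 expR0 mulr1 => H.
    have {}H := H _; rewrite -subr_ge0 opprK addrC.
    apply: le_trans A0 _; apply: H => s /bi.
    by rewrite ler_norml => /andP[+ _]; rewrite -subr_ge0 opprK addrC.
  - have := @is_derive_le R (fun s => A * expR (k * s) - v s 0 i) _ 0 t t0
      (fun s h => is_deriveB (dE s) (dvi s h)).
    rewrite v0 mxE subr0 mulr0 expR0 mulr1 => H.
    rewrite -subr_ge0.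
    apply: le_trans A0 _; apply: H => s /bi.
    by rewrite ler_norml => /andP[_]; rewrite -subr_ge0.
move=> u0 d1 d2 t tB; have [t0|t0] := leP 0 t; first exact: aux d1 d2 t t0 tB.
have := aux (fun s => u (- s)) (fun s => - du (- s)) _ _ _ (- t).
rewrite opprK normrN oppr0; apply=> //; last by rewrite oppr_ge0 ltW.
- move=> s sB; apply/is_derive_row => i; rewrite mxE.
  have /is_derive_row/(_ i) h : is_derive (- s) 1 u (du (- s)) by apply: d1; rewrite normrN.
  rewrite -mulrN1; exact: (is_derive1_comp (f := fun s => u s 0 i) (g := fun s : R => - s)).
- by move=> s sB; rewrite normrN (le_trans (d2 _ _)) ?normrN.
Qed.

(** The intervals of radius 2 Q / 2^k around [x k] are nested, and the supremum of their left ends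
    lies in all of them. *)
Lemma geometric_limit (x : nat -> R) (Q : R) : 0 <= Q ->
  (forall k, `|x k.+1 - x k| <= Q / 2 ^+ k) ->
  exists l, forall k, `|x k - l| <= 2 * Q / 2 ^+ k.
Proof.
move=> Q0 H.
pose a k := x k - 2 * Q / 2 ^+ k; pose b k := x k + 2 * Q / 2 ^+ k.
have pow k : 2 * Q / 2 ^+ k.+1 = Q / 2 ^+ k :> R.
  by rewrite exprS invfM; field; rewrite expf_neq0.
have pos k : 0 <= 2 * Q / 2 ^+ k by rewrite divr_ge0 ?mulr_ge0// exprn_ge0.
have twoQ k : 2 * Q / 2 ^+ k = Q / 2 ^+ k + Q / 2 ^+ k by lra.
have incr k : a k <= a k.+1.
  by rewrite /a pow twoQ; have := H k; rewrite ler_norml => /andP[]; lra.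
have decr k : b k.+1 <= b k.
  by rewrite /b pow twoQ; have := H k; rewrite ler_norml => /andP[]; lra.
have incr' i j : a i <= a (j + i)%N.
  by elim: j => // j ih; rewrite (le_trans ih)// addSn incr.
have decr' i j : b (j + i)%N <= b i.
  by elim: j => // j ih; rewrite addSn (le_trans (decr _)).
have ab i j : a i <= b j.
  rewrite (le_trans (incr' i j))// addnC (le_trans _ (decr' j i))//.
  by rewrite /a /b; have := pos (i + j)%N; lra.
have hs : has_sup (range a).
  by split; [exists (a 0%N); exists 0%N|exists (b 0%N) => _ [i _ <-]].
exists (sup (range a)) => k.
have h1 : a k <= sup (range a) by apply: ub_le_sup; [case: hs|exists k].
have h2 : sup (range a) <= b k by apply: ge_sup; [case: hs|move=> _ [i _ <-]].
by rewrite ler_norml; apply/andP; split; move: h1 h2; rewrite /a /b; lra.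
Qed.

(** The antiderivative is controlled only for |t| < B + 1; composing it with [clamp] makes the new
    iterate continuous on the whole line, as the next step requires. *)
Lemma picard_step n (F : 'rV[R]_n -> 'rV[R]_n) (c0 : 'rV[R]_n) (B : R) (c : R -> 'rV[R]_n) :
  continuous F -> 0 < B -> continuous c ->
  exists c' : R -> 'rV[R]_n, [/\ continuous c', c' 0 = c0 &
    forall t : R, `|t| < B -> is_derive t 1 c' (F (c t))].
Proof.
move=> cF B0 cc.
have cFc i : continuous (fun t => F (c t) 0 i).
  move=> t; apply: (continuous_comp (f := fun t => F (c t)) (g := fun u : 'rV[R]_n => u 0 i)).
    by apply: continuous_comp; [exact: cc|exact: cF].
  exact: (@coord_continuous R 1 n 0 i).
pose G i := sval (cid (antiderivative (B + 1) (cFc i))).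
have GP i : G i 0 = 0 /\ forall t : R, `|t| < B + 1 -> is_derive t 1 (G i) (F (c t) 0 i).
  by rewrite /G; case: cid.
exists (fun t => c0 + \row_i G i (clamp B t)); split.
- move=> t; apply: cvgD; first exact: cvg_cst.
  have tB : `|clamp B t| < B + 1 by rewrite (le_lt_trans (norm_clamp _ (ltW B0)))// ltrDl.
  have : {for t, continuous (fun t => (\row_i G i (clamp B t) : 'rV[R]_n))}.
    apply: (continuous_comp (f := clamp B) (g := fun t => (\row_i G i t : 'rV[R]_n))).
      exact: clamp_continuous.
    apply: (is_derive1_continuous (d := F (c (clamp B t)))); apply/is_derive_row => i.
    have -> : (fun s => (\row_i G i s) 0 i) = G i by apply/funext => s; rewrite mxE.
    by have [_] := GP i; apply.
  by [].
- rewrite clamp_id ?normr0 ?ltW//; apply/rowP => i; rewrite !mxE.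
  by have [-> _] := GP i; rewrite addr0.
- move=> t tB; have [d d0 dP] : exists2 d, 0 < d & forall h : R, `|h| < d -> `|h *: 1 + t| < B.
    exists (B - `|t|); first by rewrite subr_gt0.
    by move=> h hd; rewrite scaler1 (le_lt_trans (ler_normD _ _))// -ltrBrDr.
  apply/is_derive_row => i.
  have [_ /(_ t) GD] := GP i.
  have /is_deriveP_eps H : is_derive t 1 (G i) (F (c t) 0 i).
    by apply: GD; rewrite (lt_trans tB)// ltrDl.
  apply/is_deriveP_eps => e e0.
  have nh : \forall h \near (0 : R), `|h| < d by exact: nbhs0_lt.
  near=> h.
  have hd : `|h| < d by near: h; exact: nh.
  rewrite !mxE (clamp_id (ltW tB)) (clamp_id (ltW (dP _ hd))).
  rewrite [c0 0 i + _]addrC [c0 0 i + _]addrC opprD addrACA subrr addr0.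
  by near: h; exact: H.
Unshelve. all: by end_near. Qed.

Lemma lipschitz_continuous (V W : normedModType R) (f : V -> W) (L : R) : 0 < L ->
  (forall x y, `|f y - f x| <= L * `|y - x|) -> continuous f.
Proof.
move=> L0 FL x; apply/cvgrPdist_lt => e e0; apply/nbhs_ballP.
exists (e / L); first by rewrite /= divr_gt0.
move=> y; rewrite -ball_normE/= => xy; rewrite (le_lt_trans (FL _ _))//.
by rewrite mulrC -ltr_pdivlMr.
Qed.

Lemma picard_lindelof n (F : 'rV[R]_n -> 'rV[R]_n) (L : R) (c0 : 'rV[R]_n) (B : R) :
  0 < L -> (forall x y, `|F y - F x| <= L * `|y - x|) -> 0 < B ->
  exists c : R -> 'rV[R]_n, c 0 = c0 /\
    forall t : R, `|t| < B -> is_derive t 1 c (F (c t)).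
Proof.
move=> L0 FL B0.
have cF : continuous F.
  exact: lipschitz_continuous L0 FL.
have step (c : {c : R -> 'rV[R]_n | continuous c}) :
    {c' : {c : R -> 'rV[R]_n | continuous c} | sval c' 0 = c0 /\
      forall t : R, `|t| < B -> is_derive t 1 (sval c') (F (sval c t))}.
  apply: cid; case: c => c cc /=; have [c' [cc' c'0 dc']] := picard_step c0 cF B0 cc.
  by exists (exist _ c' cc').
have c0c : continuous (fun _ : R => c0) by move=> x; exact: cvg_cst.
pose C k := sval (iter k (fun c => sval (step c)) (exist _ (fun _ => c0) c0c)).
have C0 k : C k 0 = c0.
  by case: k => // k; rewrite /C /=; case: (step _) => /= c' [].
have dC k (t : R) : `|t| < B -> is_derive t 1 (C k.+1) (F (C k t)).
  by move=> tB; rewrite /C /=; case: (step _) => /= c' [_]; exact.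
(* With k = 2 L the product A k is |F c0|, the speed of the first iterate. *)
pose A := `|F c0| / (2 * L).
have A0 : 0 <= A by rewrite divr_ge0// mulr_ge0// ltW.
have L20 : 0 < 2 * L by rewrite mulr_gt0.
have bound k (t : R) : `|t| < B -> `|C k.+1 t - C k t| <= A / 2 ^+ k * expR (2 * L * `|t|).
  elim: k t => [|k ih].
    apply: (@is_derive_exp_bound n (fun t => C 1%N t - C 0%N t) (fun t => F c0)) => //.
    - by rewrite expr0 divr1.
    - by rewrite !C0 subrr.
    - move=> t tB; have h := dC 0%N t tB.
      by rewrite -[F c0]subr0; apply: is_deriveB.
    - move=> t tB; rewrite expr0 divr1 /A mulfVK ?gt_eqF// ler_peMr// -[leLHS]expR0 ler_expR.
      by rewrite mulr_ge0// ltW.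
  apply: (@is_derive_exp_bound n (fun t => C k.+2 t - C k.+1 t) (fun t => F (C k.+1 t) - F (C k t))) => //.
  - by rewrite divr_ge0// exprn_ge0.
  - by rewrite !C0 subrr.
  - by move=> t tB; have h1 := dC k.+1 t tB; have h2 := dC k t tB; exact: is_deriveB.
  - move=> t tB; rewrite (le_trans (FL _ _))//.
    rewrite [leRHS](_ : _ = L * (A / 2 ^+ k * expR (2 * L * `|t|))).
      by rewrite ler_pM2l// ih.
    by rewrite exprS; field; rewrite expf_neq0.
pose Q := A * expR (2 * L * B).
have Q0 : 0 <= Q by rewrite mulr_ge0// expR_ge0.
have posQ k : 0 <= 2 * Q / 2 ^+ k.
  exact: divr_ge0 (mulr_ge0 (ler0n R 2) Q0) (exprn_ge0 k (ler0n R 2)).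
have boundQ k (t : R) : `|t| < B -> `|C k.+1 t - C k t| <= Q / 2 ^+ k.
  move=> tB; rewrite (le_trans (bound _ _ tB))// /Q mulrAC ler_wpM2r ?invr_ge0 ?exprn_ge0//.
  by rewrite ler_wpM2l// ler_expR ler_pM2l// ltW.
have lim (t : R) : exists l : 'rV[R]_n, `|t| < B -> forall k, `|C k t - l| <= 2 * Q / 2 ^+ k.
  have [tB|] := boolP (`|t| < B); last by exists 0.
  have H i : exists l, forall k, `|C k t 0 i - l| <= 2 * Q / 2 ^+ k.
    apply: geometric_limit => // k; rewrite (le_trans _ (boundQ k _ tB))//.
    by have := coord_le_norm (C k.+1 t - C k t) i; rewrite !mxE.
  exists (\row_i sval (cid (H i))) => _ k; apply: norm_le_coord => [|i].
    exact: posQ.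
  by rewrite !mxE; case: cid.
have [c cP] := choice lim.
have small (e : R) : 0 < e -> exists k, 2 * Q / 2 ^+ k < e.
  move=> e0; exists (Num.Def.archi_bound (2 * Q / e)).
  rewrite ltr_pdivrMr ?exprn_gt0// -ltr_pdivrMl// [ltLHS]mulrC.
  have q0 : 0 <= 2 * Q / e by apply: divr_ge0; [exact: mulr_ge0|exact: ltW].
  apply: (lt_trans (archi_boundP q0)).
  by rewrite -natrX ltr_nat ltn_expl.
exists c; split.
  have B0' : `|0 : R| < B by rewrite normr0.
  apply/eqP; rewrite -subr_eq0 -normr_le0 leNgt; apply/negP => h.
  have [k] := small _ h; have := cP 0 B0' k.
  by rewrite C0 distrC => /le_lt_trans h1 /h1; rewrite ltxx.
move=> t tB; apply/is_deriveP_eps => e e0.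
pose eL := e / (4 * L).
have eL0 : 0 < eL by rewrite divr_gt0// mulr_gt0.
have cc : \forall s \near t, `|s| < B /\ `|c s - c t| < eL.
  have [k kP] := small (eL / 3) (divr_gt0 eL0 (ltr0Sn R 2)).
  have cCk : continuous (C k) by rewrite /C; case: (iter _ _ _).
  have nC : \forall s \near t, `|C k t - C k s| < eL / 3.
    by have /cvgrPdist_lt := cCk t; apply; rewrite divr_gt0.
  have nB : \forall s \near t, `|s| < B.
    apply/nbhs_ballP; exists (B - `|t|) => /=; first by rewrite subr_gt0.
    move=> s; rewrite /ball/= distrC ltrBrDr => h.
    by rewrite -(subrK t s) (le_lt_trans (ler_normD _ _)).
  near=> s.
  have sB : `|s| < B by near: s; exact: nB.
  have h : `|C k t - C k s| < eL / 3 by near: s; exact: nC.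
  split=> //; have h1 := cP _ tB k; have h2 := cP _ sB k.
  rewrite (_ : c s - c t = (C k t - c t) - (C k s - c s) - (C k t - C k s)); last first.
    by apply/rowP => i; rewrite !mxE; ring.
  rewrite (le_lt_trans (ler_normB _ _))//.
  have := ler_normB (C k t - c t) (C k s - c s).
  by move: h1 h2 h kP; move: (2 * Q / _) => q; lra.
have [d /= d0 dP] := (nbhs_ballP _ _).1 cc.
apply/nbhs_ballP; exists d => //= h; rewrite /ball/= sub0r normrN scaler1 => hd.
have [->|h0] := eqVneq h 0.
  by rewrite add0r subrr scale0r subrr !normr0 mulr0.
have htB s : `|s - t| <= `|h| -> `|s| < B /\ `|c s - c t| < eL.
  by move=> st; apply: dP; rewrite /ball/= distrC (le_lt_trans st).
have [hB _] : `|h + t| < B /\ `|c (h + t) - c t| < eL by apply: htB; rewrite addrK.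
have hp : 0 < `|h| by rewrite normr_gt0.
have est k : `|C k.+1 (h + t) - C k.+1 t - h *: F (c t)| <= L * (2 * Q / 2 ^+ k + eL) * `|h|.
  have := @is_derive_row_lip_sym n (fun s => C k.+1 s - s *: F (c t))
    (fun s => F (C k s) - F (c t)) t (h + t) (L * (2 * Q / 2 ^+ k + eL)).
  rewrite addrK (_ : _ - _ - (_ - _) = C k.+1 (h + t) - C k.+1 t - h *: F (c t)); last first.
    by apply/rowP => i; rewrite !mxE; ring.
  apply.
  - by rewrite mulr_ge0 ?(ltW L0)// addr_ge0 ?posQ// ltW.
  - move=> s /htB[sB _]; have h1 := dC k s sB.
    apply: is_deriveB; apply/is_derive_row => i.
    have -> : (fun r : R => (r *: F (c t)) 0 i) = F (c t) 0 i \*: (id : R -> R).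
      by apply/funext => r; rewrite mxE mulrC.
    by apply: is_derive_eq; rewrite scaler1.
  - move=> s /htB[sB sc]; rewrite (le_trans (FL _ _))// ler_pM2l//.
    rewrite -(subrK (c s) (C k s)) -addrA (le_trans (ler_normD _ _))//.
    by rewrite lerD// ?cP// ltW.
(* The iterate may depend on h: its distance to the limit is made small compared with |h|, so that
   [est] passes to the increment of c. *)
have eh : 0 < e * `|h| / 4 by rewrite divr_gt0// mulr_gt0.
have [k1 k1P] := small _ eh.
have [k2 k2P] := small _ eL0.
pose k := maxn k1 k2.
have mono i j : (i <= j)%N -> 2 * Q / 2 ^+ j <= 2 * Q / 2 ^+ i.
  move=> ij; apply: ler_wpM2l; first exact: mulr_ge0.
  rewrite lef_pV2 ?posrE ?exprn_gt0//.
  by rewrite ler_eXn2l// ltr1n.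
have a1 : 2 * Q / 2 ^+ k.+1 < e * `|h| / 4.
  by rewrite (le_lt_trans _ k1P)// mono// (leq_trans (leq_maxl k1 k2))// leqnSn.
have a2 : 2 * Q / 2 ^+ k < eL by rewrite (le_lt_trans _ k2P)// mono// leq_maxr.
have b1 := cP _ hB k.+1; have b2 := cP _ tB k.+1; have b3 := est k.
rewrite (_ : _ - _ - _ = (C k.+1 (h + t) - C k.+1 t - h *: F (c t)) -
   ((C k.+1 (h + t) - c (h + t)) - (C k.+1 t - c t))); last first.
  by apply/rowP => i; rewrite !mxE; ring.
rewrite (le_trans (ler_normB _ _))//.
have := ler_normB (C k.+1 (h + t) - c (h + t)) (C k.+1 t - c t).
have : L * (2 * Q / 2 ^+ k + eL) * `|h| <= L * (eL + eL) * `|h|.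
  by rewrite ler_pM2r// ler_pM2l// lerD2r ltW.
rewrite (_ : L * (eL + eL) * `|h| = e * `|h| / 2); last by rewrite /eL; field; rewrite gt_eqF.
by lra.
Unshelve. all: by end_near. Qed.

End picard_lindelof.

(** * Existence of geodesics *)

Section real_induction.
Context {R : realType}.

(** The supremum of the initial segments on which P holds satisfies P by the left step and would be
    exceeded by the right step. This stands in for compactness arguments throughout. *)
Lemma real_induction (T : R) (P : R -> Prop) : P 0 ->
  (forall t : R, 0 <= t < T -> (forall s : R, 0 <= s <= t -> P s) ->
     exists2 d : R, 0 < d & forall s : R, t <= s < t + d -> s <= T -> P s) ->
  (forall t : R, 0 < t <= T -> (forall s : R, 0 <= s < t -> P s) -> P t) ->
  forall t : R, 0 <= t <= T -> P t.
Proof.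
move=> P0 Pr Pl t /andP[t0 tT].
pose S := [set r : R | 0 <= r <= t /\ forall s : R, 0 <= s <= r -> P s].
have S0 : S 0.
  split; first by rewrite lexx.
  by move=> s s0; have -> : s = 0 by apply/eqP; rewrite eq_le andbC.
have hs : has_sup S by split; [exists 0|exists t => r [/andP[]]].
pose u := sup S.
have u0 : 0 <= u by apply: ub_le_sup S0; case: hs.
have ut : u <= t by apply: ge_sup; [exists 0|move=> r [/andP[]]].
have Pu (s : R) : 0 <= s < u -> P s.
  move=> /andP[s0 su]; have us : 0 < u - s by rewrite subr_gt0.
  have [r [/andP[r0 rt] Pr'] sr] := sup_adherent us hs.
  by move: sr; rewrite -/u subKr => sr; apply: Pr'; rewrite s0 ltW.
have Puu : P u.
  have [->//|un] := eqVneq u 0.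
  apply: Pl => //; rewrite lt_neqAle eq_sym un u0/=; exact: le_trans tT.
have Ple (s : R) : 0 <= s <= u -> P s.
  move=> /andP[s0]; rewrite le_eqVlt => /orP[/eqP->//|su].
  by apply: Pu; rewrite s0.
have [ut'|tu] := ltP u t; last by apply: Ple; rewrite t0.
have [d d0 Pd] := Pr u ltac:(by rewrite u0 (lt_le_trans ut')) Ple.
pose v := Num.min t (u + d / 2).
have uv : u < v by rewrite lt_min ut' ltrDl divr_gt0.
have Sv : S v.
  split; first by rewrite (le_trans u0 (ltW uv)) ge_min lexx.
  move=> s /andP[s0 sv]; have [su|us] := leP s u; first by apply: Ple; rewrite s0.
  apply: Pd; last by rewrite (le_trans sv)// ge_min tT.
  rewrite ltW//= (le_lt_trans sv)// gt_min; apply/orP; right.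
  by rewrite ltrD2l; lra.
have : v <= u by apply: ub_le_sup Sv; case: hs.
by rewrite leNgt uv.
Qed.

(** The bound is asked only inside the interval: at the current end point of a continuation argument
    it is still to be proved. *)
Lemma is_derive_lip_oo (f df : R -> R) (a b c : R) : a <= b ->
  (forall t, a <= t <= b -> is_derive t 1 f (df t)) ->
  (forall t, a < t < b -> `|df t| <= c) -> `|f b - f a| <= c * (b - a).
Proof.
move=> ab H dfc; have [<-|neq] := eqVneq a b; first by rewrite !subrr normr0 mulr0.
have ltab : a < b by rewrite lt_neqAle neq.
have [||s sab ->] := @MVT R f df a b ltab.
- by move=> t /[!in_itv]/= /andP[/ltW at_ /ltW tb]; apply: H; rewrite at_.
- exact: is_derive1_within H.
by rewrite normrM (gtr0_norm (_ : 0 < b - a)) ?subr_gt0// ler_pM2r ?subr_gt0// dfc//; move: sab; rewrite in_itv.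
Qed.

Lemma is_derive_cst_oo (f df : R -> R) (a b : R) : a <= b ->
  (forall t, a <= t <= b -> is_derive t 1 f (df t)) ->
  (forall t, a < t < b -> df t = 0) -> f b = f a.
Proof.
move=> ab H df0; apply/eqP; rewrite -subr_eq0 -normr_le0.
have := @is_derive_lip_oo f df a b 0 ab H; rewrite mul0r; apply=> t /df0 ->.
by rewrite normr0.
Qed.

End real_induction.

(** * The geodesic equation as a clamped first-order system *)

Section geodesics.
Context {R : realType} {n : nat}.
Variables (K : set 'rV[R]_n) (p0 : 'rV[R]_n) (f : 'rV[R]_n -> R)
  (df : 'rV[R]_n -> 'rV[R]_n) (d2f : 'rV[R]_n -> 'M[R]_n) (e : 'rV[R]_n) (rho : R).
Hypothesis good : good_defining K p0 f df d2f e rho.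

Definition hess (D : 'M[R]_n) (a : 'rV[R]_n) : R := \sum_i dot (row i D) a * a 0 i.

Lemma hessN D a : hess D (- a) = hess D a.
Proof. by apply: eq_bigr => i _; rewrite dotNr mxE mulrNN. Qed.

Lemma is_derive_along (x : R -> 'rV[R]_n) (t : R) a : oball p0 rho (x t) ->
  is_derive t 1 x a -> is_derive t 1 (fun s => f (x s)) (dot (df (x t)) a).
Proof.
move=> xt dx; have [_ [[_ _ [C C0 tf]] _]] := good.
apply: (is_derive_taylor (L := C) dx).
have : \forall y \near x t, oball p0 rho y.
  by apply: open_nbhs_nbhs; split=> //; exact: oball_open.
by apply: filterS => y yB; exact: tf.
Qed.

Lemma is_derive_df_along (x : R -> 'rV[R]_n) (t : R) a : oball p0 rho (x t) ->
  is_derive t 1 x a ->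
  is_derive t 1 (fun s => df (x s)) (\row_i dot (row i (d2f (x t))) a).
Proof.
move=> xt dx; apply/is_derive_row => i; rewrite mxE.
have [_ [_ /(_ i)[_ _ [C C0 tf]]]] := good.
apply: (is_derive_taylor (g := fun x => df x 0 i) (L := C) dx).
have : \forall y \near x t, oball p0 rho y.
  by apply: open_nbhs_nbhs; split=> //; exact: oball_open.
by apply: filterS => y yB; exact: tf.
Qed.

Lemma dot_hess D a : dot (\row_i dot (row i D) a) a = hess D a.
Proof. by rewrite dotE; apply: eq_bigr => i _; rewrite mxE. Qed.

(** Cauchy-Schwarz with <df x, e> = 1 gives |df x|^2 >= 1 / |e|^2. *)
Lemma norm_df_gt0 : exists2 c : R, 0 < c & forall x, oball p0 rho x -> c <= dot (df x) (df x).
Proof.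
have [[rho0 _ _ dfe] _] := good.
have e0 : 0 < dot e e.
  apply: dot_gt0; apply/negP => /eqP e0.
  have := dfe p0; rewrite e0 dot0r /oball/= subrr normr0 => /(_ rho0)/esym/eqP.
  by rewrite oner_eq0.
exists (dot e e)^-1; first by rewrite invr_gt0.
move=> x xB; have := Cauchy_Schwarz (df x) e; rewrite dfe// expr1n.
by rewrite -ler_pdivrMr// div1r.
Qed.

Let vclamp B (u : 'rV[R]_n) : 'rV[R]_n := \row_i clamp B (u 0 i).

Let vclamp_id B u : `|u| <= B -> vclamp B u = u.
Proof.
move=> uB; apply/rowP => i; rewrite mxE clamp_id// (le_trans (coord_le_norm _ _))//.
Qed.

Let clampN (B t : R) : 0 <= B -> clamp B (- t) = - clamp B t.
Proof.
move=> B0; rewrite /clamp !maxEle !minEle.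
case: (leP t B) => h1; case: (leP (- t) B) => h2.
all: repeat match goal with |- context [if ?x <= ?y then _ else _] => case: (leP x y) => ? end.
all: lra.
Qed.

Let vclampN B u : 0 <= B -> vclamp B (- u) = - vclamp B u.
Proof. by move=> B0; apply/rowP => i; rewrite !mxE clampN. Qed.

(** Keeps the position in the ball where f is controlled, so that the field is Lipschitz on the
    whole space. *)
Let box u := p0 + vclamp (rho / 2) (u - p0).

Let box_id u : `|u - p0| <= rho / 2 -> box u = u.
Proof. by move=> h; rewrite /box vclamp_id// addrC subrK. Qed.

Let box_oball u : oball p0 rho (box u).
Proof.
have [[rho0 _ _ _] _] := good.
rewrite /oball/= /box addrAC subrr add0r; apply: (@le_lt_trans _ _ (rho / 2)); last by lra.
apply: norm_le_coord => [|i]; first by lra.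
by rewrite mxE norm_clamp//; lra.
Qed.

(* The multiplier of the constraint z^2 = lambda^2 f(x), evaluated at the clamped
   state: the clamping makes the geodesic field globally Lipschitz. *)
Definition kappa (lambda : R) (x : 'rV[R]_n) (z : R) (a : 'rV[R]_n) (b : R) : R :=
  (2 * b ^+ 2 - lambda ^+ 2 * hess (d2f x) a) /
  (lambda ^+ 4 * dot (df x) (df x) + 4 * z ^+ 2).

Definition ckappa lambda x z a b :=
  kappa lambda (box x) (clamp 2 z) (vclamp 2 a) (clamp 2 b).

Definition clamped_solution (lambda B : R) (x : R -> 'rV[R]_n) (z : R -> R)
    (a : R -> 'rV[R]_n) (b : R -> R) := forall t : R, `|t| < B ->
  [/\ is_derive t 1 x (a t), is_derive t 1 z (b t),
      is_derive t 1 a ((ckappa lambda (x t) (z t) (a t) (b t) * lambda ^+ 2) *: df (box (x t))) &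
      is_derive t 1 b (- (2 * ckappa lambda (x t) (z t) (a t) (b t) * clamp 2 (z t)))].

Lemma is_derive_reverse m (x : R -> 'rV[R]_m) (t : R) v :
  is_derive (- t) 1 x v -> is_derive t 1 (fun s => x (- s)) (- v).
Proof.
move=> /is_derive_row dx; apply/is_derive_row => i; rewrite mxE -mulrN1.
exact: (is_derive1_comp (f := fun s => x s 0 i) (g := fun s : R => - s)).
Qed.

Lemma is_derive1_reverse (x : R -> R) (t v : R) :
  is_derive (- t) 1 x v -> is_derive t 1 (fun s => x (- s)) (- v).
Proof.
by move=> dx; rewrite -mulrN1; exact: (is_derive1_comp (f := x) (g := fun s : R => - s)).
Qed.

Lemma is_derive_unreverse m (x : R -> 'rV[R]_m) (t : R) v :
  is_derive t 1 (fun s => x (- s)) v -> is_derive (- t) 1 x (- v).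
Proof.
move=> h; rewrite (_ : x = fun s => x (- - s)); last by apply/funext => s; rewrite opprK.
by apply: (is_derive_reverse (x := fun s => x (- s))); rewrite opprK.
Qed.

Lemma is_derive1_unreverse (x : R -> R) (t v : R) :
  is_derive t 1 (fun s => x (- s)) v -> is_derive (- t) 1 x (- v).
Proof.
move=> h; rewrite (_ : x = fun s => x (- - s)); last by apply/funext => s; rewrite opprK.
by apply: (is_derive1_reverse (x := fun s => x (- s))); rewrite opprK.
Qed.

(** The multiplier is even in the velocity, because [clamp] is odd and the velocity enters
    quadratically. *)
Lemma clamped_solution_reverse lambda B x z a b : clamped_solution lambda B x z a b ->
  clamped_solution lambda B (fun t => x (- t)) (fun t => z (- t))
    (fun t => - a (- t)) (fun t => - b (- t)).
Proof.
move=> sol t; rewrite -normrN => /sol[dx dz da db].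
have ck x' z' a' b' : ckappa lambda x' z' (- a') (- b') = ckappa lambda x' z' a' b'.
  by rewrite /ckappa vclampN// clampN// /kappa hessN sqrrN.
split.
- exact: is_derive_reverse.
- exact: is_derive1_reverse.
- rewrite ck; have /is_derive_row h := is_derive_reverse da.
  apply/is_derive_row => i; rewrite -[X in is_derive _ _ _ X]opprK.
  have := h i; rewrite mxE => hi.
  rewrite (_ : (fun s => _) = - (fun s => a (- s) 0 i)); first exact: is_deriveN.
  by apply/funext => s; rewrite mxE.
- rewrite ck; have h := is_derive1_reverse db.
  rewrite -[X in is_derive _ _ _ X]opprK; exact: is_deriveN.
Qed.

Lemma exists_clamped_solution lambda B (x0 a0 : 'rV[R]_n) (z0 b0 : R) : 0 < lambda -> 0 < B ->
  exists x z a b, [/\ x 0 = x0, z 0 = z0, a 0 = a0, b 0 = b0 &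
    clamped_solution lambda B x z a b].
Proof.
move=> l0 B0; have [[rho0 _ _ _] [[_ bdf _] Cdf]] := good.
have [c1 c10 c1P] := norm_df_gt0.
pose V := 'rV[R]_((n + 1) + (n + 1)).
pose X (u : V) : 'rV[R]_n := lsubmx (lsubmx u).
pose Z (u : V) : R := rsubmx (lsubmx u) 0 0.
pose A (u : V) : 'rV[R]_n := lsubmx (rsubmx u).
pose Bv (u : V) : R := rsubmx (rsubmx u) 0 0.
have clampB (c : R) (g : V -> R) : 0 <= c ->
    (forall u v, `|g v - g u| <= `|v - u|) -> blip setT (fun u => clamp c (g u)).
  move=> c0 gl; exists (c + 1) => [|u v _ _]; first by rewrite addr_ge0.
  split; first by rewrite (le_trans (norm_clamp _ c0))// lerDl.
  rewrite (le_trans (clamp_lip _ _ _))// (le_trans (gl _ _))// ler_peMl//.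
  by rewrite lerDr.
have co (u v : V) i j : i = j -> `|v 0 i - u 0 j| <= `|v - u|.
  by move=> ->; have := coord_le_norm (v - u) j; rewrite !mxE.
have bX : blip setT (fun u : V => box (X u)).
  apply: blipD; first exact: blip_cst.
  apply: blip_mx => i j; rewrite (_ : (fun _ => _) = fun u => clamp (rho / 2) ((X u - p0) 0 j)).
    apply: clampB; first by rewrite divr_ge0 // ltW.
    move=> u v; rewrite !mxE opprB addrA subrK; exact: co.
  by apply/funext => u; rewrite !mxE.
have bZ : blip setT (fun u : V => clamp 2 (Z u)).
  by apply: clampB => // u v; rewrite /Z !mxE; exact: co.
have bA : blip setT (fun u : V => vclamp 2 (A u)).
  apply: blip_mx => i j; rewrite (_ : (fun _ => _) = fun u => clamp 2 (A u 0 j)).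
    by apply: clampB => // u v; rewrite !mxE; exact: co.
  by apply/funext => u; rewrite mxE.
have bB : blip setT (fun u : V => clamp 2 (Bv u)).
  by apply: clampB => // u v; rewrite /Bv !mxE; exact: co.
have onbox (W : normedModType R) (g : 'rV[R]_n -> W) : blip (oball p0 rho) g ->
    blip setT (fun u : V => g (box (X u))).
  move=> bg; apply: (blip_comp bg) => [u _|]; first exact: box_oball.
  by have [C C0 CP] := bX; exists C => // u v _ _; have [] := CP u v I I.
have bD := onbox _ _ bdf.
have bH : blip setT (fun u : V => hess (d2f (box (X u))) (vclamp 2 (A u))).
  apply: blip_sum => i; apply: blipM; last exact: blip_coord.
  apply: blip_dot => //.
  have [_ bDi _] := Cdf i.
  exact: (onbox _ (fun x => row i (d2f x))).
have bk : blip setT (fun u : V => ckappa lambda (X u) (Z u) (A u) (Bv u)).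
  apply: blipM.
    apply: blipB; first by apply: blipM; [exact: blip_cst|exact: blipM].
    by apply: blipM => //; exact: blip_cst.
  (* This lower bound degenerates as lambda tends to 0, which is harmless: lambda is fixed here. *)
  apply: (@blipV _ _ _ _ (lambda ^+ 4 * c1)).
  - by rewrite mulr_gt0// exprn_gt0.
  - move=> u _; rewrite -[leLHS]addr0 lerD//; last by rewrite mulr_ge0// sqr_ge0.
    by rewrite ler_pM2l ?exprn_gt0// c1P//; exact: box_oball.
  - apply: blipD; first by apply: blipM; [exact: blip_cst|exact: blip_dot].
    by apply: blipM; [exact: blip_cst|exact: blipM].
pose acc (u : V) : 'rV[R]_(n + 1) :=
  pt ((ckappa lambda (X u) (Z u) (A u) (Bv u) * lambda ^+ 2) *: df (box (X u)))
     (- (2 * ckappa lambda (X u) (Z u) (A u) (Bv u) * clamp 2 (Z u))).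
have bacc : blip setT acc.
  apply: blip_mx => i j; rewrite (ord1 i); case: (splitP j) => j' jE.
    have -> : j = lshift 1 j' by apply/val_inj.
    rewrite (_ : (fun _ => _) = fun u : V => ((ckappa lambda (X u) (Z u) (A u) (Bv u) * lambda ^+ 2) *: df (box (X u))) 0 j').
      apply: blip_coord; apply: blipZ => //; apply: blipM => //; exact: blip_cst.
    by apply/funext => u; rewrite ptEl.
  have -> : j = rshift n j' by apply/val_inj.
  rewrite (_ : (fun _ => _) = fun u : V => - (2 * ckappa lambda (X u) (Z u) (A u) (Bv u) * clamp 2 (Z u))).
    by apply: blipN; apply: blipM => //; apply: blipM => //; exact: blip_cst.
  by apply/funext => u; rewrite ptEr.
(* Only the acceleration is clamped; the velocity part is linear, hence the Lipschitz constant 1 +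
   C. *)
pose F (u : V) : V := row_mx (rsubmx u) (acc u).
have [C C0 CP] := bacc.
have FL u v : `|F v - F u| <= (1 + C) * `|v - u|.
  have C10 : 0 <= (1 + C) * `|v - u| by rewrite mulr_ge0// addr_ge0.
  apply: norm_le_coord => // i; rewrite mxE [X in _ + X]mxE.
  case: (splitP i) => j iE.
    have -> : i = lshift (n + 1) j by apply/val_inj.
    rewrite !row_mxEl !mxE (le_trans (co _ _ _ _ erefl))// ler_peMl// lerDl//.
  have -> : i = rshift (n + 1) j by apply/val_inj.
  rewrite !row_mxEr; have [_] := CP u v I I.
  have := coord_le_norm (acc v - acc u) j; rewrite !mxE => h1 h2.
  by rewrite (le_trans h1)// (le_trans h2)// ler_wpM2r// lerDr.
have C1 : 0 < 1 + C by rewrite ltr_pwDl.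
have [c [c0 dc]] := picard_lindelof (row_mx (pt x0 z0) (pt a0 b0)) C1 FL B0.
exists (fun t => X (c t)), (fun t => Z (c t)), (fun t => A (c t)), (fun t => Bv (c t)).
split.
- by rewrite c0 /X row_mxKl row_mxKl.
- by rewrite c0 /Z row_mxKl row_mxKr mxE.
- by rewrite c0 /A row_mxKr row_mxKl.
- by rewrite c0 /Bv row_mxKr row_mxKr mxE.
move=> t /dc/is_derive_row dct; split.
- apply/is_derive_row => i; have := dct (lshift (n + 1) (lshift 1 i)).
  rewrite /F row_mxEl [X in is_derive _ _ _ X]mxE.
  by congr is_derive; [apply/funext => s; rewrite /X !mxE|rewrite /A !mxE].
- have := dct (lshift (n + 1) (rshift n 0)).
  rewrite /F row_mxEl [X in is_derive _ _ _ X]mxE.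
  by congr is_derive; [apply/funext => s; rewrite /Z !mxE|rewrite /Bv !mxE].
- apply/is_derive_row => i; have := dct (rshift (n + 1) (lshift 1 i)).
  rewrite /F row_mxEr /acc ptEl; congr is_derive.
  by apply/funext => s; rewrite /A !mxE.
- have := dct (rshift (n + 1) (rshift n 0)).
  rewrite /F row_mxEr /acc ptEr; congr is_derive.
  by apply/funext => s; rewrite /Bv !mxE.
Qed.

Let regular_state (x : R -> 'rV[R]_n) (z : R -> R) (a : R -> 'rV[R]_n) (b : R -> R) (t : R) :=
  [/\ `|x t - p0| <= rho / 2, `|z t| <= 2, `|a t| <= 2 & `|b t| <= 2].

Definition geodesic_at (lambda : R) (x : R -> 'rV[R]_n) (z : R -> R)
    (a : R -> 'rV[R]_n) (b : R -> R) (t : R) :=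
  let k := kappa lambda (x t) (z t) (a t) (b t) in
  [/\ `|x t - p0| <= `|t|, dot (a t) (a t) + b t ^+ 2 = 1,
      z t ^+ 2 = lambda ^+ 2 * f (x t) &
      2 * (z t * b t) = lambda ^+ 2 * dot (df (x t)) (a t)] /\
  [/\ is_derive t 1 x (a t), is_derive t 1 z (b t),
      is_derive t 1 a ((k * lambda ^+ 2) *: df (x t)) &
      is_derive t 1 b (- (2 * k * z t))].

Lemma kappa_den_gt0 lambda x z : 0 < lambda -> oball p0 rho x ->
  0 < lambda ^+ 4 * dot (df x) (df x) + 4 * z ^+ 2.
Proof.
move=> l0 xB; have [c c0 /(_ _ xB) cP] := norm_df_gt0.
apply: ltr_pwDl; last by apply: mulr_ge0 => //; exact: sqr_ge0.
apply: mulr_gt0; first exact: exprn_gt0.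
exact: lt_le_trans cP.
Qed.

(** A continuation argument: while the clamps are inactive, the constraint, its derivative and the
    speed are conserved. Unit speed on a time interval with T <= 1 and T < rho / 2 then puts the
    state strictly inside the clamping bounds, so the clamps remain inactive. *)
Lemma clamped_solution_exact lambda B T x z a b : 0 < lambda ->
  clamped_solution lambda B x z a b -> T < B -> T < rho / 2 -> T <= 1 ->
  x 0 = p0 -> z 0 = 0 -> f p0 = 0 ->
  dot (a 0) (a 0) + b 0 ^+ 2 = 1 -> dot (a 0) (df p0) = 0 ->
  forall t, 0 <= t <= T -> geodesic_at lambda x z a b t.
Proof.
move=> l0 sol TB Trho T1 x0 z0 fp0 speed0 tang0.
have [[rho0 _ _ _] _] := good.
pose k s := ckappa lambda (x s) (z s) (a s) (b s).
pose a' s := (k s * lambda ^+ 2) *: df (box (x s)).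
pose b' s := - (2 * k s * clamp 2 (z s)).
have tB (s : R) : 0 <= s <= T -> `|s| < B.
  by move=> /andP[s0 sT]; rewrite ger0_norm// (le_lt_trans sT).
have dx (s : R) : 0 <= s <= T -> is_derive s 1 x (a s) by move=> /tB/sol[].
have dz (s : R) : 0 <= s <= T -> is_derive s 1 z (b s) by move=> /tB/sol[].
have da (s : R) : 0 <= s <= T -> is_derive s 1 a (a' s) by move=> /tB/sol[].
have db (s : R) : 0 <= s <= T -> is_derive s 1 b (b' s) by move=> /tB/sol[].
have sub (t s : R) : 0 <= t <= T -> 0 <= s <= t -> 0 <= s <= T.
  by move=> /andP[_ tT] /andP[-> st] /=; exact: le_trans tT.
have regE (s : R) : regular_state x z a b s ->
    [/\ k s = kappa lambda (x s) (z s) (a s) (b s),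
        a' s = (k s * lambda ^+ 2) *: df (x s) & b' s = - (2 * k s * z s)].
  move=> [h1 h2 h3 h4]; split.
  - by rewrite /k /ckappa box_id// vclamp_id// !clamp_id.
  - by rewrite /a' box_id.
  - by rewrite /b' clamp_id.
have norm1 (s : R) : dot (a s) (a s) + b s ^+ 2 = 1 -> `|a s| <= 1 /\ `|b s| <= 1.
  move=> h; split.
    by apply: norm_le_dot => //; rewrite expr1n -h lerDl sqr_ge0.
  rewrite -(@ler_pXn2r _ 2)// ?nnegrE// real_normK ?num_real// expr1n -h.
  by rewrite lerDr dot_ge0.
(* The derivative of z^2 - lambda^2 f(x). *)
pose F1 s := 2 * (z s * b s) - lambda ^+ 2 * dot (df (x s)) (a s).
have main (t : R) : 0 <= t <= T -> (forall s, 0 < s < t -> regular_state x z a b s) ->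
    [/\ `|x t - p0| <= t, `|z t| <= t, dot (a t) (a t) + b t ^+ 2 = 1,
        z t ^+ 2 = lambda ^+ 2 * f (x t) & F1 t = 0].
  move=> tT reg.
  have [t0 tT'] := andP tT.
  have xlip (c s : R) : 0 <= s <= t -> 0 <= c -> (forall r, 0 < r < t -> `|a r| <= c) ->
      `|x s - p0| <= c * s.
    move=> s0t c0 ac; have [s0 st] := andP s0t; apply: norm_le_coord => [|i].
      by rewrite mulr_ge0.
    rewrite -x0 !mxE -[s in _ * s]subr0.
    apply: (@is_derive_lip_oo _ (fun s => x s 0 i) (fun s => a s 0 i)) => // r.
      move=> /andP[r0 rs]; have /is_derive_row : is_derive r 1 x (a r); last by apply.
      by apply: dx; apply: sub tT _; rewrite r0 (le_trans rs).
    move=> /andP[r0 rs]; apply: le_trans (coord_le_norm _ _) _; apply: ac.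
    by rewrite r0 (lt_le_trans rs).
  have xB (s : R) : 0 <= s <= t -> oball p0 rho (x s).
    move=> s0t; have [s0 st] := andP s0t.
    (* Before unit speed is known only the clamping bound 2 on the velocity is available; T < rho /
       2 compensates for it. *)
    have : `|x s - p0| <= 2 * s by apply: xlip => // r /reg[].
    by move=> /le_lt_trans; apply; lra.
  have F1d (s : R) : 0 <= s <= t -> is_derive s 1 F1
      (2 * (b s * b s + z s * b' s) -
       lambda ^+ 2 * (hess (d2f (x s)) (a s) + dot (df (x s)) (a' s))).
    move=> s0t; have sT := sub _ _ tT s0t.
    have h1 := dz s sT; have h2 := db s sT.
    have h3 := is_derive_dot (is_derive_df_along (xB s s0t) (dx s sT)) (da s sT).
    have -> : F1 = 2 \*: (z * b) - (lambda ^+ 2) \*: (fun s => dot (df (x s)) (a s)).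
      by apply/funext.
    clear dx dz da db; apply: is_derive_eq; rewrite dot_hess /GRing.scale/=; ring.
  have F10 (s : R) : 0 <= s <= t -> F1 s = 0.
    move=> s0t; have [s0 st] := andP s0t.
    have -> : F1 s = F1 0.
      apply: is_derive_cst_oo s0 _ _.
        by move=> r /andP[r0 rs]; apply: F1d; rewrite r0 (le_trans rs).
      move=> r /andP[r0 rs] /=.
      have [|kE -> ->] := regE r; first by apply: reg; rewrite r0 (lt_le_trans rs).
      have den : lambda ^+ 4 * dot (df (x r)) (df (x r)) + 4 * z r ^+ 2 != 0.
        by rewrite gt_eqF// kappa_den_gt0//; apply: xB; rewrite (ltW r0) ltW// (lt_le_trans rs).
      (* [kappa] is the solution of the linear equation which says that the derivative of [F1]
         vanishes. *)
      have : k r * (lambda ^+ 4 * dot (df (x r)) (df (x r)) + 4 * z r ^+ 2) =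
         2 * b r ^+ 2 - lambda ^+ 2 * hess (d2f (x r)) (a r).
        by rewrite kE /kappa mulfVK.
      rewrite dotZr => h; apply/eqP; rewrite -[X in _ == X](subrr (k r * (lambda ^+ 4 * dot (df (x r)) (df (x r)) + 4 * z r ^+ 2))) {1}h.
      by apply/eqP; ring.
    by rewrite /F1 z0 mul0r mulr0 x0 dotC tang0 mulr0 subrr.
  have speed (s : R) : 0 <= s <= t -> dot (a s) (a s) + b s ^+ 2 = 1.
    move=> s0t; have [s0 st] := andP s0t; rewrite -speed0.
    apply: (@is_derive_cst_oo _ (fun s => dot (a s) (a s) + b s ^+ 2)
      (fun s => (dot (a' s) (a s) + dot (a s) (a' s)) + 2 * (b s * b' s))) => // r.
      move=> /andP[r0 rs]; have rT : 0 <= r <= T by apply: sub tT _; rewrite r0 (le_trans rs).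
      have h1 := is_derive_dot (da r rT) (da r rT); have h2 := db r rT.
      have -> : (fun s => dot (a s) (a s) + b s ^+ 2) = (fun s => dot (a s) (a s)) + b * b.
        by apply/funext => q; rewrite expr2.
      by apply: (is_derive_eq (is_deriveD h1 (is_deriveM h2 h2))); rewrite /GRing.scale/=; ring.
    move=> /andP[r0 rs].
    have [|_ -> ->] := regE r; first by apply: reg; rewrite r0 (lt_le_trans rs).
    have : F1 r = 0 by apply: F10; rewrite (ltW r0) ltW// (lt_le_trans rs).
    rewrite /F1 dotZl dotZr (dotC (a r)) => /eqP; rewrite subr_eq0 => /eqP h.
    rewrite (_ : _ + _ = - 2 * k r * (2 * (z r * b r) - lambda ^+ 2 * dot (df (x r)) (a r))); last by ring.
    by rewrite h subrr mulr0.
  split.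
  - rewrite -[leRHS]mul1r; apply: xlip => //; first by rewrite t0 lexx.
    move=> r /andP[r0 rt]; have [|//] := norm1 r.
    by apply: speed; rewrite (ltW r0) ltW.
  - have := @is_derive_lip_oo _ z b 0 t 1 t0.
    rewrite z0 !subr0 mul1r; apply.
      by move=> r rt; apply: dz; exact: sub tT rt.
    move=> r /andP[r0 rt]; have [|//] := norm1 r.
    by apply: speed; rewrite (ltW r0) ltW.
  - by apply: speed; rewrite t0 lexx.
  - apply/eqP; rewrite -subr_eq0; apply/eqP.
    have -> : 0 = z 0 ^+ 2 - lambda ^+ 2 * f (x 0) by rewrite z0 x0 fp0 mulr0 subr0 expr0n.
    apply: (@is_derive_cst_oo _ (fun s => z s ^+ 2 - lambda ^+ 2 * f (x s)) F1) => //.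
      move=> r r0t; have rT := sub _ _ tT r0t.
      have h1 := dz r rT; have h2 := is_derive_along (xB r r0t) (dx r rT).
      have -> : (fun s => z s ^+ 2 - lambda ^+ 2 * f (x s)) =
          z * z - (lambda ^+ 2) \*: (fun s => f (x s)).
        by apply/funext => q; rewrite expr2.
      by clear dx dz da db F1d; apply: is_derive_eq; rewrite /F1 /GRing.scale/=; ring.
    by move=> r /andP[r0 rt]; apply: F10; rewrite (ltW r0) ltW.
  - by apply: F10; rewrite t0 lexx.
have regt (t : R) : 0 <= t <= T -> (forall s, 0 < s < t -> regular_state x z a b s) ->
    regular_state x z a b t.
  move=> tT reg; have [h1 h2 h3 _ _] := main t tT reg; have [h4 h5] := norm1 t h3.
  by have [t0 tT'] := andP tT; split; lra.
have reg (t : R) : 0 <= t <= T -> regular_state x z a b t.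
  apply: real_induction => [|s /andP[s0 sT] H|s /andP[s0 sT] H].
  - have [h4 h5] := norm1 _ speed0.
    by split; rewrite ?x0 ?z0 ?subrr ?normr0 ?divr_ge0 ?(ltW rho0)//; lra.
  - have sT' : 0 <= s <= T by rewrite s0 ltW.
    have [h1 h2 h3 _ _] := main s sT' (fun r h => H r ltac:(by case/andP: h => /ltW-> /ltW->)).
    have [h4 h5] := norm1 s h3.
    have cont (V : normedModType R) (g : R -> V) (c : R) d : is_derive s 1 g d -> `|g s| < c ->
        \forall r \near s, `|g r| < c.
      move=> /is_derive1_continuous/cvg_norm cg gc.
      by have := cg [set q | q < c]; apply; exact: lt_nbhsl.
    have n1 : \forall r \near s, `|x r - p0| < rho / 2.
      apply: (cont _ (fun r => x r - p0) _ (a s)); last by lra.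
      have h := dx s sT'; rewrite -[a s]subr0; exact: is_deriveB.
    have n2 := cont _ z 2 _ (dz s sT') ltac:(lra).
    have n3 := cont _ a 2 _ (da s sT') ltac:(lra).
    have n4 := cont _ b 2 _ (db s sT') ltac:(lra).
    have : \forall r \near s, regular_state x z a b r.
      near=> r; split; apply: ltW; near: r; [exact: n1|exact: n2|exact: n3|exact: n4].
    move=> /nbhs_ballP[d /= d0 dP]; exists d => // r /andP[sr rd] _; apply: dP.
    by rewrite /ball/= ler0_norm ?subr_le0//; lra.
  - apply: regt; first by rewrite sT ltW.
    by move=> r /andP[r0 rs]; apply: H; rewrite rs ltW.
move=> t tT; have [t0 tT'] := andP tT.
have [h1 h2 h3 h4 h5] := main t tT (fun r h => reg r ltac:(by case/andP: h => /ltW-> /ltW rt; rewrite (le_trans rt))).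
have [kE aE bE] := regE _ (reg t tT).
split; split.
- by rewrite ger0_norm.
- exact: h3.
- exact: h4.
- by apply/eqP; rewrite -subr_eq0; apply/eqP.
- exact: dx.
- exact: dz.
- by rewrite -kE -aE; exact: da.
- by rewrite -kE -bE; exact: db.
Unshelve. all: by end_near. Qed.

Lemma geodesic_at_reverse lambda x z a b (t : R) :
  geodesic_at lambda (fun s => x (- s)) (fun s => z (- s)) (fun s => - a (- s))
    (fun s => - b (- s)) t ->
  geodesic_at lambda x z a b (- t).
Proof.
move=> [[h1 h2 h3 h4] [dx dz da db]].
have kN : kappa lambda (x (- t)) (z (- t)) (- a (- t)) (- b (- t)) =
   kappa lambda (x (- t)) (z (- t)) (a (- t)) (b (- t)) by rewrite /kappa hessN sqrrN.
rewrite kN in da db.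
split; split.
- by rewrite normrN.
- by move: h2; rewrite dotNl dotNr opprK sqrrN.
- exact: h3.
- by move: h4; rewrite dotNr !mulrN => /oppr_inj.
- by rewrite -[a (- t)]opprK; exact: is_derive_unreverse.
- by rewrite -[b (- t)]opprK; exact: is_derive1_unreverse.
- rewrite -[X in is_derive _ _ X _](opprK a) -[X in is_derive _ _ _ X]opprK; apply: is_deriveN.
  exact: (is_derive_unreverse (x := fun s => - a s)).
- rewrite -[X in is_derive _ _ X _](opprK b); apply: is_deriveN; rewrite -[X in is_derive _ _ _ X]opprK.
  exact: (is_derive1_unreverse (x := fun s => - b s)).
Qed.

Lemma exists_geodesic lambda T (w : 'rV[R]_n) (s : R) : 0 < lambda -> 0 < T -> T < rho / 2 ->
  T <= 1 -> f p0 = 0 -> dot w w + s ^+ 2 = 1 -> dot w (df p0) = 0 ->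
  exists x z a b, [/\ x 0 = p0, z 0 = 0, a 0 = w, b 0 = s &
    forall t : R, `|t| <= T -> geodesic_at lambda x z a b t].
Proof.
move=> l0 T0 Trho T1 fp0 speed tang.
have B0 : 0 < T + 1 by rewrite addr_gt0.
have TB : T < T + 1 by rewrite ltrDl.
have [x [z [a [b [x0 z0 a0 b0 sol]]]]] := exists_clamped_solution p0 w 0 s l0 B0.
exists x, z, a, b; split=> // t tT; have [t0|t0] := leP 0 t.
  apply: (clamped_solution_exact l0 sol TB Trho T1) => //; rewrite ?a0 ?b0//.
  by rewrite t0 -(ger0_norm t0).
rewrite -(opprK t); apply: geodesic_at_reverse.
apply: (clamped_solution_exact l0 (clamped_solution_reverse sol) TB Trho T1);
  rewrite ?oppr0 ?a0 ?b0 ?dotNl ?dotNr ?tang ?opprK ?oppr0 ?sqrrN//.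
by rewrite oppr_ge0 (ltW t0)/= -(ltr0_norm t0).
Qed.

End geodesics.

(** * Geodesics near the boundary *)

Lemma near_mul_le (R : realType) (k e : R) : 0 < e -> \forall h \near (0 : R)^'+, k * h <= e.
Proof.
move=> e0; have k0 : 0 < `|k| + 1 by rewrite ltr_wpDl.
near=> h.
have h0 : 0 < h by near: h; exact: nbhs_right_gt.
have he : h <= e / (`|k| + 1) by near: h; apply: nbhs_right_le; exact: divr_gt0.
rewrite (@le_trans _ _ ((`|k| + 1) * h))//; last by rewrite mulrC -ler_pdivlMr.
by rewrite ler_pM2r// (le_trans (ler_norm k))// lerDl.
Unshelve. all: by end_near. Qed.

Section dynamics.
Context {R : realType} {n : nat}.
Variables (K : set 'rV[R]_n) (p0 : 'rV[R]_n) (f : 'rV[R]_n -> R)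
  (df : 'rV[R]_n -> 'rV[R]_n) (d2f : 'rV[R]_n -> 'M[R]_n) (e : 'rV[R]_n) (rho : R).
Hypothesis good : good_defining K p0 f df d2f e rho.

Definition bounded_geometry (c C : R) := [/\ 0 < c, 1 <= C,
  forall x, oball p0 rho x -> c <= dot (df x) (df x) <= C,
  forall x a, oball p0 rho x -> `|a| <= 1 -> `|hess (d2f x) a| <= C &
  forall x y, oball p0 rho x -> oball p0 rho y ->
    `|f y - f x| <= C * `|y - x| /\ `|df y - df x| <= C * `|y - x|].

Lemma exists_bounded_geometry : exists c C, bounded_geometry c C.
Proof.
have [c c0 cP] := norm_df_gt0 good.
have [[rho0 _ _ _] [[[C1 C10 C1P] [C2 C20 C2P] _] Cdf]] := good.
have bh : blip (oball p0 rho) (fun x => d2f x).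
  apply: blip_mx => i j; have [_ bD _] := Cdf i.
  rewrite (_ : (fun _ => _) = (fun x => row i (d2f x) 0 j)); first exact: blip_coord.
  by apply/funext => x; rewrite mxE.
have [C3 C30 C3P] := bh.
pose C := 1 + C1 + C2 + n%:R * C2 ^+ 2 + n%:R * (n%:R * C3).
have n0 : 0 <= n%:R * C2 ^+ 2 by apply: mulr_ge0 => //; exact: sqr_ge0.
have n1 : 0 <= n%:R * (n%:R * C3) by do 2 apply: mulr_ge0 => //.
exists c, C; split=> //.
- by rewrite /C; lra.
- move=> x xB; rewrite cP//= (le_trans (dot_le_norm_sqr _))//.
  have [h _] := C2P _ _ xB xB.
  have : n%:R * `|df x| ^+ 2 <= n%:R * C2 ^+ 2 by rewrite ler_wpM2l// lerXn2r// nnegrE.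
  by rewrite /C; lra.
- move=> x a xB a1; apply: (@le_trans _ _ (n%:R * (n%:R * C3))); last by rewrite /C; lra.
  have [h _] := C3P _ _ xB xB.
  rewrite (le_trans (ler_norm_sum _ _ _))//.
  apply: (@le_trans _ _ (\sum_(i < n) n%:R * C3)); last by rewrite sumr_const card_ord -[leLHS]mulr_natl.
  apply: ler_sum => i _; rewrite normrM -[leRHS]mulr1 ler_pM//; last exact: le_trans (coord_le_norm _ _) _.
  rewrite (le_trans (norm_dot_le _ _))// ler_wpM2l// -[leRHS]mulr1 ler_pM//.
  exact: le_trans (norm_row_le _ _) _.
- move=> x y xB yB; have [_ h1] := C1P _ _ xB yB; have [_ h2] := C2P _ _ xB yB; split.
    by rewrite (le_trans h1)// ler_wpM2r// /C; lra.
  by rewrite (le_trans h2)// ler_wpM2r// /C; lra.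
Qed.

(** The height z is eliminated by squaring its product with b and using z^2 = lambda^2 f, so the
    sheet of M_lambda carrying the geodesic no longer matters; m absorbs the factor lambda^2 of the
    multiplier. *)
Definition flow_on (lambda : R) (x a : R -> 'rV[R]_n) (b m : R -> R) (t0 t1 : R) :=
  forall t : R, t0 <= t <= t1 ->
  [/\ oball p0 rho (x t), is_derive t 1 x (a t), is_derive t 1 a (m t *: df (x t)) &
      dot (a t) (a t) + b t ^+ 2 = 1] /\
  [/\ 0 <= f (x t), 4 * f (x t) * b t ^+ 2 = lambda ^+ 2 * dot (df (x t)) (a t) ^+ 2 &
      m t * (lambda ^+ 2 * dot (df (x t)) (df (x t)) + 4 * f (x t)) =
      2 * b t ^+ 2 - lambda ^+ 2 * hess (d2f (x t)) (a t)].

Lemma flow_on_sub lambda x a b m t0 t1 s0 s1 : flow_on lambda x a b m t0 t1 ->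
  t0 <= s0 -> s1 <= t1 -> flow_on lambda x a b m s0 s1.
Proof.
move=> F h0 h1 t /andP[s0t ts1]; apply: F.
by rewrite (le_trans h0 s0t) (le_trans ts1 h1).
Qed.

Lemma geodesic_flow lambda x z a b T t0 t1 : 0 < lambda -> T < rho ->
  (forall t : R, `|t| <= T -> geodesic_at p0 f df d2f lambda x z a b t) ->
  - T <= t0 -> t1 <= T ->
  flow_on lambda x a b
    (fun t => kappa df d2f lambda (x t) (z t) (a t) (b t) * lambda ^+ 2) t0 t1.
Proof.
move=> l0 Trho G h0 h1 t /andP[t0t tt1].
have tT : `|t| <= T by rewrite ler_norml (le_trans h0 t0t) (le_trans tt1 h1).
have [[g1 g2 g3 g4] [dx dz da db]] := G t tT.
have xB : oball p0 rho (x t) by rewrite /oball/= (le_lt_trans g1)// (le_lt_trans tT).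
have l2 : 0 < lambda ^+ 2 by rewrite exprn_gt0.
split; split=> //.
- by rewrite -(pmulr_rge0 _ l2) -g3 sqr_ge0.
- apply: (mulfI (lt0r_neq0 l2)).
  have -> : lambda ^+ 2 * (4 * f (x t) * b t ^+ 2) = (2 * (z t * b t)) ^+ 2.
    by rewrite !exprMn g3; ring.
  by rewrite g4; ring.
- have den := kappa_den_gt0 good (z t) l0 xB.
  have : kappa df d2f lambda (x t) (z t) (a t) (b t) *
      (lambda ^+ 4 * dot (df (x t)) (df (x t)) + 4 * z t ^+ 2) =
      2 * b t ^+ 2 - lambda ^+ 2 * hess (d2f (x t)) (a t).
    by rewrite /kappa mulfVK// gt_eqF.
  by rewrite g3 => <-; ring.
Qed.

Variables (c C : R).
Hypothesis geom : bounded_geometry c C.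

(** * Force and slope estimates along one geodesic *)

Section one_flow.
Variables (lambda : R) (x a : R -> 'rV[R]_n) (b m : R -> R) (t0 t1 : R).
Hypothesis flow : flow_on lambda x a b m t0 t1.
Hypothesis lambda0 : 0 < lambda.

Lemma flow_norm (t : R) : t0 <= t <= t1 -> `|a t| <= 1 /\ dot (a t) (a t) <= 1.
Proof.
move=> /flow[[_ _ _ h] _]; have h1 : dot (a t) (a t) <= 1 by rewrite -h lerDl sqr_ge0.
by split=> //; apply: norm_le_dot => //; rewrite expr1n.
Qed.

Lemma flow_displacement (s t : R) : t0 <= s -> s <= t -> t <= t1 -> `|x t - x s| <= t - s.
Proof.
move=> t0s st tt1; rewrite -[leRHS]mul1r; apply: (is_derive_row_lip (dx := a)) => // r /andP[sr rt].
  by have [[]] := flow (t := r) ltac:(by rewrite (le_trans t0s) ?(le_trans rt)).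
by have [] := @flow_norm r ltac:(by rewrite (le_trans t0s) ?(le_trans rt)).
Qed.

(** Only the Hessian term can make m negative, and it carries the same factor lambda^2 as the least
    possible coefficient of m. Hence a bound free of lambda: the force may be huge, but only
    inwards. *)
Lemma flow_force_lower (t : R) : t0 <= t <= t1 -> - (C / c) <= m t.
Proof.
move=> tI; have [[xB _ _ _] [f0 _ mE]] := flow tI.
have [c0 C1 dfP hP _] := geom; have [a1 _] := flow_norm tI.
have /andP[cD DC] := dfP _ xB; have hC := hP _ _ xB a1.
rewrite -(ler_pM2r c0) mulNr mulfVK ?gt_eqF//.
have [m0|m0] := leP 0 (m t).
  by rewrite (le_trans (y := 0)) ?mulr_ge0 ?(ltW c0)// oppr_le0 (le_trans ler01).
have l2 : 0 < lambda ^+ 2 by rewrite exprn_gt0.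
rewrite -(ler_pM2l l2).
have e1 : m t * (lambda ^+ 2 * dot (df (x t)) (df (x t)) + 4 * f (x t)) <= m t * (lambda ^+ 2 * c).
  rewrite ler_nM2l// -[leLHS]addr0 lerD//; last by rewrite mulr_ge0.
  by rewrite ler_pM2l.
have e2 : lambda ^+ 2 * hess (d2f (x t)) (a t) <= lambda ^+ 2 * C.
  by rewrite ler_pM2l// (le_trans (ler_norm _)).
have := sqr_ge0 (b t); rewrite mE in e1; lra.
Qed.

Lemma flow_slope_sqr (t : R) : t0 <= t <= t1 -> dot (df (x t)) (a t) ^+ 2 <= C.
Proof.
move=> tI; have [[xB _ _ _] _] := flow tI; have [_ a1] := flow_norm tI.
have [c0 C1 dfP _ _] := geom; have /andP[cD DC] := dfP _ xB.
rewrite (le_trans (Cauchy_Schwarz _ _))// -[leRHS]mulr1 ler_pM// ?dot_ge0//.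
Qed.

Lemma flow_vertical (eps t : R) : t0 <= t <= t1 -> 0 < eps -> eps <= f (x t) ->
  b t ^+ 2 <= lambda ^+ 2 * C / (4 * eps).
Proof.
move=> tI eps0 ef; have [_ [f0 bE _]] := flow tI.
rewrite ler_pdivlMr ?mulr_gt0//.
apply: (@le_trans _ _ (b t ^+ 2 * (4 * f (x t)))).
  by rewrite ler_wpM2l ?sqr_ge0// ler_pM2l.
rewrite mulrC bE; apply: ler_wpM2l; first exact: sqr_ge0.
exact: flow_slope_sqr.
Qed.

Lemma flow_force_upper (eps t : R) : t0 <= t <= t1 -> 0 < eps -> eps <= f (x t) ->
  `|m t| <= lambda ^+ 2 * (C * (eps^-1 + 1) / eps).
Proof.
move=> tI eps0 ef; have [[xB _ _ _] [f0 _ mE]] := flow tI.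
have [c0 C1 dfP hP _] := geom; have [a1 _] := flow_norm tI.
have /andP[cD DC] := dfP _ xB; have hC := hP _ _ xB a1.
have bb := flow_vertical tI eps0 ef.
have l2 : 0 <= lambda ^+ 2 by exact: sqr_ge0.
rewrite mulrA ler_pdivlMr//.
apply: (@le_trans _ _ (`|m t * (lambda ^+ 2 * dot (df (x t)) (df (x t)) + 4 * f (x t))|)).
  rewrite normrM ler_wpM2l// (le_trans _ (ler_norm _))//.
  have : 0 <= lambda ^+ 2 * dot (df (x t)) (df (x t)) by rewrite mulr_ge0 ?dot_ge0.
  by lra.
have b2 : 0 <= 2 * b t ^+ 2 by apply: mulr_ge0 => //; exact: sqr_ge0.
rewrite mE (le_trans (ler_normB _ _))// (ger0_norm b2).
rewrite normrM (ger0_norm l2) mulrA mulrDr mulr1 lerD//.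
  rewrite (_ : lambda ^+ 2 * C / eps = 4 * (lambda ^+ 2 * C / (4 * eps))); last first.
    by field; rewrite gt_eqF.
  by have := sqr_ge0 (b t); lra.
by rewrite ler_wpM2l.
Qed.

Lemma free_flight (eps : R) : 0 < eps ->
  (forall t, t0 <= t <= t1 -> eps <= f (x t)) ->
  forall t, t0 <= t <= t1 ->
  `|a t - a t0| <= lambda ^+ 2 * (C * (eps^-1 + 1) / eps) * C * (t - t0).
Proof.
move=> eps0 ef t /andP[t0t tt1].
have [c0 C1 dfP _ _] := geom.
have k0 : 0 <= lambda ^+ 2 * (C * (eps^-1 + 1) / eps).
  apply: mulr_ge0; first exact: sqr_ge0.
  by rewrite !mulr_ge0 ?addr_ge0 ?invr_ge0 ?(ltW eps0)// (le_trans ler01).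
apply: (is_derive_row_lip (dx := fun t => m t *: df (x t))) => //.
- by rewrite mulr_ge0// (le_trans ler01).
- move=> s /andP[t0s st].
  by have [[]] := flow (t := s) ltac:(by rewrite t0s (le_trans st)).
- move=> s /andP[t0s st]; have sI : t0 <= s <= t1 by rewrite t0s (le_trans st).
  have [[xB _ _ _] _] := flow sI; have /andP[_ DC] := dfP _ xB.
  rewrite normrZ ler_pM//; first exact: flow_force_upper (ef _ sI).
  apply: norm_le_dot; first exact: le_trans C1.
  by rewrite (le_trans DC)// expr2 ler_peMl// (le_trans ler01).
Qed.

Lemma is_derive_height (t : R) : t0 <= t <= t1 ->
  is_derive t 1 (fun s => f (x s)) (dot (df (x t)) (a t)).
Proof. by move=> /flow[[xB dx _ _] _]; exact: (is_derive_along good). Qed.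

Lemma is_derive_slope (t : R) : t0 <= t <= t1 ->
  is_derive t 1 (fun s => dot (df (x s)) (a s))
    (hess (d2f (x t)) (a t) + m t * dot (df (x t)) (df (x t))).
Proof.
move=> /flow[[xB dx da _] _]; have := is_derive_dot (is_derive_df_along good xB dx) da.
by rewrite dot_hess dotZr.
Qed.

(** Only the Hessian term and a negative m can lower the slope, and both are bounded independently
    of lambda. *)
Lemma slope_lower (s t : R) : t0 <= s -> s <= t -> t <= t1 ->
  dot (df (x s)) (a s) - (C + C / c * C) * (t - s) <= dot (df (x t)) (a t).
Proof.
move=> t0s st tt1; have [c0 C1 dfP hP _] := geom.
have sub r : s <= r <= t -> t0 <= r <= t1.
  by move=> /andP[sr rt]; rewrite (le_trans t0s sr) (le_trans rt tt1).
have C20 : 0 <= C / c by rewrite divr_ge0 ?(ltW c0)// (le_trans ler01).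
rewrite -mulNr; apply: (is_derive_le_lin (f := fun s => dot (df (x s)) (a s)) st (fun r h => is_derive_slope (sub r h))).
move=> r /sub rI; have [[xB _ _ _] _] := flow rI.
have [a1 _] := flow_norm rI; have := hP _ _ xB a1; rewrite ler_norml => /andP[h1 _].
have /andP[cD DC] := dfP _ xB; have ml := flow_force_lower rI.
have : - (C / c) * C <= m r * dot (df (x r)) (df (x r)).
  apply: (@le_trans _ _ (- (C / c) * dot (df (x r)) (df (x r)))).
    by rewrite !mulNr lerN2 ler_wpM2l.
  by rewrite ler_wpM2r// dot_ge0.
by lra.
Qed.

(** The slope stays at least beta for a time independent of lambda and eps, so a geodesic that has
    left the layer with a definite slope does not fall back into it meanwhile. *)
Lemma escape (eps beta : R) : 0 < beta -> eps <= f (x t0) ->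
  2 * beta <= dot (df (x t0)) (a t0) -> (C + C / c * C) * (t1 - t0) <= beta ->
  forall t, t0 <= t <= t1 -> eps <= f (x t).
Proof.
move=> b0 e0 sl hT t /andP[t0t tt1]; have [c0 C1 _ _ _] := geom.
have C90 : 0 <= C + C / c * C.
  have C0 : 0 <= C by exact: le_trans C1.
  by apply: addr_ge0 => //; apply: mulr_ge0 => //; apply: divr_ge0 => //; exact: ltW.
apply: (le_trans e0); apply: (is_derive_le (f := fun s => f (x s)) t0t).
  by move=> r /andP[r0 rt]; apply: is_derive_height; rewrite r0 (le_trans rt).
move=> r /andP[r0 rt]; have rt1 := le_trans rt tt1.
have := slope_lower (lexx t0) r0 rt1.
have : (C + C / c * C) * (r - t0) <= (C + C / c * C) * (t1 - t0).
  by rewrite ler_wpM2l// lerD2r.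
by lra.
Qed.

End one_flow.

Definition tangential (g y : 'rV[R]_n) := y - (dot y g / dot g g) *: g.

Lemma dot_tangential g y : g != 0 -> dot (tangential g y) g = 0.
Proof. by move=> /dot_gt0 g0; rewrite dotBl dotZl mulfVK ?subrr// gt_eqF. Qed.

Lemma tangentialD g y z : tangential g (y + z) = tangential g y + tangential g z.
Proof. by apply/rowP => i; rewrite /tangential !mxE dotDl; ring. Qed.

Lemma tangential_normal g k : g != 0 -> tangential g (k *: g) = 0.
Proof.
by move=> /dot_gt0 g0; rewrite /tangential dotZl mulfK ?gt_eqF// subrr.
Qed.

Lemma tangential_pythagoras g y : g != 0 ->
  dot y y = dot (tangential g y) (tangential g y) + dot y g ^+ 2 / dot g g.
Proof.
move=> /dot_gt0 g0; rewrite /tangential !dot_linear (dotC g y).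
by field; rewrite gt_eqF.
Qed.

Lemma tangential_le g y : g != 0 -> dot (tangential g y) (tangential g y) <= dot y y.
Proof.
move=> g0; rewrite [leRHS](tangential_pythagoras y g0) lerDl.
by apply: divr_ge0; [exact: sqr_ge0|exact: dot_ge0].
Qed.

Lemma dot_add_le (y z : 'rV[R]_n) : dot (y + z) (y + z) <= 2 * dot y y + 2 * dot z z.
Proof.
have := dot_ge0 (y - z); rewrite !dot_linear (dotC z y); lra.
Qed.

(** Both total energies are 1, and the tangential parts differ by 2 <w, d> + <d, d>, which is at
    most 3 om because om <= 1. *)
Lemma normal_energy (g y u : 'rV[R]_n) (b2 om : R) : g != 0 ->
  dot y y + b2 = 1 -> dot u u = 1 -> 0 <= om <= 1 ->
  dot (tangential g y - tangential g u) (tangential g y - tangential g u) <= om ^+ 2 ->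
  `|dot y g ^+ 2 / dot g g + b2 - dot u g ^+ 2 / dot g g| <= 3 * om.
Proof.
move=> g0 y1 u1 /andP[om0 om1] dd.
have yE := tangential_pythagoras y g0; have uE := tangential_pythagoras u g0.
set w := tangential g u in dd uE *; set d := tangential g y - w in dd.
have yw : tangential g y = w + d by rewrite /d addrC subrK.
have w1 : dot w w <= 1.
  rewrite -u1 uE lerDl; apply: divr_ge0; [exact: sqr_ge0|exact: dot_ge0].
have wd : `|dot w d| <= om.
  rewrite -(@ler_pXn2r _ 2)// ?nnegrE// real_normK ?num_real//.
  rewrite (le_trans (Cauchy_Schwarz w d))// -[leRHS]mul1r ler_pM// dot_ge0//.
clearbody d w.
have dd1 : dot d d <= om by rewrite (le_trans dd)// expr2 ler_piMr.
move: yE; rewrite yw dotDl !dotDr (dotC d w) => yE.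
have := dot_ge0 d; move: wd; rewrite !ler_norml => /andP[h1 h2] d0.
by apply/andP; split; lra.
Qed.

(** Energy makes the squares of N and sg close; the lower bound on N excludes the root - sg and
    keeps N + sg above sg / 2. *)
Lemma normal_component (N sg G b2 om : R) : 0 < sg -> 0 < G -> G <= C ->
  `|N ^+ 2 / G + b2 - sg ^+ 2 / G| <= 3 * om -> 0 <= b2 <= om -> - (sg / 2) <= N ->
  `|N - sg| <= 8 * om * C / sg.
Proof.
move=> sg0 G0 GC h /andP[b0 bom] Nlo.
rewrite ler_pdivlMr//.
have h1 : `|N ^+ 2 - sg ^+ 2| <= 4 * om * G.
  rewrite (_ : N ^+ 2 - sg ^+ 2 = (N ^+ 2 / G + b2 - sg ^+ 2 / G) * G - b2 * G); last first.
    by field; rewrite gt_eqF.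
  rewrite (le_trans (ler_normB _ _))// !normrM (gtr0_norm G0) (ger0_norm b0).
  by rewrite -mulrDl ler_pM2r//; lra.
have h2 : `|N - sg| * (sg / 2) <= `|N ^+ 2 - sg ^+ 2|.
  rewrite (_ : N ^+ 2 - sg ^+ 2 = (N - sg) * (N + sg)); last by ring.
  by rewrite normrM ler_wpM2l// (le_trans _ (ler_norm _))//; lra.
have : 4 * om * G <= 4 * om * C by rewrite ler_wpM2l//; lra.
by lra.
Qed.

(** Here f0, f1 are heights, s0, s1 slopes, and l2 is lambda^2. If f1 < eps, the virial quantity
    would end below 2 eps^2. But the quadratic growth (q / 2) (A eps)^2 exceeds the worst initial
    drift 5 C^2 eps (A eps) by at least 2 eps (A eps); this is the origin of the condition on q
    A. *)
Lemma virial_exit (A eps q l2 f0 f1 s0 s1 : R) : 1 <= C -> 1 <= A -> 0 < eps <= 1 ->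
  10 * C ^+ 2 + 4 <= q * A -> 0 < l2 -> C * l2 <= eps ^+ 2 -> 0 <= f0 -> 0 <= f1 ->
  2 * f0 + C / 2 * l2 <= 5 * C * eps -> s0 ^+ 2 <= C ->
  (2 * f0 + C / 2 * l2) * s0 + q * (A * eps) <= (2 * f1 + C / 2 * l2) * s1 ->
  f0 ^+ 2 + C / 2 * l2 * f0 + (2 * f0 + C / 2 * l2) * s0 * (A * eps) + q / 2 * (A * eps) ^+ 2 <=
    f1 ^+ 2 + C / 2 * l2 * f1 ->
  0 < s1 /\ eps <= f1.
Proof.
move=> C1 A1 /andP[eps0 eps1] qA l20 Cl f00 f10 k5 s0C g1 g2.
have C0 : 0 < C by exact: lt_le_trans C1.
have C20 : 0 < C / 2 * l2 by rewrite mulr_gt0// divr_gt0.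
have Q0 : 0 <= f0 ^+ 2 + C / 2 * l2 * f0.
  by apply: addr_ge0; [exact: sqr_ge0|apply: mulr_ge0 => //; exact: ltW].
have s0lo : - C <= s0.
  have : `|s0| <= C.
    rewrite -(@ler_pXn2r _ 2)// ?nnegrE ?(ltW C0)// real_normK ?num_real//.
    by rewrite (le_trans s0C)// expr2 ler_peMl// ltW.
  by rewrite ler_norml => /andP[].
have {}Cl : 2 * (C / 2 * l2) <= eps ^+ 2 by lra.
move: (C / 2 * l2) C20 Cl k5 g1 g2 Q0 => k k0 Cl k5 g1 g2 Q0.
have Q1 : - (5 * C ^+ 2 * eps) <= (2 * f0 + k) * s0.
  have : (2 * f0 + k) * - C <= (2 * f0 + k) * s0 by rewrite ler_wpM2l//; lra.
  have : (2 * f0 + k) * C <= 5 * C * eps * C by rewrite ler_wpM2r// ltW.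
  by lra.
move: ((2 * f0 + k) * s0) (f0 ^+ 2 + k * f0) Q0 Q1 g1 g2 => v u Q0 Q1 g1 g2.
have qAe : (10 * C ^+ 2 + 4) * eps <= q * A * eps by rewrite ler_pM2r.
have Ce2 : 0 <= C ^+ 2 * eps by apply: mulr_ge0; [exact: sqr_ge0|exact: ltW].
split.
  have kt1 : 0 < 2 * f1 + k by apply: ltr_wpDl => //; exact: mulr_ge0.
  by rewrite -(pmulr_rgt0 _ kt1); lra.
rewrite leNgt; apply/negP => fl.
have Ae0 : 0 <= A * eps by apply: mulr_ge0; [exact: le_trans A1|exact: ltW].
have h1 : - (5 * C ^+ 2 * eps) * (A * eps) <= v * (A * eps) by exact: ler_wpM2r.
have h2 : (10 * C ^+ 2 + 4) * eps * (A * eps) <= q * A * eps * (A * eps) by exact: ler_wpM2r.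
have h3 : eps ^+ 2 <= eps * (A * eps) by rewrite expr2 ler_pM2l// ler_peMl// ltW.
have e3 : 0 < eps ^+ 2 by exact: exprn_gt0.
have h4 : f1 ^+ 2 + k * f1 < 2 * eps ^+ 2.
  have : f1 ^+ 2 < eps ^+ 2 by rewrite ltrXn2r// nnegrE// ltW.
  have : k * f1 <= k * 1 by rewrite ler_pM2l// ltW// (lt_le_trans fl).
  by lra.
by move: qAe Ce2 => _ _; rewrite expr2 in g2; lra.
Qed.

Lemma convexity_margin (s2 E om P X : R) : 0 < c -> `|E - s2| <= 3 * om -> 12 * om <= s2 ->
  2 * P + X <= c * s2 / 4 -> c * s2 / 2 <= c * E - 2 * P - X.
Proof.
move=> c0 /ler_normlP[h1 _] h2 h3.
have : c * (s2 - 3 * om) <= c * E by rewrite ler_pM2l//; lra.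
have : c * (12 * om) <= c * s2 by rewrite ler_pM2l.
by lra.
Qed.

Lemma normal_exit (sg sl N P : R) : 0 < sg -> 4 * P <= sg -> 0 <= sl -> `|sl - N| <= P ->
  - (sg / 2) <= N.
Proof. by move=> sg0 P4 sl0 /ler_normlP[_ h]; lra. Qed.

Lemma slope_exit (sg sl N P om : R) : 0 < sg -> 4 * P <= sg -> 32 * C * om <= sg ^+ 2 ->
  `|sl - N| <= P -> `|N - sg| <= 8 * om * C / sg -> sg / 2 <= sl.
Proof.
move=> sg0 P4 om32 /ler_normlP[h1 _] /ler_normlP[h2 _].
have : 8 * om * C / sg <= sg / 4 by rewrite ler_pdivrMr//; lra.
by lra.
Qed.

Lemma thickness_small (lambda eps om : R) : 1 <= C -> 0 < lambda -> 0 < eps <= 1 -> 0 < om <= 1 ->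
  lambda <= 1 -> C * lambda <= eps * om ->
  C * lambda ^+ 2 <= eps ^+ 2 * om /\ lambda ^+ 2 <= eps.
Proof.
move=> C1 l0 /andP[eps0 eps1] /andP[om0 om1] l1 lC.
have ll : lambda ^+ 2 <= eps * lambda.
  rewrite expr2 ler_wpM2r ?(ltW l0)//.
  have : lambda <= C * lambda by rewrite ler_peMl// ltW.
  have : eps * om <= eps by rewrite ler_piMr// ltW.
  by lra.
have le : eps * lambda <= eps by rewrite ler_piMr// ltW.
split; last exact: le_trans le.
apply: (@le_trans _ _ (eps * (C * lambda))).
  by rewrite [leRHS]mulrCA; apply: ler_wpM2l => //; exact: le_trans C1.
by rewrite expr2 -mulrA ler_wpM2l// ltW.
Qed.

(** The second derivative is given by a pointwise existential, the form in which [virial_convex]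
    supplies it. *)
Lemma second_order_growth (h dh : R -> R) (s0 s1 q : R) : s0 <= s1 ->
  (forall t : R, s0 <= t <= s1 -> is_derive t 1 h (dh t)) ->
  (forall t : R, s0 <= t <= s1 -> exists2 d : R, is_derive t 1 dh d & q <= d) ->
  dh s0 + q * (s1 - s0) <= dh s1 /\
  h s0 + dh s0 * (s1 - s0) + q / 2 * (s1 - s0) ^+ 2 <= h s1.
Proof.
move=> s01 H D.
have dhP t : s0 <= t <= s1 -> dh s0 + q * (t - s0) <= dh t.
  move=> /andP[s0t ts]; apply: (@is_derive_le_lin R dh (fun t => 'D_1 dh t)) => // r /andP[r0 rt].
    by have [d dd _] := D r ltac:(by rewrite r0 (le_trans rt)); rewrite derive_val.
  by have [d dd] := D r ltac:(by rewrite r0 (le_trans rt)); rewrite derive_val.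
split; first by apply: dhP; rewrite s01 lexx.
pose k (t : R) : R := h t - (dh s0 * (t - s0) + q / 2 * (t - s0) ^+ 2).
suff : k s0 <= k s1 by rewrite /k subrr expr0n/= !mulr0 addr0 subr0; lra.
apply: (@is_derive_le R k (fun t => dh t - (dh s0 + q * (t - s0)))) => // t tI.
  have ht := H t tI.
  have -> : k = h - (dh s0 \*: (id - cst s0 : R -> R) + (q / 2) \*: ((id - cst s0 : R -> R) * (id - cst s0 : R -> R))).
    by apply/funext => z; rewrite /k expr2.
  by apply: is_derive_eq; rewrite /GRing.scale/= subr0 !fctE; field.
by rewrite subr_ge0 dhP.
Qed.

(** * A single passage near a boundary point *)

Section near_collision.
Variables (lambda : R) (x a : R -> 'rV[R]_n) (b m : R -> R) (t0 t1 : R) (p : 'rV[R]_n) (r : R).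
Hypothesis flow : flow_on lambda x a b m t0 t1.
Hypothesis lambda0 : 0 < lambda.
Hypothesis t01 : t0 <= t1 <= t0 + 1.
Hypothesis pB : oball p0 rho p.
Hypothesis fp : f p = 0.
Hypothesis xp : forall t, t0 <= t <= t1 -> `|x t - p| <= r.
Hypothesis rsmall : n%:R * C ^+ 2 * r <= c / 2.

Let g := df p.
Let G := dot g g.
Let C2 := C / c.
Let C3 := C2 * (2 * C / c + 1).

Let c0 : 0 < c. Proof. by case: geom. Qed.
Let C1 : 1 <= C. Proof. by case: geom. Qed.
Let C0 : 0 < C. Proof. exact: lt_le_trans C1. Qed.
Let GB : c <= G <= C. Proof. by case: geom => _ _ h _ _; exact: h. Qed.
Let C20 : 0 <= C2. Proof. by apply: divr_ge0; exact: ltW. Qed.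
Let C30 : 0 <= C3.
Proof.
apply: mulr_ge0 => //; apply: addr_ge0 => //; apply: divr_ge0; last exact: ltW.
by apply: mulr_ge0 => //; exact: ltW.
Qed.
Let r0 : 0 <= r.
Proof. by have := xp (t := t0); rewrite lexx; case/andP: t01 => -> _ /(_ isT); apply: le_trans. Qed.

Let gC : `|g| <= C.
Proof.
apply: norm_le_dot; first exact: ltW.
by case/andP: GB => _ h; rewrite (le_trans h)// expr2 ler_peMl// ltW.
Qed.

Let g0 : g != 0.
Proof.
by apply: contraTneq c0 => h; rewrite -leNgt; case/andP: GB; rewrite /G h dot0l.
Qed.

Let dfg (t : R) : t0 <= t <= t1 -> `|df (x t) - g| <= C * r.
Proof.
move=> tI; have [[xB _ _ _] _] := flow tI; have [_ _ _ _ h] := geom.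
have [_ h2] := h _ _ pB xB; rewrite (le_trans h2)// ler_pM2l//; exact: xp.
Qed.

Let height_le (t : R) : t0 <= t <= t1 -> f (x t) <= C * `|x t - p|.
Proof.
move=> tI; have [[xB _ _ _] _] := flow tI; have [_ _ _ _ h] := geom.
by have [h2 _] := h _ _ pB xB; move: h2; rewrite fp subr0; exact: le_trans (ler_norm _).
Qed.

Let normal_bounds (t : R) : t0 <= t <= t1 -> c / 2 <= dot (df (x t)) g <= C.
Proof.
move=> tI; have [[xB _ _ _] _] := flow tI; have [_ _ dfP _ _] := geom.
have /andP[_ DC] := dfP _ xB; have /andP[cG GC] := GB.
apply/andP; split.
  have -> : dot (df (x t)) g = G + dot (df (x t) - g) g by rewrite dotBl /G; ring.
  have : `|dot (df (x t) - g) g| <= c / 2.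
    rewrite (le_trans (norm_dot_le _ _))// (le_trans _ rsmall)//.
    rewrite [leRHS](_ : _ = n%:R * (C * r * C)); last by ring.
    by apply: ler_wpM2l => //; apply: ler_pM => //; exact: dfg.
  by rewrite ler_norml => /andP[]; lra.
have : dot (df (x t)) g ^+ 2 <= C ^+ 2.
  rewrite (le_trans (Cauchy_Schwarz _ _))// expr2 ler_pM// ?dot_ge0//.
by move=> h; rewrite (le_trans (ler_norm _))// -(@ler_pXn2r _ 2)// ?nnegrE ?(ltW C0)// real_normK// num_real.
Qed.

(** Since m is bounded below, |m| is at most a multiple of the normal force plus a constant, and the
    normal force integrates to a change of the normal velocity, which is bounded. *)
Let force_le (t : R) : t0 <= t <= t1 -> `|m t| <= 2 / c * (m t * dot (df (x t)) g) + C3.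
Proof.
move=> tI; have /andP[h1 h2] := normal_bounds tI.
have ml := flow_force_lower flow lambda0 tI; rewrite -/C2 in ml.
have mC : 0 <= m t + C2 by lra.
have e1 : (m t + C2) * (c / 2) <= (m t + C2) * dot (df (x t)) g by rewrite ler_wpM2l.
have e2 : C2 * dot (df (x t)) g <= C2 * C by rewrite ler_wpM2l.
have e3 : m t + C2 <= 2 / c * (m t * dot (df (x t)) g + C2 * C).
  rewrite -(ler_pM2r (_ : 0 < c / 2)) ?divr_gt0//.
  rewrite [leRHS](_ : _ = m t * dot (df (x t)) g + C2 * C); last by field; rewrite gt_eqF.
  by rewrite (le_trans e1)// mulrDl lerD2l.
have e4 : C3 = 2 / c * (C2 * C) + C2 by rewrite /C3; field; rewrite gt_eqF.
rewrite e4 (_ : _ + _ = 2 / c * (m t * dot (df (x t)) g + C2 * C) + C2); last by ring.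
have key (X M c2 : R) : 0 <= c2 -> - c2 <= M -> M + c2 <= X -> `|M| <= X + c2.
  by move=> h3 h4 h5; rewrite ler_norml; apply/andP; split; lra.
exact: key C20 ml e3.
Qed.

Let normal_velocity (t : R) : t0 <= t <= t1 -> `|dot (a t) g| <= C.
Proof.
move=> tI; have [_ a1] := flow_norm flow tI; have /andP[_ GC] := GB.
rewrite -(@ler_pXn2r _ 2)// ?nnegrE ?(ltW C0)// real_normK ?num_real//.
rewrite (le_trans (Cauchy_Schwarz _ _))// -[dot g g]/G.
apply: (@le_trans _ _ (1 * C)); first by rewrite ler_pM// dot_ge0.
by rewrite mul1r expr2 ler_peMl// ltW.
Qed.

Definition collision_const : R := n%:R * 2 * C * (4 * C / c + C3).
Let C5 := collision_const.

(* The impulse is bounded because it is almost normal and the normal velocity is bounded;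
   hence the tangential velocity is almost conserved. *)
Lemma tangential_velocity v (t : R) : dot v g = 0 -> `|v| <= 2 -> t0 <= t <= t1 ->
  `|dot (a t - a t0) v| <= C5 * r.
Proof.
move=> vg v2 tI; have [t0t tt1] := andP tI; have [_ t1t0] := andP t01.
pose q := n%:R * (C * r * 2).
have q0 : 0 <= q by rewrite mulr_ge0// mulr_ge0// mulr_ge0// ltW.
have sub s : t0 <= s <= t -> t0 <= s <= t1 by move=> /andP[-> st]; exact: le_trans tt1.
have dE (s : R) : t0 <= s <= t -> is_derive s 1 (fun s => dot (a s) v) (dot (m s *: df (x s)) v).
  move=> /sub/flow[[_ _ da _] _].
  have := is_derive_dot da (is_derive_cst v s 1).
  by rewrite dot0r addr0.
have dN (s : R) : t0 <= s <= t -> is_derive s 1 (fun s => dot (a s) g) (m s * dot (df (x s)) g).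
  move=> /sub/flow[[_ _ da _] _].
  have := is_derive_dot da (is_derive_cst g s 1).
  by rewrite dot0r addr0 dotZl.
have bE s : t0 <= s <= t -> `|dot (m s *: df (x s)) v| <= q * (2 / c * (m s * dot (df (x s)) g) + C3).
  move=> /sub sI; rewrite dotZl (_ : dot (df (x s)) v = dot (df (x s) - g) v); last first.
    by rewrite dotBl (dotC g) vg subr0.
  rewrite normrM mulrC ler_pM//; last exact: force_le.
  rewrite (le_trans (norm_dot_le _ _))// /q ler_wpM2l// ler_pM//; exact: dfg.
(* An antiderivative of the bound on the tangential force; its increment involves only the normal
   velocity and the elapsed time. *)
pose H s := q * (2 / c * dot (a s) g + C3 * s).
have dH (s : R) : t0 <= s <= t -> is_derive s 1 H (q * (2 / c * (m s * dot (df (x s)) g) + C3)).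
  move=> /dN h; have -> : H = q \*: ((2 / c) \*: (fun s => dot (a s) g) + C3 \*: (id : R -> R)).
    by apply/funext => z; rewrite /H.
  by apply: is_derive_eq; rewrite /GRing.scale/= mulr1.
have u1 := @is_derive_le R (fun s => H s - dot (a s) v) _ t0 t t0t
  (fun s h => is_deriveB (dH s h) (dE s h)).
have u2 := @is_derive_le R (fun s => H s + dot (a s) v) _ t0 t t0t
  (fun s h => is_deriveD (dH s h) (dE s h)).
have {}u1 : H t0 - dot (a t0) v <= H t - dot (a t) v.
  by apply: u1 => s /bE; rewrite ler_norml subr_ge0 => /andP[].
have {}u2 : H t0 + dot (a t0) v <= H t + dot (a t) v.
  by apply: u2 => s /bE; rewrite ler_norml => /andP[h _]; rewrite -lerBlDl sub0r.
have HH : H t - H t0 <= C5 * r.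
  rewrite /H -mulrBr (_ : C5 * r = q * (4 * C / c + C3)); last by rewrite /C5 /collision_const /q; ring.
  apply: ler_wpM2l => //.
  have tI0 : t0 <= t0 <= t1 by rewrite lexx (le_trans t0t).
  have /ler_normlP[n1 n2] := normal_velocity tI; have /ler_normlP[n3 n4] := normal_velocity tI0.
  have ic : 0 <= 2 / c by apply: divr_ge0 => //; exact: ltW.
  have e1 : 2 / c * (dot (a t) g - dot (a t0) g) <= 2 / c * (2 * C) by apply: ler_wpM2l => //; lra.
  have e2 : C3 * (t - t0) <= C3 * 1 by apply: ler_wpM2l => //; lra.
  have e3 : 4 * C / c = 2 / c * (2 * C) by field; rewrite gt_eqF.
  by rewrite e3; lra.
by rewrite dotBl ler_norml; apply/andP; split; lra.
Qed.

(** The bound of [tangential_velocity] is tested on the tangential part of the velocity change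
    itself. *)
Lemma tangential_conserved (t : R) : t0 <= t <= t1 ->
  dot (tangential g (a t - a t0)) (tangential g (a t - a t0)) <= C5 * r.
Proof.
move=> tI; set y := a t - a t0; set v := tangential g y.
have vg : dot v g = 0 by exact: dot_tangential.
have tI0 : t0 <= t0 <= t1 by rewrite lexx; case/andP: t01.
have vv4 : dot v v <= 2 ^+ 2.
  rewrite (le_trans (tangential_le y g0))// (le_trans (dot_add_le _ _))//.
  have [_ h1] := flow_norm flow tI; have [_ h2] := flow_norm flow tI0.
  by rewrite dotNl dotNr opprK; lra.
have v2 : `|v| <= 2 by exact: norm_le_dot.
have -> : dot v v = dot y v by rewrite {1}/v dotBl dotZl (dotC g) vg mulr0 subr0.
by rewrite (le_trans (ler_norm _))// tangential_velocity.
Qed.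

Lemma slope_near_normal (t : R) : t0 <= t <= t1 ->
  `|dot (df (x t)) (a t) - dot (a t) g| <= n%:R * C * r.
Proof.
move=> tI; rewrite (dotC (a t)) -dotBl (le_trans (norm_dot_le _ _))// -mulrA ler_wpM2l//.
have [a1 _] := flow_norm flow tI.
by rewrite -[leRHS]mulr1 ler_pM// dfg.
Qed.

(** The summand C / 2 * lambda^2 makes 2 kap dominate lambda^2 |df|^2 + 4 f, the coefficient of m in
    the force equation. *)
Let kap t : R := 2 * f (x t) + C / 2 * lambda ^+ 2.

(* Q = f^2 + (C/2) lambda^2 f is strictly convex along the flow near a transversal
   collision, whatever the phase of the reflection. *)
Let Q t : R := f (x t) ^+ 2 + C / 2 * lambda ^+ 2 * f (x t).

Lemma is_derive_virial (t : R) : t0 <= t <= t1 ->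
  is_derive t 1 Q (kap t * dot (df (x t)) (a t)).
Proof.
move=> /(is_derive_height flow) h.
have -> : Q = (fun s => f (x s)) * (fun s => f (x s)) + (C / 2 * lambda ^+ 2) \*: (fun s => f (x s)).
  by apply/funext => s; rewrite /Q expr2.
by apply: is_derive_eq; rewrite /kap /GRing.scale/=; ring.
Qed.

Lemma virial_convex (t k0 : R) : t0 <= t <= t1 -> kap t <= k0 -> lambda ^+ 2 <= k0 ->
  n%:R * C * r <= 1 ->
  exists2 d, is_derive t 1 (fun s => kap s * dot (df (x s)) (a s)) d &
  c * (dot (a t) g ^+ 2 / G + b t ^+ 2) - 2 * (n%:R * C * r) - (C + C * (C / 2 + C2)) * k0 <= d.
Proof.
move=> tI kk0 lk0 rr1.
have [[xB dx da sp] [f0 bE mE]] := flow tI; have [_ _ dfP hP _] := geom.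
have [a1 a2] := flow_norm flow tI; have /andP[cD DC] := dfP _ xB.
have hC := hP _ _ xB a1; have /andP[cG GC] := GB.
have h1 := is_derive_height flow tI; have h2 := is_derive_slope flow tI.
set H := hess _ _ in h2 mE hC; set D := dot (df (x t)) (df (x t)) in h2 mE cD DC.
set ph := dot (df (x t)) (a t) in h1 bE *.
exists (2 * ph ^+ 2 + kap t * (H + m t * D)).
  have -> : (fun s => kap s * dot (df (x s)) (a s)) =
     (2 \*: (fun s => f (x s)) + cst (C / 2 * lambda ^+ 2)) * (fun s => dot (df (x s)) (a s)).
    by apply/funext => s.
  by apply: is_derive_eq; rewrite /kap !fctE /GRing.scale/= -/ph -[2 *: f (x t)]/(2 * f (x t)); ring.
have l2 : 0 <= lambda ^+ 2 by exact: sqr_ge0.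
have kap0 : 0 <= kap t.
  apply: addr_ge0; apply: mulr_ge0 => //; exact: ltW (divr_gt0 C0 (ltr0Sn R 1)).
have ml := flow_force_lower flow lambda0 tI; rewrite -/C2 in ml.
have b20 := sqr_ge0 (b t).
have /ler_normlP[H1 H2] := hC.
(* Adding C2 makes the factor m + C2 nonnegative, so the coefficient of m may be replaced by the
   larger 2 kap. *)
have e1 : b t ^+ 2 - lambda ^+ 2 * C / 2 <= (m t + C2) * kap t.
  have : (m t + C2) * (lambda ^+ 2 * D + 4 * f (x t)) <= (m t + C2) * (2 * kap t).
    apply: ler_wpM2l; first by lra.
    have : lambda ^+ 2 * D <= lambda ^+ 2 * C by rewrite ler_wpM2l.
    by rewrite /kap; lra.
  rewrite [leLHS]mulrDl mE => h.
  have : lambda ^+ 2 * H <= lambda ^+ 2 * C by rewrite ler_wpM2l//; lra.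
  have : 0 <= C2 * (lambda ^+ 2 * D + 4 * f (x t)).
    by apply: mulr_ge0 => //; apply: addr_ge0; apply: mulr_ge0 => //; exact: dot_ge0.
  by lra.
have e2 : D * (b t ^+ 2 - lambda ^+ 2 * C / 2 - C2 * kap t) <= kap t * (m t * D).
  rewrite mulrCA mulrA [leRHS]mulrC; apply: ler_wpM2l; first exact: dot_ge0.
  by move: e1; rewrite mulrDl; lra.
have e3 : c * b t ^+ 2 <= D * b t ^+ 2 by rewrite ler_wpM2r.
have e4 : D * (lambda ^+ 2 * C / 2 + C2 * kap t) <= C * (k0 * (C / 2 + C2)).
  have X0 : 0 <= lambda ^+ 2 * C / 2 + C2 * kap t.
    apply: addr_ge0; last exact: mulr_ge0.
    by apply: divr_ge0 => //; apply: mulr_ge0 => //; exact: ltW.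
  apply: ler_pM => //; first exact: dot_ge0.
  rewrite [leRHS](_ : _ = k0 * (C / 2) + C2 * k0); last by ring.
  apply: lerD; last by rewrite ler_wpM2l.
  by rewrite -mulrA; apply: ler_wpM2r => //; exact: ltW (divr_gt0 C0 (ltr0Sn R 1)).
have e5 : - (C * k0) <= kap t * H.
  have : kap t * - H <= kap t * C by rewrite ler_wpM2l//; lra.
  have : kap t * C <= k0 * C by rewrite ler_wpM2r// ltW.
  by lra.
have e6 : c * (dot (a t) g ^+ 2 / G) <= dot (a t) g ^+ 2.
  rewrite mulrA ler_pdivrMr; last exact: lt_le_trans cG.
  by rewrite mulrC ler_wpM2l// sqr_ge0.
(* The factor 2 of 2 f'^2 is spent here: N^2 <= 2 f'^2 + 2 (f' - N)^2 for the normal velocity N. *)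
have e7 : dot (a t) g ^+ 2 - 2 * (n%:R * C * r) <= 2 * ph ^+ 2.
  have h := slope_near_normal tI; rewrite -/ph in h.
  have : (ph - dot (a t) g) ^+ 2 <= n%:R * C * r.
    rewrite -real_normK ?num_real// (le_trans _ (_ : (n%:R * C * r) ^+ 2 <= _))//.
      by rewrite lerXn2r// nnegrE// (le_trans _ h).
    by rewrite expr2 ler_piMr// (le_trans _ h).
  have := sqr_ge0 (ph + ph - dot (a t) g); nra.
have {}e2 : D * b t ^+ 2 - D * (lambda ^+ 2 * C / 2 + C2 * kap t) <= kap t * (m t * D).
  by rewrite -mulrBr opprD addrA.
have -> : (C + C * (C / 2 + C2)) * k0 = C * k0 + C * (k0 * (C / 2 + C2)) by ring.
rewrite (mulrDr c) (mulrDr (kap t)).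
have key (m0 m1 m2 m3 m4 m5 m6 m7 m8 m9 m10 : R) : m2 - m3 <= m4 -> m5 <= m2 -> m3 <= m0 ->
  - m1 <= m9 -> m6 <= m10 -> m10 - 2 * m7 <= m8 ->
  m6 + m5 - 2 * m7 - (m1 + m0) <= m8 + (m9 + m4) by lra.
exact: key e2 e3 e4 e5 e6 e7.
Qed.

(** s2 is the normal energy of u, q is half of the convexity c s2 that it produces, and k0 bounds
    [kap] within the distance r = (2 + A) eps: 2 eps at the start and A eps travelled. After the
    exit the vertical energy is small, and the positive slope decides the sign of the normal
    velocity. *)
Lemma collision_exit (u : 'rV[R]_n) (theta eps om A eta : R) :
  let sg := dot u g in let s2 := sg ^+ 2 / G in let q := c * s2 / 2 in
  let k0 := (2 * C * (2 + A) + C) * eps in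
  t1 = t0 + A * eps -> r = (2 + A) * eps -> 1 <= A -> 10 * C ^+ 2 + 4 <= q * A ->
  dot u u = 1 -> 0 < sg -> 0 < eps <= 1 -> 0 < om <= 1 -> 0 <= eta ->
  `|x t0 - p| <= 2 * eps -> `|a t0 - (u + theta *: g)| <= eps ->
  2 * (C5 * r) + 2 * (n%:R * eps) <= om ^+ 2 -> 12 * om <= s2 -> 32 * C * om <= sg ^+ 2 ->
  om * (1 + 64 * C ^+ 2 / (sg ^+ 2 * c)) <= eta ^+ 2 ->
  lambda <= 1 -> C * lambda <= eps * om ->
  n%:R * C * r <= 1 -> 4 * (n%:R * C * r) <= sg ->
  2 * (n%:R * C * r) + (C + C * (C / 2 + C2)) * k0 <= c * s2 / 4 ->
  [/\ eps <= f (x t1), `|a t1 - u| <= eta & sg / 2 <= dot (df (x t1)) (a t1)].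
Proof.
move=> sg s2 q k0 t1E rE A1 qA u1 sg0 /andP[eps0 eps1] /andP[om0 om1] eta0 x0 a0 hom om12 om32
  hometa l1 lC P1 P4 hk.
set P := n%:R * C * r in P1 P4 hk.
have G0 : 0 < G by case/andP: GB => h _; exact: lt_le_trans h.
have GC : G <= C by case/andP: GB.
have c1 : t0 <= t1 by case/andP: t01.
have tI0 : t0 <= t0 <= t1 by rewrite lexx.
have tI1 : t0 <= t1 <= t1 by rewrite lexx c1.
have [Cll lle] := thickness_small C1 lambda0 (introT andP (conj eps0 eps1)) (introT andP (conj om0 om1)) l1 lC.
have Cle : C * lambda ^+ 2 <= eps ^+ 2.
  by rewrite (le_trans Cll)// ler_piMr// sqr_ge0.
have e2e : eps ^+ 2 <= eps by rewrite expr2 ler_piMr// ltW.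
have e20 : 0 <= eps ^+ 2 by exact: sqr_ge0.
have Ceps : eps <= C * eps by rewrite ler_peMl// ltW.
have CA : 0 <= C * A * eps by apply: mulr_ge0; [apply: mulr_ge0; [exact: ltW|lra]|exact: ltW].
(* Two errors add up: the change along the passage and the initial one, whose normal part theta g is
   invisible to [tangential]. *)
have tanP t : t0 <= t <= t1 ->
    dot (tangential g (a t) - tangential g u) (tangential g (a t) - tangential g u) <= om ^+ 2.
  move=> tI; rewrite (_ : _ - _ = tangential g (a t - a t0) + tangential g (a t0 - (u + theta *: g))).
    rewrite (le_trans (dot_add_le _ _))// (le_trans _ hom)// lerD// ler_pM2l//.
      exact: tangential_conserved.
    rewrite (le_trans (tangential_le _ g0))// (le_trans (dot_le_norm_sqr _))// ler_wpM2l//.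
    by rewrite (le_trans _ e2e)// lerXn2r ?nnegrE ?(ltW eps0).
  have tN v w : tangential g (v - w) = tangential g v - tangential g w.
    by apply/rowP => i; rewrite /tangential !mxE dotBl; ring.
  by rewrite !tN tangentialD tangential_normal// addr0 addrA subrK.
have enP t : t0 <= t <= t1 -> `|dot (a t) g ^+ 2 / G + b t ^+ 2 - s2| <= 3 * om.
  move=> tI; have [[_ _ _ sp] _] := flow tI.
  by apply: normal_energy => //; [rewrite ltW//|exact: tanP].
have kk t : t0 <= t <= t1 -> kap t <= 2 * (C * `|x t - p|) + eps ^+ 2.
  by move=> tI; have := height_le tI; rewrite /kap; lra.
have kk0 t : t0 <= t <= t1 -> kap t <= k0.
  move=> tI; have : C * `|x t - p| <= C * r by rewrite ler_pM2l// xp.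
  by have := kk t tI; rewrite rE /k0; lra.
have lk0 : lambda ^+ 2 <= k0 by rewrite /k0; lra.
have dQ t : t0 <= t <= t1 ->
    exists2 d, is_derive t 1 (fun s => kap s * dot (df (x s)) (a s)) d & q <= d.
  move=> tI; have [d d1 d2] := virial_convex tI (kk0 t tI) lk0 P1; exists d => //.
  by apply: le_trans d2; exact: convexity_margin c0 (enP t tI) om12 hk.
have [g1 g2] := second_order_growth c1 is_derive_virial dQ.
rewrite t1E addrAC subrr add0r -t1E in g1 g2.
have [_ [ft0 _ _]] := flow tI0; have [[_ _ _ sp1] [ft1 _ _]] := flow tI1.
have k5 : kap t0 <= 5 * C * eps.
  have e1 : C * `|x t0 - p| <= C * (2 * eps) by rewrite ler_pM2l.
  apply: le_trans (kk t0 tI0) _.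
  by lra.
have [sl1 fe] := virial_exit C1 A1 (introT andP (conj eps0 eps1)) qA (exprn_gt0 2 lambda0) Cle
  ft0 ft1 k5 (flow_slope_sqr flow tI0) g1 g2.
have bo : 0 <= b t1 ^+ 2 <= om.
  rewrite sqr_ge0/= (le_trans (flow_vertical flow tI1 eps0 fe))// ler_pdivrMr ?mulr_gt0//.
  rewrite (mulrC (lambda ^+ 2)) (le_trans Cll)// [leRHS]mulrC ler_pM2r// (le_trans e2e)//.
  by rewrite ler_peMl ?ler1n// ltW.
have sn := slope_near_normal tI1; rewrite -/P in sn.
have Nlo := normal_exit sg0 P4 (ltW sl1) sn.
have NN := normal_component sg0 G0 GC (enP t1 tI1) bo Nlo.
split=> //; last exact: slope_exit P4 om32 sn NN.
apply: norm_le_dot => //; apply: le_trans hometa.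
rewrite (tangential_pythagoras _ g0) mulrDr mulr1; apply: lerD.
  have -> : tangential g (a t1 - u) = tangential g (a t1) - tangential g u.
    by apply/rowP => i; rewrite /tangential !mxE dotBl; ring.
  by rewrite (le_trans (tanP _ tI1))// expr2 ler_piMl// ltW.
rewrite dotBl -/sg -[dot g g]/G.
have h1 : (dot (a t1) g - sg) ^+ 2 <= (8 * om * C / sg) ^+ 2.
  by rewrite -real_normK ?num_real// lerXn2r// nnegrE// (le_trans _ NN).
have h2 : (8 * om * C / sg) ^+ 2 = om * om * (64 * C ^+ 2 / sg ^+ 2) by field; rewrite gt_eqF.
have X0 : 0 <= 64 * C ^+ 2 / sg ^+ 2 by apply: divr_ge0; [apply: mulr_ge0 => //|]; exact: sqr_ge0.
rewrite ler_pdivrMr// (le_trans h1)// h2.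
have -> : om * (64 * C ^+ 2 / (sg ^+ 2 * c)) * G = om * (64 * C ^+ 2 / sg ^+ 2) * (G / c).
  by field; rewrite !gt_eqF.
rewrite -(mulrA om om) -(mulrA om _ (G / c)); apply: ler_wpM2l; first exact: ltW.
apply: (@le_trans _ _ (1 * (64 * C ^+ 2 / sg ^+ 2))); first by rewrite ler_wpM2r.
rewrite mulrC; apply: ler_wpM2l => //; rewrite ler_pdivlMr// mul1r.
by case/andP: GB.
Qed.

End near_collision.

(* The velocity at t0 is only required to agree with u up to a normal component. *)
Definition reflects (p u : 'rV[R]_n) (A eta eps lambda : R) :=
  forall x a b m (t0 theta : R), flow_on lambda x a b m t0 (t0 + A * eps) ->
  `|x t0 - p| <= 2 * eps -> `|a t0 - (u + theta *: df p)| <= eps ->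
  [/\ eps <= f (x (t0 + A * eps)), `|a (t0 + A * eps) - u| <= eta &
      dot u (df p) / 2 <= dot (df (x (t0 + A * eps))) (a (t0 + A * eps))].

(** A is fixed by the geometry and the normal energy of u, before eta; then om is chosen from eta,
    eps from om, and lambda from eps. *)
Lemma collision (p u : 'rV[R]_n) : oball p0 rho p -> f p = 0 -> dot u u = 1 ->
  0 < dot u (df p) ->
  exists2 A : R, 1 <= A & forall eta : R, 0 < eta ->
  \forall eps \near (0 : R)^'+, \forall lambda \near (0 : R)^'+, reflects p u A eta eps lambda.
Proof.
move=> pB fp u1 sg0; have [c0 C1 dfP _ _] := geom.
have /andP[cG GC] := dfP _ pB.
set sg := dot u (df p) in sg0 *; set G := dot (df p) (df p) in cG GC.
have C0 : 0 < C by exact: lt_le_trans C1.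
have G0 : 0 < G by exact: lt_le_trans cG.
pose s2 := sg ^+ 2 / G; have s20 : 0 < s2 by rewrite divr_gt0// exprn_gt0.
pose q := c * s2 / 2; have q0 : 0 < q by rewrite divr_gt0// mulr_gt0.
have C20 : 0 <= C ^+ 2 by exact: sqr_ge0.
(* The condition on q A comes from [virial_exit]; the summand 1 gives 1 <= A. *)
pose A := (10 * C ^+ 2 + 4) / q + 1.
have A1 : 1 <= A by rewrite lerDr divr_ge0 ?(ltW q0)//; lra.
have qA : 10 * C ^+ 2 + 4 <= q * A 
  by rewrite /A mulrDr mulr1 (mulrC q) mulfVK ?gt_eqF// lerDl ltW.
exists A => // eta eta0.
have [om [om0 om1] [om12 om32 omh]] : exists2 om : R, 0 < om /\ om <= 1 &
    [/\ 12 * om <= s2, 32 * C * om <= sg ^+ 2 &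
        om * (1 + 64 * C ^+ 2 / (sg ^+ 2 * c)) <= eta ^+ 2].
  near (0 : R)^'+ => om; exists om; split.
  - by near: om; exact: nbhs_right_gt.
  - by near: om; apply: nbhs_right_le.
  - by near: om; exact: near_mul_le.
  - by near: om; apply: near_mul_le; exact: exprn_gt0.
  - by rewrite mulrC; near: om; apply: near_mul_le; exact: exprn_gt0.
have sg20 : 0 < c * s2 / 4 by rewrite divr_gt0// mulr_gt0.
pose C5 := collision_const; pose C6 := C + C * (C / 2 + C / c).
near=> eps.
have eps0 : 0 < eps by near: eps; exact: nbhs_right_gt.
have eps1 : eps <= 1 by near: eps; exact: nbhs_right_le.
have h1 : A * eps <= 1 by near: eps; exact: near_mul_le.
have h2 : n%:R * C ^+ 2 * (2 + A) * eps <= c / 2.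
  by near: eps; apply: near_mul_le; exact: divr_gt0.
have h3 : (2 * (C5 * (2 + A)) + 2 * n%:R) * eps <= om ^+ 2.
  by near: eps; apply: near_mul_le; exact: exprn_gt0.
have h4 : n%:R * C * (2 + A) * eps <= 1 by near: eps; exact: near_mul_le.
have h5 : 4 * (n%:R * C * (2 + A)) * eps <= sg by near: eps; exact: near_mul_le.
have h6 : (2 * (n%:R * C * (2 + A)) + C6 * (2 * C * (2 + A) + C)) * eps <= c * s2 / 4.
  by near: eps; exact: near_mul_le.
near=> lambda => x a b m t0 theta flow x0 a0.
have l0 : 0 < lambda by near: lambda; exact: nbhs_right_gt.
have l1 : lambda <= 1 by near: lambda; exact: nbhs_right_le.
have lC : C * lambda <= eps * om by near: lambda; apply: near_mul_le; exact: mulr_gt0.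
have Ae0 : 0 <= A * eps by apply: mulr_ge0; [exact: le_trans A1|exact: ltW].
have t01 : t0 <= t0 + A * eps <= t0 + 1 by rewrite lerDl Ae0 lerD2l.
have xp t : t0 <= t <= t0 + A * eps -> `|x t - p| <= (2 + A) * eps.
  move=> /andP[tt0 tt1]; rewrite -(subrK (x t0) (x t)) -addrA (le_trans (ler_normD _ _))//.
  rewrite mulrDl [leRHS]addrC lerD// (le_trans (flow_displacement flow (lexx t0) tt0 tt1))//.
  by rewrite lerBlDl.
apply: (@collision_exit lambda x a b m t0 _ p ((2 + A) * eps) flow l0 t01 pB fp xp _ u theta eps om A) => //.
all: rewrite ?eps0 ?om0 ?(ltW eta0)//.
- by move: h2; rewrite !mulrA.
- apply: le_trans h3; rewrite le_eqVlt; apply/orP; left; apply/eqP; rewrite -/C5; ring.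
- by move: h4; rewrite !mulrA.
- by move: h5; rewrite !mulrA.
- apply: le_trans h6; rewrite le_eqVlt; apply/orP; left; apply/eqP; rewrite /C6; ring.
Unshelve. all: by end_near. Qed.

(** * Convergence to a broken line *)

Section drift.
Variables (lambda : R) (x a : R -> 'rV[R]_n) (b m : R -> R) (t0 t1 : R).
Hypothesis flow : flow_on lambda x a b m t0 t1.

Lemma flow_drift (y u : 'rV[R]_n) (al be : R) : t0 <= t1 <= t0 + 1 -> 0 <= be ->
  `|x t0 - y| <= al -> (forall t, t0 <= t <= t1 -> `|a t - u| <= be) ->
  `|x t1 - (y + (t1 - t0) *: u)| <= al + be.
Proof.
move=> /andP[t01 t10] be0 xy au.
have d (t : R) : t0 <= t <= t1 -> is_derive t 1 (fun s => x s - (s - t0) *: u) (a t - u).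
  move=> /flow[[_ dx _ _] _].
  have -> : (fun s => x s - (s - t0) *: u) = x - (fun s => (s - t0) *: u) by apply/funext.
  apply: is_deriveB => //; rewrite -[in X in is_derive _ _ _ X](scale1r u).
  apply/is_deriveP_eps => e1 e10; near=> h.
  rewrite (_ : _ - _ - _ = 0) ?normr0 ?mulr_ge0// ?(ltW e10)//.
  by apply/rowP => i; rewrite !mxE /GRing.scale/= mulr1; ring.
have := is_derive_row_lip t01 be0 d au.
rewrite subrr scale0r subr0 => h.
rewrite (_ : _ - _ = (x t0 - y) + (x t1 - (t1 - t0) *: u - x t0)); last first.
  by apply/rowP => i; rewrite !mxE; ring.
rewrite (le_trans (ler_normD _ _))// lerD// (le_trans h)// ler_piMr//; lra.
Unshelve. all: by end_near. Qed.

(** One be accounts for the initial velocity error, the other for the impulse of the force, which a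
    small lambda makes negligible once eps is fixed. *)
Lemma controlled_flight (eps al be : R) (y u : 'rV[R]_n) : 0 < lambda <= 1 ->
  t0 <= t1 <= t0 + 1 -> 0 < eps -> (forall t, t0 <= t <= t1 -> eps <= f (x t)) ->
  C * (eps^-1 + 1) / eps * C * lambda <= be -> `|x t0 - y| <= al -> `|a t0 - u| <= be ->
  `|a t1 - u| <= 2 * be /\ `|x t1 - (y + (t1 - t0) *: u)| <= al + 2 * be.
Proof.
move=> /andP[l0 l1] t01 eps0 ef kl xy au; have [c0 C1 _ _ _] := geom.
have C0 : 0 <= C by exact: le_trans C1.
have k0 : 0 <= C * (eps^-1 + 1) / eps * C.
  by rewrite !mulr_ge0 ?addr_ge0 ?invr_ge0// ltW.
have /andP[h1 h2] := t01.
have aP t : t0 <= t <= t1 -> `|a t - u| <= 2 * be.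
  move=> tI; rewrite -(subrK (a t0) (a t)) -addrA (le_trans (ler_normD _ _))//.
  have e1 := free_flight flow eps0 ef tI.
  have : lambda ^+ 2 * (C * (eps^-1 + 1) / eps) * C * (t - t0) <= be.
    apply: le_trans kl.
    rewrite [leLHS](_ : _ = C * (eps^-1 + 1) / eps * C * lambda * (lambda * (t - t0))); last by ring.
    rewrite ler_piMr//; first by rewrite mulr_ge0// ltW.
    case/andP: tI => h3 h4; rewrite -[leRHS](mulr1 1) ler_pM ?(ltW l0) ?subr_ge0//; lra.
  by lra.
have be0 : 0 <= be by exact: le_trans au.
split; first by apply: aP; rewrite lexx h1.
by apply: flow_drift => //; rewrite mulr_ge0.
Qed.

End drift.

Definition flight (gamma : R -> 'rV[R]_n) (u : 'rV[R]_n) (s t : R) :=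
  forall r : R, s <= r <= t -> gamma r = gamma s + (r - s) *: u.

Definition conv_thin (y : R -> 'rV[R]_n) (v : 'rV[R]_n) :=
  forall eta : R, 0 < eta -> \forall lambda \near (0 : R)^'+, `|y lambda - v| <= eta.

Lemma third_add (eta : R) : eta / 3 + 2 * (eta / 3) = eta.
Proof. by field. Qed.

Lemma third_le (eta : R) : 0 <= eta -> 2 * (eta / 3) <= eta.
Proof. by move=> eta0; rewrite -[leRHS]third_add lerDr divr_ge0. Qed.

(** * Propagation of convergence along a broken line *)

Section convergence.
Variables (T : R) (x a : R -> R -> 'rV[R]_n) (b m : R -> R -> R) (u0 : 'rV[R]_n)
  (gamma : R -> 'rV[R]_n).
Hypotheses (T0 : 0 < T) (T1 : T <= 1) (Trho : T < rho).
Hypothesis flows : forall lambda, 0 < lambda ->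
  [/\ flow_on lambda (x lambda) (a lambda) (b lambda) (m lambda) 0 T, x lambda 0 = p0 &
      a lambda 0 = tangential (df p0) u0].
Hypothesis gamma0 : gamma 0 = p0.
Hypothesis gamma_lip : forall s t, 0 <= s -> s <= t -> t <= T -> `|gamma t - gamma s| <= t - s.

Let gamma_oball t : 0 <= t <= T -> oball p0 rho (gamma t).
Proof.
move=> /andP[t0 tT]; rewrite /oball/= -gamma0 (le_lt_trans (gamma_lip (lexx 0) t0 tT))//.
by rewrite subr0 (le_lt_trans tT).
Qed.

Let sub_flow lambda s r : 0 < lambda -> 0 <= s -> r <= T ->
  flow_on lambda (x lambda) (a lambda) (b lambda) (m lambda) s r.
Proof. by move=> /flows[h _ _] s0 rT; exact: flow_on_sub h s0 rT. Qed.

(** The duration is short enough for the Lipschitz bound to keep f above half of [f (gamma s)] along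
    the geodesics, with room for the initial error. *)
Lemma conv_flight (s r : R) u : 0 <= s -> s <= r -> r <= T -> flight gamma u s r ->
  0 < f (gamma s) -> 4 * C * (r - s) <= f (gamma s) ->
  conv_thin (x^~ s) (gamma s) -> conv_thin (a^~ s) u ->
  conv_thin (x^~ r) (gamma r) /\ conv_thin (a^~ r) u.
Proof.
move=> s0 sr rT fl fs0 rs xs as_; have [c0 C1 _ _ lip] := geom.
have C0 : 0 < C by exact: lt_le_trans C1.
have sT := le_trans sr rT.
suff H eta : 0 < eta -> \forall lambda \near (0 : R)^'+,
    `|a lambda r - u| <= eta /\ `|x lambda r - gamma r| <= eta.
  by split=> eta /H; apply: filterS => lambda [].
move=> eta0; pose eps := f (gamma s) / 2.
have eps0 : 0 < eps by rewrite divr_gt0.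
near=> lambda.
have l0 : 0 < lambda by near: lambda; exact: nbhs_right_gt.
have l1 : lambda <= 1 by near: lambda; exact: nbhs_right_le.
have x1 : `|x lambda s - gamma s| <= eta / 3 by near: lambda; apply: xs; exact: divr_gt0.
have x2 : `|x lambda s - gamma s| <= f (gamma s) / (4 * C).
  by near: lambda; apply: xs; rewrite divr_gt0// mulr_gt0.
have a1 : `|a lambda s - u| <= eta / 3 by near: lambda; apply: as_; exact: divr_gt0.
have kl : C * (eps^-1 + 1) / eps * C * lambda <= eta / 3.
  by near: lambda; apply: near_mul_le; exact: divr_gt0.
have F := sub_flow l0 s0 rT.
have ef t : s <= t <= r -> eps <= f (x lambda t).
  move=> tI; have [[xB _ _ _] _] := F t tI; case/andP: tI => st tr.
  have gs : oball p0 rho (gamma s) by apply: gamma_oball; rewrite s0.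
  have [/ler_normlP[h _] _] := lip _ _ gs xB.
  have d1 := flow_displacement F (lexx s) st tr.
  have : C * `|x lambda t - gamma s| <= C * ((r - s) + f (gamma s) / (4 * C)).
    rewrite ler_pM2l// -(subrK (x lambda s) (x lambda t)) -addrA (le_trans (ler_normD _ _))//.
    by rewrite lerD// (le_trans d1)// lerB.
  rewrite mulrDr (_ : C * (f (gamma s) / (4 * C)) = f (gamma s) / 4); last by field; rewrite gt_eqF.
  by rewrite /eps; lra.
have l01 : 0 < lambda <= 1 by rewrite l0.
have sr1 : s <= r <= s + 1 by rewrite sr (le_trans rT)// (le_trans T1)// lerDr.
have [h1 h2] := controlled_flight F l01 sr1 eps0 ef kl x1 a1.
rewrite -fl ?sr ?lexx// third_add in h2.
by split=> //; exact: le_trans (third_le (ltW eta0)).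
Unshelve. all: by end_near. Qed.

(** The entry time t0 may depend on eps but not on lambda. The passage ends at t1 = t0 + A eps with
    slope at least half of <u, grad f>; the bound on r - tau is the condition of [escape] with beta
    a quarter of that product, so a free flight covers the rest up to r. *)
Lemma conv_bounce (tau r theta : R) u : 0 <= tau -> tau < r -> r <= T -> f (gamma tau) = 0 ->
  dot u u = 1 -> 0 < dot u (df (gamma tau)) -> flight gamma u tau r ->
  4 * (C + C / c * C) * (r - tau) <= dot u (df (gamma tau)) ->
  (\forall eps \near (0 : R)^'+, exists2 t0 : R, 0 <= t0 /\ tau - eps <= t0 <= tau &
    \forall lambda \near (0 : R)^'+, `|x lambda t0 - gamma tau| <= 2 * eps /\
      `|a lambda t0 - (u + theta *: df (gamma tau))| <= eps) ->
  conv_thin (x^~ r) (gamma r) /\ conv_thin (a^~ r) u.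
Proof.
move=> tau0 taur rT fg u1 sg0 fl rs H; have [c0 C1 _ _ _] := geom.
have C90 : 0 <= C + C / c * C.
  have C0 : 0 <= C by exact: le_trans C1.
  by apply: addr_ge0 => //; apply: mulr_ge0 => //; apply: divr_ge0 => //; exact: ltW.
have tauT := ltW (lt_le_trans taur rT).
have gB : oball p0 rho (gamma tau) by apply: gamma_oball; rewrite tau0.
have [A A1 coll] := collision gB fg u1 sg0.
suff K2 eta : 0 < eta -> \forall lambda \near (0 : R)^'+,
    `|a lambda r - u| <= eta /\ `|x lambda r - gamma r| <= eta.
  by split=> eta /K2; apply: filterS => lambda [].
move=> eta0; have e30 : 0 < eta / 3 by rewrite divr_gt0.
have {}coll := coll _ e30.
near (0 : R)^'+ => eps.
have eps0 : 0 < eps by near: eps; exact: nbhs_right_gt.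
have Aeps : A * eps <= r - tau by near: eps; apply: near_mul_le; rewrite subr_gt0.
have A2eps : (2 + 2 * A) * eps <= eta / 3 by near: eps; exact: near_mul_le.
have coll1 : \forall lambda \near (0 : R)^'+, reflects (gamma tau) u A (eta / 3) eps lambda.
  by near: eps.
have [t0 [t00 /andP[t0l t0r]] H1] : exists2 t0 : R, 0 <= t0 /\ tau - eps <= t0 <= tau &
    \forall lambda \near (0 : R)^'+, `|x lambda t0 - gamma tau| <= 2 * eps /\
      `|a lambda t0 - (u + theta *: df (gamma tau))| <= eps by near: eps.
have Aeps1 : eps <= A * eps by rewrite ler_peMl// ltW.
pose t1 := t0 + A * eps.
have t1r : t1 <= r by apply: (le_trans (lerD t0r Aeps)); rewrite addrC subrK.
have taut1 : tau <= t1 by rewrite -[tau](subrK eps) lerD.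
near=> lambda.
have l0 : 0 < lambda by near: lambda; exact: nbhs_right_gt.
have l1 : lambda <= 1 by near: lambda; exact: nbhs_right_le.
have kl : C * (eps^-1 + 1) / eps * C * lambda <= eta / 3 by near: lambda; exact: near_mul_le.
have [x1 a1] : `|x lambda t0 - gamma tau| <= 2 * eps /\
      `|a lambda t0 - (u + theta *: df (gamma tau))| <= eps by near: lambda.
have refl : reflects (gamma tau) u A (eta / 3) eps lambda by near: lambda.
have F0 : flow_on lambda (x lambda) (a lambda) (b lambda) (m lambda) t0 t1.
  by apply: sub_flow => //; exact: le_trans rT.
have [ft1 at1 sl1] := refl _ _ _ _ _ _ F0 x1 a1.
have t10 : 0 <= t1 by exact: le_trans taut1.
have F := sub_flow l0 t10 rT.
have ef t : t1 <= t <= r -> eps <= f (x lambda t).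
  apply: (escape F l0 (beta := dot u (df (gamma tau)) / 4)) => //.
  - by rewrite divr_gt0.
  - by rewrite (_ : 2 * _ = dot u (df (gamma tau)) / 2)//; field.
  - apply: (@le_trans _ _ ((C + C / c * C) * (r - tau))); first by rewrite ler_wpM2l// lerB.
    by rewrite ler_pdivlMr// mulrC mulrA.
have x2 : `|x lambda t1 - gamma t1| <= eta / 3.
  have d1 := flow_displacement F0 (lexx t0) (le_trans t0r taut1) (lexx t1).
  have d2 := gamma_lip tau0 taut1 (le_trans t1r rT).
  rewrite (_ : _ - _ = (x lambda t1 - x lambda t0) + (x lambda t0 - gamma tau) - (gamma t1 - gamma tau)).
    rewrite (le_trans (ler_normB _ _))// (le_trans (lerD (ler_normD _ _) (lexx _)))//.
    rewrite (le_trans (lerD (lerD d1 x1) d2))//; apply: le_trans A2eps.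
    by rewrite -subr_ge0 (_ : _ - _ = tau - t0) ?subr_ge0// /t1; ring.
  by apply/rowP => i; rewrite !mxE; ring.
have l01 : 0 < lambda <= 1 by rewrite l0.
have tr1 : t1 <= r <= t1 + 1 by rewrite t1r (le_trans rT)// (le_trans T1)// lerDr.
have [h1] := controlled_flight F l01 tr1 eps0 ef kl x2 at1.
rewrite (_ : gamma t1 + (r - t1) *: u = gamma r); last first.
  rewrite (fl t1) ?taut1 ?t1r// (fl r) ?(ltW taur) ?lexx//.
  by apply/rowP => i; rewrite !mxE; ring.
by rewrite third_add => h2; split=> //; exact: le_trans (third_le (ltW eta0)).
Unshelve. all: by end_near. Qed.

Definition backward_flight (v : 'rV[R]_n) (t d : R) :=
  forall s : R, 0 <= s -> t - d <= s <= t -> gamma s = gamma t + (s - t) *: v.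

Hypothesis fgamma0 : f (gamma 0) = 0.
Hypothesis fgamma : forall t, 0 <= t <= T -> 0 <= f (gamma t).
Hypothesis path : forall t, 0 <= t < T -> exists u d,
  [/\ 0 < d, dot u u = 1,
      forall s, t <= s <= t + d -> s <= T -> gamma s = gamma t + (s - t) *: u,
      0 < f (gamma t) -> backward_flight u t d &
      f (gamma t) = 0 -> [/\ 0 < dot u (df (gamma t)), t = 0 -> u = u0 &
        0 < t -> exists2 theta, backward_flight (u + theta *: df (gamma t)) t d &
          forall s, 0 <= s -> t - d <= s < t -> 0 < f (gamma s)]].

Lemma backward_flight_sub v (t d h : R) : 0 <= h -> h <= t -> h <= d ->
  backward_flight v t d -> backward_flight v (t - h) (d - h).
Proof.
move=> h0 ht hd fl s s0 /andP[sl sr].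
rewrite (fl (t - h)) ?subr_ge0//; last by apply/andP; split; lra.
rewrite (fl s)//; last by apply/andP; split; lra.
by apply/rowP => i; rewrite !mxE; ring.
Qed.

Lemma backward_flight_unique u v (t d d' : R) : 0 < t -> 0 < d -> 0 < d' ->
  backward_flight u t d -> backward_flight v t d' -> u = v.
Proof.
move=> t0 d0 d0' fu fv; pose h := Num.min t (Num.min d d').
have h0 : 0 < h by rewrite !lt_min t0 d0.
have ht : h <= t by rewrite ge_min lexx.
have hd : h <= d by rewrite !ge_min lexx orbT.
have hd' : h <= d' by rewrite !ge_min lexx !orbT.
have th : 0 <= t - h by rewrite subr_ge0.
have tht : t - h <= t by lra.
have eu := fu (t - h) th ltac:(by rewrite lerD2l lerN2 hd).
have ev := fv (t - h) th ltac:(by rewrite lerD2l lerN2 hd').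
have : (t - h - t) *: u = (t - h - t) *: v by apply: (addrI (gamma t)); rewrite -eu -ev.
by apply: scalerI; rewrite addrAC subrr add0r oppr_eq0 gt_eqF.
Qed.

Lemma forward_backward_flight u (t s d : R) : t <= s <= t + d -> s <= T ->
  (forall s, t <= s <= t + d -> s <= T -> gamma s = gamma t + (s - t) *: u) ->
  backward_flight u s (s - t).
Proof.
move=> /andP[ts sd] sT fl q q0 /andP[qs1 qs].
rewrite (fl s) ?ts// (fl q) ?(le_trans qs)//; last by apply/andP; split; lra.
by apply/rowP => i; rewrite !mxE; ring.
Qed.

(** At a bounce the velocities need not converge, so their convergence is asked only at interior
    times, and towards the direction of the flight arriving there. *)
Definition follows (t : R) := conv_thin (x^~ t) (gamma t) /\
  (0 < t -> 0 < f (gamma t) -> forall v (d : R), 0 < d -> backward_flight v t d ->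
   conv_thin (a^~ t) v).

Let follows0 : follows 0.
Proof.
split; last by rewrite ltxx.
move=> eta eta0; near=> lambda.
have l0 : 0 < lambda by near: lambda; exact: nbhs_right_gt.
by have [_ -> _] := flows l0; rewrite gamma0 subrr normr0 ltW.
Unshelve. all: by end_near. Qed.

Let lip_conv (s t : R) : 0 <= s -> s <= t -> t <= T -> conv_thin (x^~ s) (gamma s) ->
  forall eta : R, 0 < eta ->
  \forall lambda \near (0 : R)^'+, `|x lambda t - gamma t| <= eta + 2 * (t - s).
Proof.
move=> s0 st tT xs eta eta0; near=> lambda.
have l0 : 0 < lambda by near: lambda; exact: nbhs_right_gt.
have h1 : `|x lambda s - gamma s| <= eta by near: lambda; exact: xs.
have h2 := flow_displacement (sub_flow l0 s0 tT) (lexx s) st (lexx t).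
have h3 := gamma_lip s0 st tT.
rewrite (_ : _ - _ = (x lambda t - x lambda s) + (x lambda s - gamma s) - (gamma t - gamma s)).
  by rewrite (le_trans (ler_normB _ _))// (le_trans (lerD (ler_normD _ _) (lexx _)))//; lra.
by apply/rowP => i; rewrite !mxE; ring.
Unshelve. all: by end_near. Qed.

(** Positions converge at t by equicontinuity; velocities are carried over by one free flight on
    [t - h, t]. *)
Let follows_left (t : R) : 0 < t <= T -> (forall s, 0 <= s < t -> follows s) -> follows t.
Proof.
move=> /andP[t0 tT] IH; split=> [eta eta0|_ ft v d d0 bf].
  pose h := Num.min t (eta / 4).
  have h0 : 0 < h by rewrite lt_min t0 divr_gt0.
  have ht : h <= t by rewrite ge_min lexx.
  have he : h <= eta / 4 by rewrite ge_min lexx orbT.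
  have th : 0 <= t - h < t by rewrite subr_ge0 ht gtrBl.
  have [xs _] := IH _ th; case/andP: (th) => th0 /ltW th1.
  have := lip_conv th0 th1 tT xs (_ : 0 < eta / 2); rewrite divr_gt0// => /(_ isT).
  by apply: filterS => lambda /le_trans; apply; lra.
have [c0 C1 _ _ lip] := geom; have C0 : 0 < C by exact: lt_le_trans C1.
(* With 5 C h <= f (gamma t) the height at t - h is still at least 4 C h, as [conv_flight]
   demands. *)
pose h := Num.min (t / 2) (Num.min (d / 2) (f (gamma t) / (5 * C))).
have h0 : 0 < h by rewrite !lt_min !divr_gt0// mulr_gt0.
have ht : h <= t / 2 by rewrite ge_min lexx.
have hd : h <= d / 2 by rewrite !ge_min lexx orbT.
have hf : h <= f (gamma t) / (5 * C) by rewrite !ge_min lexx !orbT.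
rewrite ler_pdivlMr ?mulr_gt0// in hf.
have th0 : 0 < t - h by lra.
have tht : t - h <= t by lra.
have ht' : h <= t by lra.
have hd' : h <= d by lra.
have tht' : 0 <= t - h < t by rewrite ltW//= gtrBl.
have bs := backward_flight_sub (ltW h0) ht' hd' bf.
have [xs as_] := IH _ tht'.
have gt := gamma_lip (ltW th0) tht tT.
have [/ler_normlP[f1 f2] _] : `|f (gamma t) - f (gamma (t - h))| <= C * `|gamma t - gamma (t - h)| /\ True.
  split=> //; have [] // := lip (gamma (t - h)) (gamma t) (gamma_oball _) (gamma_oball _).
    by rewrite ltW//= (le_trans tht).
  by rewrite ltW.
have Ch : C * `|gamma t - gamma (t - h)| <= C * h by rewrite ler_pM2l// (le_trans gt)//; lra.
have fs : 4 * C * h <= f (gamma (t - h)) by lra.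
have fs0 : 0 < f (gamma (t - h)) by rewrite (lt_le_trans _ fs)// !mulr_gt0.
have fl : flight gamma v (t - h) t.
  move=> r /andP[r1 r2]; rewrite (bf r) ?(bf (t - h))//; first last.
  - by rewrite r2; lra.
  - by lra.
  - by apply/andP; split; lra.
  - by lra.
  by apply/rowP => i; rewrite !mxE; ring.
have dh : 0 < d - h by lra.
have fs' : 4 * C * (t - (t - h)) <= f (gamma (t - h)) by rewrite subKr.
by have [] := conv_flight (ltW th0) tht tT fl fs0 fs' xs (as_ th0 fs0 v (d - h) dh bs).
Qed.

(** The entry time is t - eps: the error eps of the geodesic there and the distance at most eps run
    by gamma add up to 2 eps. *)
Let bounce_entry (t theta d : R) (u : 'rV[R]_n) : 0 < t -> 0 < d -> t < T ->
  (forall s, 0 <= s <= t -> follows s) ->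
  backward_flight (u + theta *: df (gamma t)) t d ->
  (forall s, 0 <= s -> t - d <= s < t -> 0 < f (gamma s)) ->
  \forall eps \near (0 : R)^'+, exists2 t0 : R, 0 <= t0 /\ t - eps <= t0 <= t &
    \forall lambda \near (0 : R)^'+, `|x lambda t0 - gamma t| <= 2 * eps /\
      `|a lambda t0 - (u + theta *: df (gamma t))| <= eps.
Proof.
move=> t0 d0 tT IH bf fpos; near=> eps.
have eps0 : 0 < eps by near: eps; exact: nbhs_right_gt.
have epst : eps <= t / 2 by near: eps; apply: nbhs_right_le; exact: divr_gt0.
have epsd : eps <= d / 2 by near: eps; apply: nbhs_right_le; exact: divr_gt0.
have te0 : 0 < t - eps by lra.
have tet : t - eps <= t by lra.
exists (t - eps); first by rewrite lexx tet ltW.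
have epst' : eps <= t by lra.
have epsd' : eps <= d by lra.
have deps : 0 < d - eps by lra.
have [xs as_] := IH (t - eps) (introT andP (conj (ltW te0) tet)).
have fs : 0 < f (gamma (t - eps)) by apply: fpos; [exact: ltW|apply/andP; split; lra].
have bs := backward_flight_sub (ltW eps0) epst' epsd' bf.
have {}as_ := as_ te0 fs _ (d - eps) deps bs.
have gt := gamma_lip (ltW te0) tet (ltW tT).
near=> lambda; split; last by near: lambda; exact: as_.
have h1 : `|x lambda (t - eps) - gamma (t - eps)| <= eps by near: lambda; exact: xs.
rewrite -(subrK (gamma (t - eps)) (x lambda (t - eps))) -addrA (le_trans (ler_normD _ _))//.
by rewrite (distrC (gamma _)); lra.
Unshelve. all: by end_near. Qed.

Let follows_right (t : R) : 0 <= t < T -> (forall s, 0 <= s <= t -> follows s) ->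
  exists2 d : R, 0 < d & forall s : R, t <= s < t + d -> s <= T -> follows s.
Proof.
move=> tI IH; have /andP[t0 tT] := tI.
have [c0 C1 _ _ lip] := geom; have C0 : 0 < C by exact: lt_le_trans C1.
have [u [d [d0 u1 fwd inner bd]]] := path tI.
have Pt : follows t by apply: IH; rewrite t0 lexx.
(* Any direction of arrival at s > t is u, since the flight forward from t is also a flight arriving
   at s. *)
have conclude (h : R) : 0 < h -> h <= d ->
    (forall s, t < s < t + h -> s <= T -> conv_thin (x^~ s) (gamma s) /\ conv_thin (a^~ s) u) ->
    exists2 d : R, 0 < d & forall s : R, t <= s < t + d -> s <= T -> follows s.
  move=> h0 hd H; exists h => // s /andP[ts sh] sT.
  move: ts; rewrite le_eqVlt => /predU1P[<-//|ts].
  have [xs as_] := H s (introT andP (conj ts sh)) sT.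
  split=> // s0 fs v d' d0' bf.
  have tsd : t <= s <= t + d by rewrite ltW//= (le_trans (ltW sh))// lerD2l.
  have st0 : 0 < s - t by rewrite subr_gt0.
  by rewrite -(backward_flight_unique s0 st0 d0' (forward_backward_flight tsd sT fwd) bf).
have flu s : t < s < t + d -> s <= T -> flight gamma u t s.
  move=> /andP[ts sd] sT r /andP[tr rs]; apply: fwd; last exact: le_trans sT.
  by rewrite tr; lra.
have := fgamma (t := t); rewrite t0 (ltW tT) => /(_ isT); rewrite le_eqVlt => /predU1P[/esym ft|ft].
  have [sg0 tu tb] := bd ft.
  have C9 : 0 < C + C / c * C by rewrite addr_gt0// mulr_gt0// divr_gt0.
  pose h := Num.min d (dot u (df (gamma t)) / (4 * (C + C / c * C))).
  have h0 : 0 < h by rewrite lt_min d0 divr_gt0// mulr_gt0.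
  have hd : h <= d by rewrite ge_min lexx.
  have hs : h * (4 * (C + C / c * C)) <= dot u (df (gamma t)).
    by rewrite -ler_pdivlMr ?mulr_gt0// ge_min lexx orbT.
  have entry : exists theta, \forall eps \near (0 : R)^'+, exists2 t0 : R, 0 <= t0 /\ t - eps <= t0 <= t &
    \forall lambda \near (0 : R)^'+, `|x lambda t0 - gamma t| <= 2 * eps /\
      `|a lambda t0 - (u + theta *: df (gamma t))| <= eps.
    move: t0; rewrite le_eqVlt => /predU1P[t0|t0]; last first.
      by have [theta bf fpos] := tb t0; exists theta; exact: (bounce_entry t0 d0 tT IH bf fpos).
    (* At time 0 the velocity is u0 stripped of its normal part, hence of the form u + theta grad f:
       the start counts as a bounce. *)
    exists (- (dot u0 (df p0) / dot (df p0) (df p0))); near=> eps.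
    have eps0 : 0 < eps by near: eps; exact: nbhs_right_gt.
    exists 0; first by rewrite -t0 lexx sub0r oppr_le0 ltW.
    near=> lambda; have l0 : 0 < lambda by near: lambda; exact: nbhs_right_gt.
    have [_ -> ->] := flows l0; rewrite -t0 gamma0 tu// /tangential scaleNr !subrr normr0.
    by rewrite mulr_ge0// ltW.
  have [theta ent] := entry.
  apply: (conclude h) => // s /andP[ts sh] sT.
  have ths : t < s < t + d by rewrite ts (lt_le_trans sh)// lerD2l.
  apply: (conv_bounce t0 ts sT ft u1 sg0 (flu s ths sT) _ ent).
  have : (C + C / c * C) * (s - t) <= (C + C / c * C) * h by rewrite ler_pM2l//; lra.
  by lra.
have bf := inner ft.
have tgt0 : 0 < t.
  move: t0; rewrite le_eqVlt => /predU1P[t0|//].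
  by move: ft; rewrite -t0 gamma0; have := fgamma0; rewrite gamma0 => ->; rewrite ltxx.
have [xs as_] := Pt; have {}as_ := as_ tgt0 ft u d d0 bf.
pose h := Num.min d (f (gamma t) / (4 * C)).
have h0 : 0 < h by rewrite lt_min d0 divr_gt0// mulr_gt0.
have hd : h <= d by rewrite ge_min lexx.
have hs : h * (4 * C) <= f (gamma t) by rewrite -ler_pdivlMr ?mulr_gt0// ge_min lexx orbT.
apply: (conclude h) => // s /andP[ts sh] sT.
have ths : t < s < t + d by rewrite ts (lt_le_trans sh)// lerD2l.
apply: (conv_flight t0 (ltW ts) sT (flu s ths sT) ft) => //.
have : C * (s - t) <= C * h by rewrite ler_pM2l//; lra.
by lra.
Unshelve. all: by end_near. Qed.

Lemma geodesics_follow (t : R) : 0 <= t <= T -> conv_thin (x^~ t) (gamma t).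
Proof.
move=> tI; suff [] : follows t by [].
exact: (real_induction follows0 follows_right follows_left tI).
Qed.

End convergence.

End dynamics.

(** * Billiard trajectories are broken lines *)

Section straightness.
Context {R : realType} {n : nat}.
Implicit Types c : R -> 'rV[R]_n.

Lemma polygon_length_line (p w : 'rV[R]_n) (a0 a b : R) (s : seq R) : path <%R a s ->
  polygon_length (fun t => p + (t - a0) *: w) a b s = (last a s - a) * enorm w.
Proof.
elim: s a => [|x s IH] a /=; first by rewrite /polygon_length big_geq// subrr mul0r.
move=> /andP[ax /IH h]; rewrite /polygon_length big_nat_recl//=.
transitivity ((x - a) * enorm w + (last x s - x) * enorm w); last by ring.
congr (_ + _); last exact: h.
rewrite (_ : _ - _ = (x - a) *: w); last by apply/rowP => i; rewrite !mxE; ring.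
by rewrite enormZ ger0_norm// subr_ge0 ltW.
Qed.

Lemma curve_length_chord c (s t L : R) : s <= t -> curve_length c s t = L%:E ->
  enorm (c t - c s) <= L.
Proof.
rewrite le_eqVlt => /predU1P[<-|st] cl.
  have : ((polygon_length c s s [::])%:E <= curve_length c s s)%E.
    by apply: ereal_sup_ubound; exists [::].
  by rewrite cl lee_fin /polygon_length big_geq//= subrr /enorm dot0l sqrtr0.
have : ((polygon_length c s t [:: t])%:E <= curve_length c s t)%E.
  by apply: ereal_sup_ubound; exists [:: t] => //; exact: itv_partition1.
by rewrite cl lee_fin /polygon_length big_nat1.
Qed.

(** K contains the chord, so the minimizing curve is as long as its chord; each intermediate point
    then realises equality in the triangle inequality. *)
Lemma minimizing_straight (K : set 'rV[R]_n) c (l r : R) : segment_closed K -> l < r ->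
  (forall t, l <= t <= r -> K (c t)) ->
  (forall s t, l <= s -> s <= t -> t <= r -> curve_length c s t = (t - s)%:E) ->
  length_minimizing K c l r ->
  exists2 u, dot u u = 1 & forall t, l <= t <= r -> c t = c l + (t - l) *: u.
Proof.
move=> cK lr Kc cl min; pose w := (r - l)^-1 *: (c r - c l).
have rl : 0 < r - l by rewrite subr_gt0.
pose d (t : R) := c l + (t - l) *: w.
have dl : d l = c l by rewrite /d subrr scale0r addr0.
have dr : d r = c r by rewrite /d /w scalerA mulfV ?gt_eqF// scale1r addrC subrK.
have dK t : l <= t <= r -> K (d t).
  move=> /andP[lt tr]; rewrite /d /w scalerA; apply: cK.
  - by apply: Kc; rewrite lexx ltW.
  - by apply: Kc; rewrite lexx ltW.
  - by rewrite divr_ge0 ?subr_ge0 ?(ltW lr)// ler_pdivrMr// mul1r lerD2r.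
have dc : {within `[l, r], continuous d}.
  apply: continuous_subspaceT => t; apply: cvgD; first exact: cvg_cst.
  by apply: cvgZr_tmp; apply: cvgB; [exact: cvg_id|exact: cvg_cst].
have len : (curve_length d l r <= ((r - l) * enorm w)%:E)%E.
  apply: ub_ereal_sup => _ [s [ls /eqP lse] <-].
  by rewrite polygon_length_line// lse.
have chord : r - l <= enorm (c r - c l).
  have := le_trans (min d dc dK dl dr) len.
  by rewrite cl ?lexx ?(ltW lr)// lee_fin /w enormZ gtr0_norm ?invr_gt0// mulVKf ?gt_eqF.
have w1 : enorm w = 1.
  have := curve_length_chord (ltW lr) (cl _ _ (lexx l) (ltW lr) (lexx r)) => h.
  rewrite /w enormZ gtr0_norm ?invr_gt0//.
  have -> : enorm (c r - c l) = r - l by apply/eqP; rewrite eq_le h chord.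
  by rewrite mulVf// gt_eqF.
exists w; first exact/enorm_eq1.
move=> t /andP[lt tr].
have := @enorm_aligned _ _ (c t - c l) (c r - c t) (t - l) (r - t).
rewrite !subr_ge0 (curve_length_chord lt)//; last by rewrite cl// lexx.
rewrite (curve_length_chord tr)//; last by rewrite cl// lexx.
rewrite [X in enorm X](_ : _ = c r - c l); last by rewrite addrC addrA subrK.
rewrite (_ : t - l + (r - t) = r - l); last by ring.
move=> /(_ lt tr isT isT chord) h.
have : (r - l) *: (c t - c l) = (t - l) *: (c r - c l).
  transitivity ((r - t) *: (c t - c l) + (t - l) *: (c t - c l)).
    by apply/rowP => i; rewrite !mxE; ring.
  by rewrite h; apply/rowP => i; rewrite !mxE; ring.
move=> /(congr1 (fun v => (r - l)^-1 *: v)); rewrite !scalerA mulVf ?gt_eqF// scale1r => e.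
by rewrite -[LHS](subrK (c l)) e addrC (mulrC (t - l)).
Qed.

Definition locally_straight c (A : set R) (t : R) :=
  exists d u, [/\ 0 < d, dot u u = 1 & forall s : R, A s -> `|s - t| <= d ->
    c s = c t + (s - t) *: u].

Lemma trajectory_locally_straight (K : set 'rV[R]_n) (a b : R) c t : a < b ->
  segment_closed K -> billiard_trajectory K a b c -> a <= t <= b -> ~ boundary K (c t) ->
  locally_straight c `[a, b] t.
Proof.
move=> ab cK [Kc [[_ _ cl] [_ min _ _]]] tI nb.
have [|d d0 dmin] := min t tI; first by move=> [].
have /andP[at_ tb] := tI.
set l := Num.max _ _ in dmin; set r := Num.min _ _ in dmin.
have al : a <= l by rewrite le_max lexx.
have rb : r <= b by rewrite ge_min lexx.
have lt : l <= t by rewrite ge_max at_ gerBl ltW.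
have tr : t <= r by rewrite le_min tb lerDl ltW.
have lr : l < r.
  rewrite lt_min !gt_max ab; apply/andP; split; first by lra.
  by apply/andP; split; lra.
have [|s' t' h1 h2 h3|u u1 lin] := minimizing_straight cK lr _ _ dmin.
- by move=> s /andP[h1 h2]; apply: Kc; rewrite (le_trans al h1) (le_trans h2 rb).
- by apply: cl; [exact: le_trans h1|exact: h2|exact: le_trans rb].
exists d, u; split=> // s; rewrite /= in_itv/= => /andP[as_ sb].
rewrite ler_norml => /andP[h1 h2].
rewrite (lin s) ?(lin t) ?lt//; last first.
  by rewrite ge_max le_min as_ sb/=; apply/andP; split; lra.
by apply/rowP => i; rewrite !mxE; ring.
Qed.

Lemma affine_unique c u v (s t : R) : s != t -> c s = c t + (s - t) *: u ->
  c s = c t + (s - t) *: v -> u = v.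
Proof.
by move=> st -> /addrI; apply: scalerI; rewrite subr_eq0.
Qed.

(** Overlapping local pieces have the same direction, so real induction carries the initial
    direction to b. *)
Lemma straight_segment c (a b : R) : a < b ->
  (forall t, a <= t <= b -> locally_straight c `[a, b] t) ->
  exists2 u, dot u u = 1 & forall t, a <= t <= b -> c t = c a + (t - a) *: u.
Proof.
move=> ab H; have [|d0 [u [d00 u1 Hu]]] := H a; first by rewrite lexx ltW.
exists u => //.
suff P r : 0 <= r <= b - a -> c (a + r) = c a + r *: u.
  move=> t /andP[at_ tb]; have := P (t - a); rewrite subr_ge0 at_ lerD2r tb => /(_ isT).
  by rewrite addrC subrK.
have ain t : a <= t -> t <= b -> `[a, b]%classic t by move=> h1 h2; rewrite /= in_itv/= h1.
have step t d v : 0 < t <= b - a -> 0 < d ->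
    (forall s : R, `[a, b]%classic s -> `|s - (a + t)| <= d ->
       c s = c (a + t) + (s - (a + t)) *: v) ->
    (forall s, 0 <= s < t -> c (a + s) = c a + s *: u) ->
    v = u /\ c (a + t) = c a + t *: u.
  move=> /andP[t0 tb] dd0 Hv IH; pose h := Num.min t d.
  have h0 : 0 < h by rewrite lt_min t0.
  have ht : h <= t by rewrite ge_min lexx.
  have hd : h <= d by rewrite ge_min lexx orbT.
  (* The value at a + t is not known yet; two earlier points determine both it and the direction. *)
  have eqn k : 0 < k -> k <= h -> c (a + t) - k *: v = c a + (t - k) *: u.
    move=> k0 kh; rewrite -IH; last by rewrite subr_ge0 (le_trans kh)//= gtrBl.
    rewrite (Hv (a + (t - k))).
    - by apply/rowP => i; rewrite !mxE; ring.
    - by apply: ain; lra.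
    - rewrite (_ : _ - _ = - k); last by ring.
      by rewrite normrN gtr0_norm// (le_trans kh).
  have e1 := eqn h h0 (lexx h).
  have e2 := eqn (h / 2) ltac:(by rewrite divr_gt0) ltac:(lra).
  have vu : v = u.
    have : (h / 2) *: v = (h / 2) *: u.
      have -> : (h / 2) *: v = (c (a + t) - (h / 2) *: v) - (c (a + t) - h *: v).
        by apply/rowP => i; rewrite !mxE; field.
      by rewrite e1 e2; apply/rowP => i; rewrite !mxE; field.
    by apply: scalerI; rewrite mulf_neq0 ?gt_eqF// invr_gt0.
  split=> //; rewrite vu in e1.
  by rewrite -[LHS](subrK (h *: u)) e1; apply/rowP => i; rewrite !mxE; ring.
apply: (@real_induction R (b - a) (fun r => c (a + r) = c a + r *: u)) => [|t /andP[t0 tb] IH|t tI IH].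
- by rewrite addr0 scale0r addr0.
- move: t0; rewrite le_eqVlt => /predU1P[t0|t0].
    exists d0 => // s; rewrite -t0 add0r => /andP[s0 sd] sb.
    rewrite (Hu (a + s)); first by rewrite addrAC subrr add0r.
      by apply: ain; lra.
    by rewrite addrAC subrr add0r ger0_norm// ltW.
  have [|d [v [dd0 v1 Hv]]] := H (a + t); first by apply/andP; split; lra.
  have [|s /andP[s0 st]|vu ct] := step t d v _ dd0 Hv.
  - by rewrite t0 ltW.
  - by apply: IH; rewrite s0 ltW.
  exists d => // s /andP[ts sd] sb; rewrite (Hv (a + s)).
  - by rewrite ct vu; apply/rowP => i; rewrite !mxE; ring.
  - by apply: ain; lra.
  - rewrite (_ : _ - _ = s - t); last by ring.
    by rewrite ger0_norm; lra.
- have /andP[t0 tb] := tI.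
  have [|d [v [dd0 v1 Hv]]] := H (a + t); first by apply/andP; split; lra.
  by have [] := step t d v tI dd0 Hv IH.
Qed.

(** At t itself, a possible bounce, no straightness is assumed: the segments over [t + k, t + d]
    share one direction, and the Lipschitz bound closes the gap as k tends to 0. *)
Lemma straight_right c (t d L : R) : 0 < d ->
  (forall s, t < s <= t + d -> `|c s - c t| <= L * (s - t)) ->
  (forall s, t < s <= t + d -> locally_straight c `[t, t + d] s) ->
  exists2 u, dot u u = 1 & forall s, t <= s <= t + d -> c s = c t + (s - t) *: u.
Proof.
move=> d0 lip loc.
have seg (k : R) : 0 < k -> k <= d / 2 -> exists2 u, dot u u = 1 &
    forall s, t + k <= s <= t + d -> c s = c (t + k) + (s - (t + k)) *: u.
  move=> k0 kd; apply: straight_segment; first by lra.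
  move=> s /andP[ks sd]; have [|d1 [u [d10 u1 Hu]]] := loc s; first by apply/andP; split; lra.
  exists d1, u; split=> // r; rewrite /= in_itv/= => /andP[kr rd]; apply: Hu.
  by rewrite /= in_itv/=; apply/andP; split; lra.
have [u u1 Hu] := seg (d / 2) ltac:(by rewrite divr_gt0) (lexx _).
exists u => //.
have E s : t < s <= t + d -> c s = c (t + d) + (s - (t + d)) *: u.
  move=> /andP[ts sd]; pose k := Num.min (s - t) (d / 2).
  have k0 : 0 < k by rewrite lt_min subr_gt0 ts divr_gt0.
  have ks : k <= s - t by rewrite ge_min lexx.
  have kd : k <= d / 2 by rewrite ge_min lexx orbT.
  have [v v1 Hv] := seg k k0 kd.
  have vu : v = u.
    apply: (@affine_unique c v u (t + d) (t + d / 2)).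
    - by rewrite gt_eqF//; lra.
    - rewrite (Hv (t + d)) ?(Hv (t + d / 2)).
      + by apply/rowP => i; rewrite !mxE; ring.
      + by apply/andP; split; lra.
      + by apply/andP; split; lra.
    - by apply: Hu; apply/andP; split; lra.
  rewrite (Hv s) ?(Hv (t + d)) ?vu.
  - by apply/rowP => i; rewrite !mxE; ring.
  - by apply/andP; split; lra.
  - by apply/andP; split; lra.
have ct : c t = c (t + d) - d *: u.
  apply/eqP; rewrite -subr_eq0 -normr_le0; apply/ler_addgt0Pr => e e0; rewrite add0r.
  near (0 : R)^'+ => h.
  have h0 : 0 < h by near: h; exact: nbhs_right_gt.
  have hd : h <= d by near: h; exact: nbhs_right_le.
  have he : (L + `|u|) * h <= e by near: h; exact: near_mul_le.
  have tI : t < t + h <= t + d by rewrite ltrDl h0 lerD2l.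
  have := lip _ tI; have := E _ tI; rewrite (_ : t + h - t = h); last by ring.
  move=> -> h1.
  rewrite (_ : _ - _ = h *: u - (c (t + d) + (t + h - (t + d)) *: u - c t)); last first.
    by apply/rowP => i; rewrite !mxE; ring.
  rewrite (le_trans (ler_normB _ _))// normrZ gtr0_norm//; lra.
move=> s /andP[]; rewrite le_eqVlt => /predU1P[<- _|ts sd].
  by rewrite subrr scale0r addr0.
by rewrite E ?ts// ct; apply/rowP => i; rewrite !mxE; ring.
Unshelve. all: by end_near. Qed.

Lemma straight_left c (t d L : R) : 0 < d ->
  (forall s, t - d <= s < t -> `|c s - c t| <= L * (t - s)) ->
  (forall s, t - d <= s < t -> locally_straight c `[t - d, t] s) ->
  exists2 u, dot u u = 1 & forall s, t - d <= s <= t -> c s = c t + (s - t) *: u.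
Proof.
move=> d0 lip loc; pose cr (s : R) := c (- s).
have flip s : - t < s <= - t + d -> t - d <= - s < t.
  by move=> /andP[h1 h2]; apply/andP; split; lra.
have [s sI|s sI|u u1 Hu] := @straight_right cr (- t) d L d0.
- by rewrite /cr opprK (le_trans (lip _ (flip _ sI)))// !opprK addrC.
- have [d1 [u [d10 u1 Hu]]] := loc _ (flip _ sI).
  exists d1, (- u); split=> //; first by rewrite dotNl dotNr opprK.
  move=> r; rewrite /= in_itv/= => /andP[r1 r2] rs.
  rewrite /cr (Hu (- r)); last 2 first.
  + by rewrite /= in_itv/=; apply/andP; split; lra.
  + by rewrite -opprD normrN.
  by apply/rowP => i; rewrite !mxE; ring.
exists (- u); first by rewrite dotNl dotNr opprK.
move=> s /andP[s1 s2]; have := Hu (- s); rewrite /cr !opprK => ->.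
  by apply/rowP => i; rewrite !mxE; ring.
by apply/andP; split; lra.
Qed.

Lemma finite_isolated (S : set R) (t : R) : finite_set S ->
  exists2 d : R, 0 < d & forall s, S s -> s != t -> d < `|s - t|.
Proof.
move=> /finite_seqP[l ->]; elim: l => [|x l [d d0 IH]]; first by exists 1.
have [xt|xt] := eqVneq x t.
  exists d => // s; rewrite /= in_cons => /predU1P[->|]; first by rewrite xt eqxx.
  exact: IH.
have h0 : 0 < `|x - t| by rewrite normr_gt0 subr_eq0.
exists (Num.min d (`|x - t| / 2)); first by rewrite lt_min d0 divr_gt0.
move=> s; rewrite /= in_cons gt_min => /predU1P[-> _|sl st].
  by rewrite [X in _ || X](_ : _ = true) ?orbT//; lra.
by rewrite IH.
Qed.

End straightness.

(** * Velocities before and after a bounce *)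

Section bounces.
Context {R : realType} {n : nat}.
Implicit Types (c : R -> 'rV[R]_n) (f : 'rV[R]_n -> R) (df : 'rV[R]_n -> 'rV[R]_n).

(** u is the velocity after t and v the one before. Ordinary times and bounces are covered at once,
    in a form stable under time reversal, which suits an induction on time rather than on
    bounces. *)
Definition bounces_at f df c (t : R) := exists u v d,
  [/\ 0 < d, dot u u = 1, dot v v = 1,
      forall s, t <= s <= t + d -> c s = c t + (s - t) *: u &
      forall s, t - d <= s <= t -> c s = c t + (s - t) *: v] /\
  [/\ 0 < f (c t) -> v = u,
      f (c t) = 0 -> [/\ 0 < dot u (df (c t)), dot v (df (c t)) < 0 &
        exists theta, v = u + theta *: df (c t)] &
      forall s, 0 < `|s - t| <= d -> 0 < f (c s)].

Lemma bounces_at_reverse f df c (t : R) : bounces_at f df c (- t) ->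
  bounces_at f df (fun s => c (- s)) t.
Proof.
move=> [u [v [d [[d0 u1 v1 fw bw] [inn bd pos]]]]].
exists (- v), (- u), d; split; split=> //.
- by rewrite dotNl dotNr opprK.
- by rewrite dotNl dotNr opprK.
- move=> s /andP[s1 s2]; rewrite bw; last by rewrite -opprD !lerN2 s2.
  by apply/rowP => i; rewrite !mxE; ring.
- move=> s /andP[s1 s2]; rewrite fw; last by apply/andP; split; lra.
  by apply/rowP => i; rewrite !mxE; ring.
- by move=> /inn ->.
- move=> /bd[h1 h2 [th h3]]; split; [|by rewrite dotNl oppr_lt0|].
    by rewrite dotNl oppr_gt0.
  by exists th; rewrite h3; apply/rowP => i; rewrite !mxE; ring.
- by move=> s h; apply: pos; rewrite -opprD normrN.
Qed.

Lemma cplus_forward c u (t d : R) : 0 < d ->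
  (forall s, t <= s <= t + d -> c s = c t + (s - t) *: u) -> cplus c t = u.
Proof.
move=> d0 fw; apply: cvg_lim => //; apply: cvg_near_cst; near=> h.
have h0 : 0 < h by near: h; exact: nbhs_right_gt.
have hd : h <= d by near: h; exact: nbhs_right_le.
rewrite /diff_quotient fw; last by rewrite lerDl (ltW h0) lerD2l.
rewrite (addrC (c t)) addrK (addrC t) addrK scalerA mulVf ?gt_eqF// scale1r.
Unshelve. all: by end_near. Qed.

Lemma cminus_backward c v (t d : R) : 0 < d ->
  (forall s, t - d <= s <= t -> c s = c t + (s - t) *: v) -> cminus c t = - v.
Proof.
move=> d0 bw; congr (- _); apply: cvg_lim => //; apply: cvg_near_cst; near=> h.
have h0 : h < 0 by near: h; exact: nbhs_left_lt.
have hd : - d <= h by near: h; apply: nbhs_left_ge; rewrite oppr_lt0.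
rewrite /diff_quotient bw; last by rewrite lerD2l hd gerDl (ltW h0).
rewrite (addrC (c t)) addrK (addrC t) addrK scalerA mulVf ?lt_eqF// scale1r.
Unshelve. all: by end_near. Qed.

Lemma straight_velocities_agree c u v w (t a b d d' : R) : 0 < d -> 0 < d' ->
  a <= t - d -> t + d <= b ->
  (forall s, t <= s <= t + d -> c s = c t + (s - t) *: u) ->
  (forall s, t - d <= s <= t -> c s = c t + (s - t) *: v) ->
  (forall s, `[a, b]%classic s -> `|s - t| <= d' -> c s = c t + (s - t) *: w) -> v = u.
Proof.
move=> d0 d0' al bl fw bw H; pose h := Num.min d d'.
have h0 : 0 < h by rewrite lt_min d0.
have hd : h <= d by rewrite ge_min lexx.
have hd' : h <= d' by rewrite ge_min lexx orbT.
have -> : v = w.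
  apply: (@affine_unique _ _ c v w (t - h) t); first by rewrite lt_eqF//; lra.
    by apply: bw; apply/andP; split; lra.
  apply: H; first by rewrite /= in_itv/=; apply/andP; split; lra.
  by rewrite addrAC subrr add0r normrN gtr0_norm.
apply: (@affine_unique _ _ c w u (t + h) t); first by rewrite gt_eqF//; lra.
  apply: H; first by rewrite /= in_itv/=; apply/andP; split; lra.
  by rewrite addrAC subrr add0r gtr0_norm.
by apply: fw; apply/andP; split; lra.
Qed.

Lemma trajectory_lip (K : set 'rV[R]_n) (a b : R) c : billiard_trajectory K a b c ->
  forall s t, a <= s -> s <= t -> t <= b -> `|c t - c s| <= t - s.
Proof.
move=> [_ [[_ _ cl] _]] s t as_ st tb; apply: norm_le_dot; first by rewrite subr_ge0.
by rewrite -enorm_le ?subr_ge0// curve_length_chord// cl.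
Qed.

(** The bounce times are finite in number, hence isolated, so the curve is straight on both sides of
    t; [cplus] and [cminus] are then u and - v, and the reflection law makes v - u normal to the
    boundary. *)
Lemma trajectory_bounces (K : set 'rV[R]_n) p0 f df d2f e (rho T : R) c : closed K ->
  segment_closed K ->
  (forall q, K q -> forall r : R, 0 < r -> exists2 q', K° q' & `|q' - q| < r) -> K p0 ->
  good_defining K p0 f df d2f e rho -> 0 < T -> T < rho / 2 ->
  billiard_trajectory K (- T) T c -> c 0 = p0 ->
  forall t, - T < t < T -> bounces_at f df c t.
Proof.
move=> clK cK near_int Kp0 good T0 Trho traj c0 t /andP[Tt tT].
have lip := trajectory_lip traj.
have TT : - T < T by lra.
have [[rho0 fK fbd dfe] _] := good.
have half s : - T <= s <= T -> oball p0 (rho / 2) (c s).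
  move=> /andP[s1 s2]; rewrite /oball/= -c0.
  have [s0|s0] := leP 0 s.
    by have := lip 0 s ltac:(by rewrite oppr_le0 ltW) s0 s2; lra.
  by have := lip s 0 s1 (ltW s0) (ltW T0); rewrite distrC; lra.
have ball s : - T <= s <= T -> oball p0 rho (c s).
  by move=> /half /lt_trans; apply; lra.
have [Kc [_ [fin _ refl trans]]] := traj.
have fpos s : - T <= s <= T -> ~ boundary K (c s) -> 0 < f (c s).
  move=> sI nb; rewrite lt_neqAle (fK _ (ball s sI)).2 ?andbT; last exact: Kc.
  by apply/negP => /eqP h; apply: nb; apply/(fbd _ (ball s sI)).
have [d1 d10 iso] := finite_isolated t fin.
pose d := Num.min d1 (Num.min (t + T) (T - t)).
have d0 : 0 < d by rewrite !lt_min d10; apply/andP; split; lra.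
have dd1 : d <= d1 by rewrite ge_min lexx.
have dl : d <= t + T by rewrite !ge_min lexx orbT.
have dr : d <= T - t by rewrite !ge_min lexx !orbT.
have dI s : `|s - t| <= d -> - T <= s <= T.
  by rewrite ler_norml => /andP[h1 h2]; apply/andP; split; lra.
have nobd s : 0 < `|s - t| <= d -> ~ boundary K (c s).
  move=> /andP[s0 sd] bs; have : d1 < `|s - t|.
    by apply: iso; [split=> //; exact: dI|rewrite -subr_eq0 -normr_gt0].
  by rewrite ltNge (le_trans sd).
have loc s A : 0 < `|s - t| <= d -> A `<=` `[- T, T]%classic -> locally_straight c A s.
  move=> sd AT; have [d2 [u [d20 u1 H]]] := trajectory_locally_straight TT cK traj
     (dI s ltac:(by case/andP: sd)) (nobd s sd).
  by exists d2, u; split=> // r /AT; exact: H.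
have [s sI|s sI|u u1 fw] := @straight_right _ _ c t d 1 d0.
- by rewrite mul1r; case/andP: sI => s1 s2; apply: lip; lra.
- apply: loc; first by case/andP: sI => s1 s2; rewrite gtr0_norm ?subr_gt0// s1 lerBlDl.
  by move=> r; rewrite /= !in_itv/= => /andP[h1 h2]; apply/andP; split; lra.
have [s sI|s sI|v v1 bw] := @straight_left _ _ c t d 1 d0.
- by rewrite mul1r distrC; case/andP: sI => s1 s2; apply: lip; lra.
- apply: loc.
    by case/andP: sI => s1 s2; rewrite distrC gtr0_norm subr_gt0// s2 lerBlDr -lerBlDl.
  by move=> r; rewrite /= !in_itv/= => /andP[h1 h2]; apply/andP; split; lra.
exists u, v, d; split; split=> //.
- move=> ft; have nb : ~ boundary K (c t).
    by move=> /(fbd _ (ball t ltac:(by rewrite !ltW))) h; rewrite h ltxx in ft.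
  have [d2 [w [d20 w1 H]]] := trajectory_locally_straight TT cK traj
     (introT andP (conj (ltW Tt) (ltW tT))) nb.
  have al : - T <= t - d by rewrite lerBrDr addrC -lerBrDr opprK.
  have bl : t + d <= T by rewrite addrC -lerBrDr.
  exact: (straight_velocities_agree d0 d20 al bl fw bw H).
- move=> ft; have tI : - T <= t <= T by rewrite !ltW.
  have bt : boundary K (c t) by apply/(fbd _ (ball t tI)).
  have dn := defining_near_good clK cK (near_int _ Kp0) good (half t tI).
  have [tanP coneP] := good_defining_tangent clK cK near_int Kp0 good (half t tI) bt.
  have g0 : df (c t) != 0.
    apply/negP => /eqP h.
    by have := dfe _ (ball t tI); rewrite h dot0l => /esym/eqP; rewrite oner_eq0.
  have tI' : - T < t < T by rewrite Tt.
  have bt' : bounce_times K (- T) T c t by [].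
  have := refl t tI' bt'; have [] := trans t tI' bt'.
  rewrite (cplus_forward d0 fw) (cminus_backward d0 bw) => nu nv pol.
  have [|_ _ h1 h2 [k uv]] := polar_reflection g0 tanP coneP _ pol nu nv.
    by exists ((enorm (df (c t)))^-1 *: df (c t)), (good_nbhd p0 (rho / 2)), f, df.
  split=> //; first by rewrite -oppr_gt0 -dotNl.
  exists (- k); rewrite scaleNr -uv; by apply/rowP => i; rewrite !mxE; ring.
- by move=> s sd; apply: fpos; [apply: dI; case/andP: sd|exact: nobd].
Qed.

End bounces.

(** * Geodesic segments and uniform convergence *)

Section limits.
Context {R : realType}.

Lemma near_at_right_sequence (P : R -> Prop) (h : nat -> R) : (forall k, 0 < h k) ->
  h k @[k --> \oo] --> (0 : R) -> (\forall l \near (0 : R)^'+, P l) ->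
  \forall k \near \oo, P (h k).
Proof.
move=> h0 hc PP.
have : \forall k \near \oo, 0 < h k -> P (h k) by exact: hc _ PP.
by apply: filterS => k; apply; exact: h0.
Qed.

(** Real induction on the length of the interval takes the place of a finite net. The factor 3
    counts two Lipschitz moves over a distance eta and the error at the base point. *)
Lemma lipschitz_pointwise_uniform m (y : nat -> R -> 'rV[R]_m) (g : R -> 'rV[R]_m) (a b : R) :
  a <= b ->
  (forall k s t, a <= s -> s <= t -> t <= b -> `|y k t - y k s| <= t - s) ->
  (forall s t, a <= s -> s <= t -> t <= b -> `|g t - g s| <= t - s) ->
  (forall t, a <= t <= b -> forall eta : R, 0 < eta ->
     \forall k \near \oo, `|y k t - g t| <= eta) ->
  {uniform `[a, b], y @ \oo --> g}.
Proof.
move=> ab ylip glip pw P /uniform_nbhs[E [+ EP]].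
rewrite -entourage_ballE => -[eps /= eps0 epsE].
pose eta := eps / 4; have eta0 : 0 < eta by rewrite divr_gt0.
have close k s t : a <= s -> s <= t -> t <= b -> t - s <= eta -> `|y k s - g s| <= eta ->
    `|y k t - g t| <= 3 * eta.
  move=> as_ st tb ts h; have h1 := ylip k _ _ as_ st tb; have h2 := glip _ _ as_ st tb.
  rewrite (_ : _ - _ = (y k t - y k s) + (y k s - g s) - (g t - g s)).
    by rewrite (le_trans (ler_normB _ _))// (le_trans (lerD (ler_normD _ _) (lexx _)))//; lra.
  by apply/rowP => i; rewrite !mxE; ring.
have Q : \forall k \near \oo, forall s : R, a <= s <= a + (b - a) -> `|y k s - g s| <= 3 * eta.
  apply: (@real_induction R (b - a) (fun r => \forall k \near \oo,
    forall s : R, a <= s <= a + r -> `|y k s - g s| <= 3 * eta)) => [|t /andP[t0 tb] IH|t /andP[t0 tb] IH|].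
  - have := pw a ltac:(by rewrite lexx) eta eta0; apply: filterS => k h s.
    rewrite addr0 -eq_le => /eqP <-; apply: (close k a a) => //.
    by rewrite subrr ltW.
  - have Pt := IH t ltac:(by rewrite t0 lexx).
    exists eta => // r /andP[tr rt] rb.
    have tI : a <= a + t <= b by apply/andP; split; lra.
    apply: filterS2 Pt (pw _ tI eta eta0) => k h1 h2 s /andP[s1 s2].
    have [st|st] := leP s (a + t); first by apply: h1; rewrite s1.
    by apply: (close k (a + t)) => //; lra.
  - pose s0 := Num.max 0 (t - eta).
    have s00 : 0 <= s0 by rewrite le_max lexx.
    have s0t : s0 < t by rewrite gt_max t0 gtrBl.
    have st : t - eta <= s0 by rewrite le_max lexx orbT.
    have Ps := IH s0 ltac:(by rewrite s00).
    have sI : a <= a + s0 <= b by apply/andP; split; lra.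
    apply: filterS2 Ps (pw _ sI eta eta0) => k h1 h2 s /andP[s1 s2].
    have [ss|ss] := leP s (a + s0); first by apply: h1; rewrite s1.
    by apply: (close k (a + s0)) => //; lra.
  - by rewrite subr_ge0 ab lexx.
apply: filterS Q => k Hk; apply: EP => t; rewrite /= in_itv/= => tI.
apply: epsE; rewrite /= -ball_normE/= distrC (le_lt_trans (Hk t _))//.
  by rewrite addrC subrK.
by rewrite /eta; lra.
Qed.

End limits.

(** * Solutions as geodesic segments of M_lambda *)

Section approximation.
Context {R : realType} {n : nat}.

Lemma is_derive_pt (x dx : R -> 'rV[R]_n) (z dz : R -> R) (t : R) :
  is_derive t 1 x (dx t) -> is_derive t 1 z (dz t) ->
  is_derive t 1 (fun s => pt (x s) (z s)) (pt (dx t) (dz t)).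
Proof.
move=> Hx Hz; apply/is_derive_row => i; case: (split_ordP i) => j ->.
  rewrite ptEl (_ : (fun _ => _) = (fun s => x s 0 j)); last by apply/funext => s; rewrite ptEl.
  exact: (is_derive_row _ _ _).1.
rewrite ptEr (_ : (fun _ => _) = z)//; by apply/funext => s; rewrite ptEr.
Qed.

Variables (K : set 'rV[R]_n) (p0 : 'rV[R]_n) (f : 'rV[R]_n -> R)
  (df : 'rV[R]_n -> 'rV[R]_n) (d2f : 'rV[R]_n -> 'M[R]_n) (e : 'rV[R]_n) (rho : R).
Hypothesis good : good_defining K p0 f df d2f e rho.

(** Differentiating the constraint along a curve in M_lambda: tangent vectors are orthogonal to
    (lambda^2 grad f, - 2 z), of which the acceleration of a solution is a multiple. *)
Lemma tangent_Mlambda U lambda (x vx : 'rV[R]_n) (z vz : R) : oball p0 rho x ->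
  tangent_vector (Mlambda K U f lambda) (pt x z) (pt vx vz) ->
  2 * (z * vz) = lambda ^+ 2 * dot (df x) vx.
Proof.
move=> xB [c [cM c0 dc]].
pose y (s : R) : 'rV[R]_n := \row_j c s 0 (lshift 1 j).
pose w (s : R) : R := c s 0 (rshift n 0).
have y0 : y 0 = x by apply/rowP => j; rewrite mxE c0 ptEl.
have w0 : w 0 = z by rewrite /w c0 ptEr.
have dy : is_derive (0 : R) 1 y vx.
  apply/is_derive_row => j; rewrite (_ : (fun _ => _) = (fun s => c s 0 (lshift 1 j))).
    by rewrite -(ptEl vx vz j); exact: (is_derive_row _ _ _).1.
  by apply/funext => s; rewrite mxE.
have dw : is_derive (0 : R) 1 w vz.
  by rewrite -(ptEr vx vz 0); exact: (is_derive_row _ _ _).1.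
have dfy : is_derive (0 : R) 1 (fun s => f (y s)) (dot (df x) vx).
  by rewrite -y0; apply: (is_derive_along good) => //; rewrite y0.
have d1 : is_derive (0 : R) 1 (w * w - lambda ^+ 2 \*: (fun s => f (y s)))
    (2 * (z * vz) - lambda ^+ 2 * dot (df x) vx).
  by apply: is_derive_eq; rewrite /GRing.scale/= w0; ring.
have d2 : is_derive (0 : R) 1 (w * w - lambda ^+ 2 \*: (fun s => f (y s))) 0.
  apply: near_eq_is_derive (is_derive_cst (0 : R) (0 : R) (1 : R)).
  apply: filterS cM => s [y' [w' [cs _ _ zz]]].
  rewrite -[RHS]/(w s * w s - lambda ^+ 2 * f (y s)).
  have -> : y s = y' by apply/rowP => j; rewrite mxE cs ptEl.
  have -> : w s = w' by rewrite /w cs ptEr.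
  by rewrite -expr2 zz subrr.
apply/eqP; rewrite -subr_eq0; apply/eqP.
by rewrite -(@derive_val _ _ _ _ _ _ _ d1) (@derive_val _ _ _ _ _ _ _ d2).
Qed.

Lemma geodesic_segment lambda (T : R) x z a b : 0 < lambda -> 0 < T -> T < rho / 2 ->
  (forall t : R, `|t| <= T -> geodesic_at p0 f df d2f lambda x z a b t) ->
  unit_geodesic_segment (Mlambda K (good_nbhd p0 (rho / 2)) f lambda) (- T) T
    (fun t => pt (x t) (z t)).
Proof.
move=> l0 T0 Trho G; have [[rho0 fK _ _] _] := good.
pose k (t : R) := kappa df d2f lambda (x t) (z t) (a t) (b t).
have GT t : - T <= t <= T -> geodesic_at p0 f df d2f lambda x z a b t.
  by rewrite -ler_norml; exact: G.
have half t : - T <= t <= T -> oball p0 (rho / 2) (x t).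
  move=> tI; have [[h _ _ _] _] := GT t tI; rewrite /oball/= (le_lt_trans h)//.
  by rewrite (le_lt_trans _ Trho)// ler_norml.
have ball t : - T <= t <= T -> oball p0 rho (x t).
  by move=> /half h; apply: (lt_trans h); lra.
have dc t : - T <= t <= T -> is_derive t 1 (fun t => pt (x t) (z t)) (pt (a t) (b t)).
  by move=> /GT[_ [dx dz _ _]]; exact: is_derive_pt.
have d2c t : - T <= t <= T -> is_derive t 1 (fun t => pt (a t) (b t))
    (pt ((k t * lambda ^+ 2) *: df (x t)) (- (2 * k t * z t))).
  move=> /GT[_ [_ _ da db]].
  exact: (is_derive_pt (dx := fun t => (k t * lambda ^+ 2) *: df (x t))
    (dz := fun t => - (2 * k t * z t))).
split.
- move=> t tI; exists (x t), (z t); have [[_ _ zz _] _] := GT t tI; split=> //.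
  + apply/(fK _ (ball t tI)).
    by rewrite -(pmulr_rge0 _ (exprn_gt0 2 l0)) -zz sqr_ge0.
  + exact/good_nbhd_emb/half.
- exact: is_derive1_within dc.
- move=> t tI; have tI' : - T <= t <= T by case/andP: tI => h1 h2; rewrite !ltW.
  (* The first derivative is identified on a neighbourhood so that it can be differentiated
     again. *)
  have dcE : \forall s \near t, derive1 (fun t => pt (x t) (z t)) s = pt (a s) (b s).
    have : \forall s \near t, - T < s < T.
      have := near_in_itvoo (a := - T) (b := T) (x := t).
      by rewrite in_itv/= => /(_ tI); apply: filterS => s; rewrite in_itv.
    apply: filterS => s /andP[h1 h2].
    by rewrite derive1E; apply: derive_val; apply: dc; rewrite !ltW.
  have dd : is_derive t 1 (derive1 (fun t => pt (x t) (z t)))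
      (pt ((k t * lambda ^+ 2) *: df (x t)) (- (2 * k t * z t))).
    apply: (near_eq_is_derive _ (d2c t tI')).
    by apply: filterS dcE => s ->.
  have [[_ sp zz zb] _] := GT t tI'.
  have ct : derive1 (fun t => pt (x t) (z t)) t = pt (a t) (b t) by exact: nbhs_singleton dcE.
  split.
  + by case: (dc t tI').
  + by case: dd.
  + by rewrite ct; apply/enorm_eq1; rewrite dot_pt -expr2.
  + move=> v; rewrite derive1E (@derive_val _ _ _ _ _ _ _ dd).
    have -> : v = pt (\row_j v 0 (lshift 1 j)) (v 0 (rshift n 0)).
      apply/rowP => i; case: (split_ordP i) => j ->; first by rewrite ptEl mxE.
      by rewrite ptEr (ord1 j).
    move=> /(tangent_Mlambda (ball t tI')) h.
    rewrite dot_pt dotZl -mulrA -h; ring.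
Qed.

Lemma geodesics_follow_bounces (x a : R -> R -> 'rV[R]_n) (z b : R -> R -> R)
    (T d0 : R) u0 gamma :
  0 < T -> T <= 1 -> T < rho -> f p0 = 0 ->
  (forall lambda, 0 < lambda -> [/\ forall t : R, `|t| <= T ->
      geodesic_at p0 f df d2f lambda (x lambda) (z lambda) (a lambda) (b lambda) t,
      x lambda 0 = p0 & a lambda 0 = tangential (df p0) u0]) ->
  gamma 0 = p0 ->
  (forall s t, 0 <= s -> s <= t -> t <= T -> `|gamma t - gamma s| <= t - s) ->
  (forall t, 0 <= t <= T -> 0 <= f (gamma t)) ->
  (forall t, 0 <= t < T -> bounces_at f df gamma t) ->
  0 < d0 -> (forall s, 0 <= s <= d0 -> gamma s = gamma 0 + s *: u0) ->
  forall t, 0 <= t <= T -> conv_thin (x^~ t) (gamma t).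
Proof.
move=> T0 T1 Trho fp0 fam g0 lip fpos bounce d00 fw0 t tI.
have [c [C geom]] := exists_bounded_geometry good.
pose m lambda (t : R) :=
  kappa df d2f lambda (x lambda t) (z lambda t) (a lambda t) (b lambda t) * lambda ^+ 2.
apply: (@geodesics_follow _ _ K p0 f df d2f e rho good c C geom T x a b m u0) => //.
- move=> lambda l0; have [G x0 a0] := fam lambda l0; split=> //.
  by apply: (geodesic_flow good l0 Trho G); rewrite ?oppr_le0 ?lexx// ltW.
- by rewrite g0.
- move=> {tI}t tI; have [u [v [d [[dd0 u1 v1 fw bw] [inn bd pos]]]]] := bounce t tI.
  exists u, d; split=> //.
  + by move=> s sI _; exact: fw.
  + by move=> ft s _; rewrite -(inn ft); exact: bw.
  + move=> ft; have [h1 _ [th vE]] := bd ft; split=> //.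
      move=> t0; rewrite t0 in fw; pose h := Num.min d d0.
      have h0 : 0 < h by rewrite lt_min dd0.
      apply: (@affine_unique _ _ gamma u u0 h 0); first by rewrite gt_eqF.
        by apply: fw; rewrite (ltW h0) add0r ge_min lexx.
      by rewrite subr0; apply: fw0; rewrite (ltW h0) ge_min lexx orbT.
    move=> _; exists th; first by move=> s _; rewrite -vE; exact: bw.
    move=> s _ /andP[s1 s2]; apply: pos; rewrite distrC gtr0_norm subr_gt0// s2/=.
    by rewrite lerBlDr -lerBlDl.
Qed.

End approximation.

Section table.
Context {R : realType} {n : nat}.
Variables (K : set 'rV[R]_n) (p0 : 'rV[R]_n) (f : 'rV[R]_n -> R)
  (df : 'rV[R]_n -> 'rV[R]_n) (d2f : 'rV[R]_n -> 'M[R]_n) (e : 'rV[R]_n) (rho : R).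
Hypothesis good : good_defining K p0 f df d2f e rho.

(** The vertical velocity sqrt (1 - |w|^2) makes up for the missing normal energy at p0. *)
Lemma exists_geodesic_family (T : R) (w : 'rV[R]_n) : 0 < T -> T < rho / 2 -> T <= 1 ->
  f p0 = 0 -> dot w w <= 1 -> dot w (df p0) = 0 ->
  exists (x : R -> R -> 'rV[R]_n) (z : R -> R -> R) (a : R -> R -> 'rV[R]_n) (b : R -> R -> R),
    forall lambda, 0 < lambda ->
    [/\ x lambda 0 = p0, z lambda 0 = 0, a lambda 0 = w & forall t : R, `|t| <= T ->
       geodesic_at p0 f df d2f lambda (x lambda) (z lambda) (a lambda) (b lambda) t].
Proof.
move=> T0 Trho T1 fp0 w1 wg; pose s := Num.sqrt (1 - dot w w).
have speed : dot w w + s ^+ 2 = 1 by rewrite sqr_sqrtr ?subr_ge0// addrC subrK.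
have H lambda : exists q : (R -> 'rV[R]_n) * (R -> R) * (R -> 'rV[R]_n) * (R -> R),
    0 < lambda -> [/\ q.1.1.1 0 = p0, q.1.1.2 0 = 0, q.1.2 0 = w & forall t : R, `|t| <= T ->
       geodesic_at p0 f df d2f lambda q.1.1.1 q.1.1.2 q.1.2 q.2 t].
  have [l0|l0] := ltP 0 lambda; last first.
    (* Dummy values for lambda <= 0, so that [choice] yields families indexed by all reals. *)
    by exists (cst 0, cst 0, cst 0, cst 0).
  have [x [z [a [b [x0 z0 a0 _ G]]]]] := exists_geodesic good l0 T0 Trho T1 fp0 speed wg.
  by exists (x, z, a, b).
have [q Hq] := choice H.
by exists (fun l => (q l).1.1.1), (fun l => (q l).1.1.2), (fun l => (q l).1.2), (fun l => (q l).2).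
Qed.

Lemma geodesic_pt_lip lambda (T : R) x z a b :
  (forall t : R, `|t| <= T -> geodesic_at p0 f df d2f lambda x z a b t) ->
  forall s t, - T <= s -> s <= t -> t <= T -> `|pt (x t) (z t) - pt (x s) (z s)| <= t - s.
Proof.
move=> G s t s0 st tT; rewrite -[leRHS]mul1r.
have sub r : s <= r <= t -> geodesic_at p0 f df d2f lambda x z a b r.
  by move=> /andP[sr rt]; apply: G; rewrite ler_norml (le_trans s0 sr) (le_trans rt).
apply: (@is_derive_row_lip R _ (fun r => pt (x r) (z r)) (fun r => pt (a r) (b r)) s t 1 st ler01) => r /sub[[_ sp _ _] [dx dz _ _]].
  exact: is_derive_pt.
by apply: norm_le_dot => //; rewrite dot_pt -expr2 sp expr1n.
Qed.

Lemma geodesic_height_le c C lambda (T : R) x z a b : bounded_geometry p0 f df d2f rho c C ->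
  f p0 = 0 -> 0 < lambda -> T <= 1 -> T < rho ->
  (forall t : R, `|t| <= T -> geodesic_at p0 f df d2f lambda x z a b t) ->
  forall t : R, `|t| <= T -> `|z t| <= C * lambda.
Proof.
move=> [_ C1 _ _ lip] fp0 l0 T1 Trho G t tT; have C0 : 0 < C by exact: lt_le_trans C1.
have [[xt _ zz _] _] := G t tT; have [[rho0 _ _ _] _] := good.
have pB : oball p0 rho p0 by rewrite /oball/= subrr normr0.
have xB : oball p0 rho (x t) by rewrite /oball/= (le_lt_trans xt)// (le_lt_trans tT).
have [h _] := lip _ _ pB xB.
have fC : f (x t) <= C.
  rewrite fp0 subr0 in h; rewrite (le_trans (ler_norm _))// (le_trans h)//.
  by rewrite ler_piMr// ?(ltW C0)// (le_trans xt)// (le_trans tT).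
rewrite -(@ler_pXn2r _ 2)// ?nnegrE ?mulr_ge0 ?(ltW C0) ?(ltW l0)// real_normK ?num_real//.
by rewrite zz exprMn mulrC ler_wpM2r ?sqr_ge0// (le_trans fC)// expr2 ler_peMl// ltW.
Qed.

(* Backwards in time the geodesics are those started at -w, the tangential part of -v. *)
Lemma geodesics_converge (T : R) (x a : R -> R -> 'rV[R]_n) (z b : R -> R -> R) gamma u v d :
  0 < T -> T <= 1 -> T < rho -> f p0 = 0 -> df p0 != 0 ->
  (forall lambda, 0 < lambda -> [/\ x lambda 0 = p0, z lambda 0 = 0,
      a lambda 0 = tangential (df p0) u & forall t : R, `|t| <= T ->
      geodesic_at p0 f df d2f lambda (x lambda) (z lambda) (a lambda) (b lambda) t]) ->
  gamma 0 = p0 ->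
  (forall s t, - T <= s -> s <= t -> t <= T -> `|gamma t - gamma s| <= t - s) ->
  (forall t, - T <= t <= T -> 0 <= f (gamma t)) ->
  (forall t, - T < t < T -> bounces_at f df gamma t) ->
  0 < d -> (forall s, 0 <= s <= d -> gamma s = gamma 0 + s *: u) ->
  (forall s, - d <= s <= 0 -> gamma s = gamma 0 + s *: v) ->
  (exists theta, v = u + theta *: df p0) ->
  forall t, - T <= t <= T -> conv_thin (x^~ t) (gamma t).
Proof.
move=> T0 T1 Trho fp0 g0 fam gam0 lip fpos bounce d0 fw bw [th vE] t /andP[Tt tT].
have [t0|t0] := leP 0 t.
  apply: (@geodesics_follow_bounces _ _ _ _ _ _ _ _ _ good x a z b T d u gamma) => //.
  - by move=> l /fam[].
  - by move=> r s r0 rs sT; apply: lip => //; lra.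
  - by move=> s /andP[s0 sT]; apply: fpos; rewrite sT andbT; lra.
  - by move=> s /andP[s0 sT]; apply: bounce; rewrite sT andbT; lra.
  - by rewrite t0.
rewrite -(opprK t).
apply: (@geodesics_follow_bounces _ _ _ _ _ _ _ _ _ good (fun l s => x l (- s))
  (fun l s => - a l (- s)) (fun l s => z l (- s)) (fun l s => - b l (- s)) T d (- v)
  (fun s => gamma (- s))) => //.
- move=> l /fam[x0 z0 a0 G]; rewrite oppr0; split=> //.
    move=> s sT; rewrite -(opprK s); apply: geodesic_at_reverse.
    have -> : (fun s => x l (- - s)) = x l by apply/funext => r; rewrite opprK.
    have -> : (fun s => z l (- - s)) = z l by apply/funext => r; rewrite opprK.
    have -> : (fun s => - - a l (- - s)) = a l by apply/funext => r; rewrite !opprK.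
    have -> : (fun s => - - b l (- - s)) = b l by apply/funext => r; rewrite !opprK.
    by apply: G; rewrite normrN.
  have -> : - v = (- 1) *: u + (- th) *: df p0 by rewrite vE scaleN1r scaleNr opprD.
  rewrite a0 tangentialD tangential_normal// addr0.
  by apply/rowP => i; rewrite /tangential !mxE dotZl; ring.
- by rewrite oppr0.
- move=> r s r0 rs sT; rewrite distrC (_ : s - r = - r - - s); last by ring.
  by apply: lip; lra.
- by move=> s /andP[s0 sT]; apply: fpos; apply/andP; split; lra.
- by move=> s /andP[s0 sT]; apply: bounces_at_reverse; apply: bounce; apply/andP; split; lra.
- move=> s /andP[s0 sd]; rewrite oppr0 bw; last by apply/andP; split; lra.
  by rewrite scalerN scaleNr.
- by apply/andP; split; lra.
Qed.

End table.

Theorem theorem1p2 (R : realType) (n : nat) (K : set 'rV[R]_n)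
    (hK : billiard_table K)
    (hconv : convex_set (K : set (convex_lmodType 'rV[R]_n)))
    (p0 : 'rV[R]_n) (hp0 : boundary K p0) :
  exists (U : set 'rV[R]_(n + 1)) (f : 'rV[R]_n -> R)
         (df : 'rV[R]_n -> 'rV[R]_n),
    defining_near K p0 U f df /\
    exists2 T : R, 0 < T &
      forall gamma : R -> 'rV[R]_n,
        billiard_trajectory K (- T) T gamma ->
        gamma 0 = p0 ->
        transversal_at K gamma 0 ->
        exists (lambda_ : nat -> R) (gamma_ : nat -> R -> 'rV[R]_(n + 1)),
          [/\ forall k, 0 < lambda_ k < 1,
              lambda_ k @[k --> \oo] --> (0 : R),
              forall k, unit_geodesic_segment
                          (Mlambda K U f (lambda_ k)) (- T) T (gamma_ k),
              forall k, gamma_ k 0 = emb p0 &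
              {uniform `[- T, T], gamma_ @ \oo --> (fun t => emb (gamma t))}].

Proof.
have [[K0 [oK0 _ KK0]] _] := hK; have cK := convex_setP hconv.
have clK : closed K by rewrite KK0; exact: closed_closure.
have near_int q (Kq : K q) := closure_interior_near oK0 KK0 Kq.
have [Kp0 _] := (boundary_closed p0 clK).1 hp0.
have [f [df [d2f [e [rho good]]]]] := exists_good_defining hK hconv hp0.
have [[rho0 fK fbd dfe] _] := good.
have half0 : oball p0 (rho / 2) p0 by rewrite /oball/= subrr normr0 divr_gt0.
have ball0 : oball p0 rho p0 by rewrite /oball/= subrr normr0.
have fp0 : f p0 = 0 by exact/(fbd _ ball0).
have g0 : df p0 != 0.
  apply/negP => /eqP h.
  by have := dfe _ ball0; rewrite h dot0l => /esym/eqP; rewrite oner_eq0.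
exists (good_nbhd p0 (rho / 2)), f, df; split.
  exact: (defining_near_good clK cK (near_int _ Kp0) good half0).
(* T depends on rho alone, hence serves all trajectories: at unit speed everything stays within rho
   / 4 of p0. *)
pose T := Num.min (rho / 4) 1.
have T0 : 0 < T by rewrite lt_min divr_gt0 ?ltr01.
have T1 : T <= 1 by rewrite ge_min lexx orbT.
have T4 : T <= rho / 4 by rewrite ge_min lexx.
have Trho2 : T < rho / 2 by lra.
have Trho : T < rho by lra.
exists T => // gamma traj gam0 _.
have lip := trajectory_lip traj.
have bounce := trajectory_bounces clK cK near_int Kp0 good T0 Trho2 traj gam0.
have [u [v [d [[d0 u1 v1 fw bw] [_ bd _]]]]] := bounce 0 ltac:(by rewrite oppr_lt0 T0).
have [_ _ vu] : [/\ 0 < dot u (df (gamma 0)), dot v (df (gamma 0)) < 0 &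
    exists theta, v = u + theta *: df (gamma 0)] by apply: bd; rewrite gam0.
rewrite gam0 in vu.
pose w := tangential (df p0) u.
have w1 : dot w w <= 1 by rewrite -u1; exact: tangential_le.
have wg : dot w (df p0) = 0 by exact: dot_tangential.
have [x [z [a [b fam]]]] := exists_geodesic_family good T0 Trho2 T1 fp0 w1 wg.
have [c [C geom]] := exists_bounded_geometry good.
(* [harmonic 0] is 1, so the sequence is halved to stay below 1. *)
pose h (k : nat) : R := harmonic k / 2.
have h0 k : 0 < h k by rewrite divr_gt0 ?harmonic_gt0.
have hlim : h k @[k --> \oo] --> (0 : R).
  by rewrite -(mul0r (2^-1 : R)); apply: cvgMl; exact: cvg_harmonic.
exists h, (fun k t => pt (x (h k) t) (z (h k) t)); split=> //.
- move=> k; rewrite h0 /h /harmonic/= ltr_pdivrMr// mul1r.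
  by apply: (@le_lt_trans _ _ 1); [rewrite invf_le1// ler1n|rewrite ltr1n].
- move=> k; have [_ _ _ G] := fam _ (h0 k).
  exact: (geodesic_segment good (h0 k) T0 Trho2 G).
- by move=> k; have [-> -> _ _] := fam _ (h0 k).
apply: lipschitz_pointwise_uniform => //.
- by rewrite ge0_cp// ltW.
- by move=> k; have [_ _ _ G] := fam _ (h0 k); exact: (geodesic_pt_lip G).
- move=> s t s0 st tT; rewrite /emb ptB subrr norm_pt_le ?subr_ge0//.
  by rewrite normr0 subr_ge0 st andbT; exact: lip.
move=> t tI eta eta0.
have KT s : - T <= s <= T -> 0 <= f (gamma s).
  move=> sI; apply/fK; last by have [Kc _] := traj; exact: Kc.
  rewrite /oball/= -gam0; case/andP: sI => s1 s2; have [s0|s0] := leP 0 s.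
    by have := lip 0 s ltac:(by rewrite oppr_le0 ltW) s0 s2; lra.
  by have := lip s 0 s1 (ltW s0) (ltW T0); rewrite distrC; lra.
have xt : conv_thin (x^~ t) (gamma t).
  apply: (@geodesics_converge _ _ _ _ _ _ _ _ _ good T x a z b gamma u v d) => //.
  - by move=> s sI; rewrite fw ?subr0// add0r.
  - by move=> s sI; rewrite bw ?subr0// sub0r.
apply: (near_at_right_sequence (P := fun l => `|pt (x l t) (z l t) - emb (gamma t)| <= eta) h0 hlim).
near=> l.
have l0 : 0 < l by near: l; exact: nbhs_right_gt.
have [_ _ _ G] := fam l l0.
have tT : `|t| <= T by rewrite ler_norml.
rewrite /emb ptB subr0 norm_pt_le ?(ltW eta0)//; apply/andP; split.
  by near: l; exact: xt.
apply: (le_trans (geodesic_height_le good geom fp0 l0 T1 Trho G tT)).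
by near: l; exact: near_mul_le.
Unshelve. all: by end_near. Qed.
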